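(* For positive integers $m,k$ define power series by \[ \sum_{n\ge0}\mu_{m,k}(n)q^n=\frac{(q^k;q^{2k})_{\infty}^{mk}}{(q;q^2)_{\infty}^m},\qquad \sum_{n\ge0}\nu_{m,k}(n)q^n=\frac{(q;q^2)_{\infty}^{mk}}{(q^k;q^{2k})_{\infty}^m}, \] \[ \sum_{n\ge0}\eta_{k}(n)q^n=\frac{(q;q^2)_{\infty}^{3}(q^9;q^{18})_{\infty}^{3}}{(q^3;q^{6})_{\infty}^{2k}},\qquad \sum_{n\ge0}\zeta_{m,k}(n)q^n=(q;q^{2})_{\infty}^k(q^m;q^{2m})_{\infty}^k, \] \[ \sum_{n\ge0}\theta_1(n)q^n=(q;q^{2})_{\infty}(q^3;q^{6})_{\infty}(q^5;q^{10})_{\infty}(q^{15};q^{30})_{\infty},\qquad \sum_{n\ge0}\theta_2(n)q^n=\frac{(q;q^{2})_{\infty}}{(q^{25};q^{50})_{\infty}}, \] and for each of these series denote by a prime (e.g. $\mu'_{m,k}(n)$) the coefficient of $q^n$ in its reciprocal. Then for all $n\ge0$: (i) $\mu_{1,3}(2n+1)=\mu'_{1,3}(n)$; (ii) $\mu_{3,3}(2n+3)=4\mu'_{3,3}(n)$; (iii) $\mu_{1,5}(2n+3)=2\mu'_{1,5}(n)$; (iv) $\nu_{1,3}(2n)=\nu'_{1,3}(n)$; (v) $\nu_{1,5}(2n+2)=2\nu'_{1,5}(n+1)$; (vi) $\nu_{3,3}(2n)=4\nu'_{3,3}(n)$; (vii) $\eta_{1}(2n+3)=-2\eta'_{1}(n)$;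 (viii) $2\eta_{5}(n)=-\eta'_{5}(2n)$; (ix) $\zeta_{3,2}(2n+1)=-2\zeta'_{3,2}(n)$; (x) $\zeta_{5,4}(2n+3)=-8\zeta'_{5,4}(n)$; (xi) $\zeta_{7,1}(2n+1)=-\zeta'_{7,1}(n)$; (xii) $\zeta_{7,3}(2n+3)=-4\zeta'_{7,3}(n)$; (xiii) $\zeta_{11,2}(2n+3)=-2\zeta'_{11,2}(n)$; (xiv) $\zeta_{23,1}(2n+3)=-\zeta'_{23,1}(n)$; (xv) $\theta_1(2n+3)=-2\theta'_1(n)$; (xvi) $2\theta_2(10n+3)=-\theta'_2(5n+3)$; (xvii) $2\theta_2(10n+5)=-\theta'_2(5n+4)$.
   Context: $(a;q)_\infty=\prod_{j\ge0}(1-aq^j)$, $q$ a formal variable (or complex with $|q|<1$). All the series have constant term $1$, so their reciprocals are power series.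
   Formalization: Items (vi) and (viii) are stated only for n ≥ 1: at n = 0 they would read 1 = 4 and 2 = −1, since all the series have constant term 1; all other items are stated for all n ≥ 0. *)

(* Defs.v *)
From HB Require Import structures.
From mathcomp Require Import all_boot all_order all_algebra.
From mathcomp Require Import boolp.

Set Implicit Arguments.
Unset Strict Implicit.
Unset Printing Implicit Defensive.

Import GRing.Theory.
Local Open Scope ring_scope.

(* The ring of formal power series R[[q]], as coefficient sequences with the
   Cauchy product; the application [f n] is the coefficient of q^n in [f]. *)
Record fps (R : Type) := Fps { fps_coef :> nat -> R }.

HB.instance Definition _ (R : Type) := gen_eqMixin (fps R).
HB.instance Definition _ (R : Type) := gen_choiceMixin (fps R).

Lemma fpsP (R : Type) (f g : fps R) : (forall n, f n = g n) -> f = g.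
Proof. by case: f g => [f] [g] /= fg; congr Fps; apply/funext. Qed.

Section FpsRing.
Variable R : comUnitRingType.
Implicit Types (f g h u : fps R) (p r : {poly R}).

Definition fps_zero : fps R := Fps (fun=> 0).
Definition fps_opp f : fps R := Fps (fun n => - f n).
Definition fps_add f g : fps R := Fps (fun n => f n + g n).

Fact fps_addA : associative fps_add.
Proof. by move=> f g h; apply: fpsP => n /=; rewrite addrA. Qed.
Fact fps_addC : commutative fps_add.
Proof. by move=> f g; apply: fpsP => n /=; rewrite addrC. Qed.
Fact fps_add0 : left_id fps_zero fps_add.
Proof. by move=> f; apply: fpsP => n /=; rewrite add0r. Qed.
Fact fps_addN : left_inverse fps_zero fps_opp fps_add.
Proof. by move=> f; apply: fpsP => n /=; rewrite addNr. Qed.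

HB.instance Definition _ :=
  GRing.isZmodule.Build (fps R) fps_addA fps_addC fps_add0 fps_addN.

Definition fps_one : fps R := Fps (fun n => (n == 0%N)%:R).
Definition fps_mul f g : fps R :=
  Fps (fun n => \sum_(i < n.+1) f i * g (n - i)%N).

Let agree n f p := forall i, (i <= n)%N -> f i = p`_i.
Let trunc n f : {poly R} := \poly_(i < n.+1) f i.

Fact fps_agree_trunc n f : agree n f (trunc n f).
Proof. by move=> i lein; rewrite coef_poly ltnS lein. Qed.

Fact fps_agree_mul n f g p r :
  agree n f p -> agree n g r -> agree n (fps_mul f g) (p * r).
Proof.
move=> fp gr i lein /=; rewrite coefM; apply: eq_bigr => j _.
have leji : (j <= i)%N by rewrite -ltnS.
by rewrite fp ?(leq_trans leji) // gr // (leq_trans (leq_subr _ _)).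
Qed.

Fact fps_mulA : associative fps_mul.
Proof.
move=> f g h; apply: fpsP => n; have T := @fps_agree_trunc n.
by rewrite (fps_agree_mul (T f) (fps_agree_mul (T g) (T h))) //
           (fps_agree_mul (fps_agree_mul (T f) (T g)) (T h)) // mulrA.
Qed.

Fact fps_mulC : commutative fps_mul.
Proof.
move=> f g; apply: fpsP => n; have T := @fps_agree_trunc n.
by rewrite (fps_agree_mul (T f) (T g)) // (fps_agree_mul (T g) (T f)) // mulrC.
Qed.

Fact fps_mul1 : left_id fps_one fps_mul.
Proof.
move=> f; apply: fpsP => n /=; rewrite big_ord_recl /= mul1r subn0.
by rewrite big1 ?addr0 // => i _; rewrite mul0r.
Qed.

Fact fps_mulDl : left_distributive fps_mul fps_add.
Proof.
move=> f g h; apply: fpsP => n /=; rewrite -big_split /=.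
by apply: eq_bigr => i _; rewrite mulrDl.
Qed.

Fact fps_one_neq0 : fps_one != fps_zero.
Proof.
apply/eqP => /(congr1 (fun f : fps R => f 0%N)) /= /eqP.
by rewrite oner_eq0.
Qed.

HB.instance Definition _ := GRing.Zmodule_isComNzRing.Build (fps R)
  fps_mulA fps_mulC fps_mul1 fps_mulDl fps_one_neq0.

Lemma fps_coef0 n : (0 : fps R) n = 0. Proof. by []. Qed.
Lemma fps_coef1 n : (1 : fps R) n = (n == 0%N)%:R. Proof. by []. Qed.
Lemma fps_coefD f g n : (f + g) n = f n + g n. Proof. by []. Qed.
Lemma fps_coefN f n : (- f) n = - f n. Proof. by []. Qed.
Lemma fps_coefB f g n : (f - g) n = f n - g n. Proof. by []. Qed.
Lemma fps_coefM f g n : (f * g) n = \sum_(i < n.+1) f i * g (n - i)%N.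
Proof. by []. Qed.
Lemma fps_coefM0 f g : (f * g) 0%N = f 0%N * g 0%N.
Proof. by rewrite fps_coefM big_ord1. Qed.

Lemma fps_coef_exp_small u j n : u 0%N = 0 -> (n < j)%N -> (u ^+ j) n = 0.
Proof.
move=> u0; elim: j n => [|j IHj] n //; rewrite ltnS => lenj.
rewrite exprS fps_coefM big_ord_recl u0 mul0r add0r big1 // => i _.
rewrite IHj ?mulr0 // lift0; apply: leq_trans lenj.
by rewrite subnSK ?leq_subr.
Qed.

Lemma fps_coefM_small f g n :
  (forall i, (i <= n)%N -> g i = 0) -> (f * g) n = 0.
Proof.
by move=> g0; rewrite fps_coefM big1 // => i _; rewrite g0 ?mulr0 ?leq_subr.
Qed.

Definition fpsC (c : R) : fps R := Fps (fun n => if n == 0%N then c else 0).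

Lemma fps_coefCM c f n : (fpsC c * f) n = c * f n.
Proof.
rewrite fps_coefM big_ord_recl /= subn0 big1 ?addr0 // => i _.
by rewrite mul0r.
Qed.

(* With c the constant term of f and u = 1 - c^-1 f, the inverse of f is
   c^-1 * (1 + u + u^2 + ...), and u^j contributes only in degrees >= j. *)
Definition fps_unit : pred (fps R) := fun f => f 0%N \is a GRing.unit.
Definition fps_inv f : fps R :=
  if fps_unit f then
    let c := (f 0%N)^-1 in
    Fps (fun n => c * (\sum_(j < n.+1) (1 - fpsC c * f) ^+ j) n)
  else f.

Fact fps_mulV : {in fps_unit, left_inverse 1 fps_inv *%R}.
Proof.
move=> f fU; rewrite /fps_inv -/(fps_unit f) [fps_unit f]fU.
rewrite unfold_in /fps_unit in fU; move cE: (f 0%N)^-1 => c /=.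
set u := 1 - fpsC c * f.
have u0 : u 0%N = 0.
  by rewrite /u fps_coefB fps_coefCM fps_coef1 -cE mulVr // subrr.
have stab n i : (i <= n)%N ->
    (\sum_(j < i.+1) u ^+ j) i = (\sum_(j < n.+1) u ^+ j) i.
  move=> /subnKC <-; elim: (n - i)%N => [|d IHd]; first by rewrite addn0.
  rewrite addnS [in RHS]big_ord_recr fps_coefD -IHd fps_coef_exp_small ?addr0 //.
  by rewrite ltnS leq_addr.
apply: fpsP => n; rewrite mulrC.
transitivity ((f * (fpsC c * \sum_(j < n.+1) u ^+ j)) n).
  rewrite !fps_coefM; apply: eq_bigr => i _; rewrite fps_coefCM /=.
  by rewrite (stab n) // leq_subr.
have -> : f * (fpsC c * \sum_(j < n.+1) u ^+ j) = 1 - u ^+ n.+1.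
  rewrite mulrCA mulrA -[fpsC c * f](subKr 1) -/u -opprB mulNr -subrX1.
  by rewrite opprB.
by rewrite fps_coefB fps_coef_exp_small // subr0.
Qed.

Fact fps_unitP f g : g * f = 1 -> fps_unit f.
Proof.
move=> gf1; have : (g * f) 0%N = 1 by rewrite gf1.
by rewrite fps_coefM0 => gf01; apply/unitrP; exists (g 0%N); split; last rewrite mulrC.
Qed.

Fact fps_inv_out : {in [predC fps_unit], fps_inv =1 id}.
Proof. by move=> f /negbTE fU; rewrite /fps_inv -/(fps_unit f) [fps_unit f]fU. Qed.

HB.instance Definition _ := GRing.ComNzRing_hasMulInverse.Build (fps R)
  fps_mulV fps_unitP fps_inv_out.

Lemma fps_unitE f : (f \is a GRing.unit) = (f 0%N \is a GRing.unit).
Proof. by []. Qed.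

Definition fpsX : fps R := Fps (fun n => (n == 1%N)%:R).

(* (a; r)_oo = \prod_(j >= 0) (1 - a r^j) for a series r without constant term:
   the factors with j > n do not affect the coefficient of q^n
   (see [qpoch_stable]). *)
Definition qpoch (a r : fps R) : fps R :=
  Fps (fun n => (\prod_(j < n.+1) (1 - a * r ^+ j)) n).

Lemma qpoch_stable (a r : fps R) n N : r 0%N = 0 -> (n < N)%N ->
  (\prod_(j < N) (1 - a * r ^+ j)) n = qpoch a r n.
Proof.
move=> r0 /subnKC <-; elim: (N - n.+1)%N => [|d IHd]; first by rewrite addn0.
have -> : \prod_(j < n.+1 + d.+1) (1 - a * r ^+ j) =
    \prod_(j < n.+1 + d) (1 - a * r ^+ j) * (1 - a * r ^+ (n.+1 + d)).
  by rewrite addnS big_ord_recr.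
rewrite mulrBr mulr1 fps_coefB IHd fps_coefM_small ?subr0 //.
move=> i lein; rewrite fps_coefM_small // => k leki; apply: fps_coef_exp_small => //.
by rewrite (leq_ltn_trans leki) // (leq_ltn_trans lein) // leq_addr.
Qed.

Lemma qpoch_coef0 (a r : fps R) : a 0%N = 0 -> qpoch a r 0%N = 1.
Proof.
move=> a0 /=.
by rewrite big_ord1 expr0 mulr1 fps_coefB a0 subr0.
Qed.

End FpsRing.

Local Notation q := (fpsX int).

Definition mu (m k : nat) : fps int :=
  qpoch (q ^+ k) (q ^+ (2 * k)) ^+ (m * k) / qpoch q (q ^+ 2) ^+ m.

Definition nu (m k : nat) : fps int :=
  qpoch q (q ^+ 2) ^+ (m * k) / qpoch (q ^+ k) (q ^+ (2 * k)) ^+ m.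

Definition eta (k : nat) : fps int :=
  qpoch q (q ^+ 2) ^+ 3 * qpoch (q ^+ 9) (q ^+ 18) ^+ 3
  / qpoch (q ^+ 3) (q ^+ 6) ^+ (2 * k).

Definition zeta (m k : nat) : fps int :=
  qpoch q (q ^+ 2) ^+ k * qpoch (q ^+ m) (q ^+ (2 * m)) ^+ k.

Definition theta1 : fps int :=
  qpoch q (q ^+ 2) * qpoch (q ^+ 3) (q ^+ 6) *
  qpoch (q ^+ 5) (q ^+ 10) * qpoch (q ^+ 15) (q ^+ 30).

Definition theta2 : fps int :=
  qpoch q (q ^+ 2) / qpoch (q ^+ 25) (q ^+ 50).

(* Main.v *)
From HB Require Import structures.
Require Import Defs.
From mathcomp Require Import all_boot all_order all_algebra.
From mathcomp Require Import boolp classical_sets cardinality fsbigop.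
From mathcomp Require Import zify ring.

(* Write x_k = (q^k; q^{2k})_oo and let a minus sign denote q |-> -q.  Items (i)-(xv)
   read off the coefficients of one parity in an identity
     F - F^- = c q + d q^j / F(q^2)   or   F + F^- = c + d / F(q^2)
   for the series F in question (its reciprocal in (viii)); the last two come from
     q^3 (F - F^-) + 1 / F(q^2) = C + q^2 - q^4 / C,   C a power series in q^10.
   Since x_k x_k^- = x_{2k}, these identities follow by elimination from modular
   equations of level 3, 5, 7, 9, 11, 15, 23 and 25 between theta functions.  By the
   Jacobi triple product the theta products are double series indexed by Z^2, and
   every modular equation needed comes from splitting Z^2 into cosets of a sublattice
   and changing variables.  At levels 15 and 25 three quotients of theta functions are
   the roots of one cubic, and Vieta's formulas give the identity. *)

Set Implicit Arguments.
Unset Strict Implicit.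
Unset Printing Implicit Defensive.

Import GRing.Theory.
Local Open Scope ring_scope.

(** Each series F of (i)-(xv), with its reciprocal in (viii), satisfies F F^- = F(q^2), so an
    identity for F - F^- or F + F^- says that F is a root of a quadratic equation whose coefficients
    are rational in q and F(q^2). The obstacle is that the theta identities involve several products
    at once while the final identity involves one series: the others have to be eliminated, which
    means dividing by q, by small integers and by sums such as V + q. So Z[[q]] is shown to be an
    integral domain and the elimination takes place in its field of fractions, where nonvanishing is
    mostly read off from constant terms; the results descend because the embedding is injective. On
    a coset of the sublattice the exponent is again a quadratic polynomial in the new variables, so
    two cosets are compared term by term. The cosets that match nothing have exponents of the wrong
    parity, cancel against another coset, or cancel internally under a sign-reversing involution. *)

Section Congruence.
Variable R : comUnitRingType.
Implicit Types f g h : fps R.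

Definition eqfps (K : nat) f g := forall n, (n < K)%N -> f n = g n.

Lemma eqfps_refl K f : eqfps K f f. Proof. by []. Qed.

Lemma eqfps_sym K f g : eqfps K f g -> eqfps K g f.
Proof. by move=> fg n nK; rewrite fg. Qed.

Lemma eqfps_trans K f g h : eqfps K f g -> eqfps K g h -> eqfps K f h.
Proof. by move=> fg gh n nK; rewrite fg // gh. Qed.

Lemma eqfpsM K f f' g g' :
  eqfps K f f' -> eqfps K g g' -> eqfps K (f * g) (f' * g').
Proof.
move=> ff gg n nK; rewrite !fps_coefM; apply: eq_bigr => i _.
have := ltn_ord i; rewrite ltnS => lein.
rewrite ff ?(leq_ltn_trans lein) // gg //.
exact: leq_ltn_trans (leq_subr _ _) nK.
Qed.

Lemma fps_coef_sum (I : Type) (r : seq I) (P : pred I) (F : I -> fps R) n :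
  (\sum_(i <- r | P i) F i) n = \sum_(i <- r | P i) F i n.
Proof. by apply: (big_morph (fun f : fps R => f n)). Qed.

Lemma eqfps_qpoch (a r : fps R) K N : r 0%N = 0 -> (K <= N)%N ->
  eqfps K (\prod_(j < N) (1 - a * r ^+ j)) (qpoch a r).
Proof. by move=> r0 KN n nK; rewrite qpoch_stable // (leq_trans nK). Qed.

(** The partial products need only be controlled for arbitrarily large [N], which lets a dissection
    use multiples of the number of classes. *)
Lemma qpochP (a r f : fps R) : r 0%N = 0 ->
  (forall K, exists2 N, (K <= N)%N & eqfps K (\prod_(j < N) (1 - a * r ^+ j)) f) ->
  qpoch a r = f.
Proof.
move=> r0 H; apply: fpsP => n; have [N leN eqN] := H n.+1.
by rewrite -eqN // qpoch_stable.
Qed.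

Lemma fps_unit1 f : f 0%N = 1 -> f \is a GRing.unit.
Proof. by move=> f0; rewrite fps_unitE f0 unitr1. Qed.

Lemma fps_exp0 f k : f 0%N = 0 -> (0 < k)%N -> (f ^+ k) 0%N = 0.
Proof. by move=> f0 k0; apply: fps_coef_exp_small. Qed.

Lemma fps_coefM_smalll f g n :
  (forall i, (i <= n)%N -> f i = 0) -> (f * g) n = 0.
Proof. by move=> f0; rewrite mulrC fps_coefM_small. Qed.

Lemma fpsM_order f g a b n : (forall i, (i < a)%N -> f i = 0) ->
  (forall i, (i < b)%N -> g i = 0) -> (n < a + b)%N -> (f * g) n = 0.
Proof.
move=> f0 g0 nab; rewrite fps_coefM; apply: big1 => i _.
have [/f0->|ged] := ltnP i a; first by rewrite mul0r.
by rewrite (g0 (n - i)%N) ?mulr0 //; have := ltn_ord i; lia.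
Qed.

(** The factors 1 - a r^j are grouped by the residue of j modulo [m.+1]. *)
Lemma qpoch_dissect m (a r : fps R) : r 0%N = 0 ->
  qpoch a r = \prod_(i < m.+1) qpoch (a * r ^+ i) (r ^+ m.+1).
Proof.
move=> r0; apply: qpochP => // K; exists (K * m.+1)%N; first by rewrite leq_pmulr.
have -> : \prod_(j < K * m.+1) (1 - a * r ^+ j) =
    \prod_(i < m.+1) \prod_(j < K) (1 - a * r ^+ i * (r ^+ m.+1) ^+ j).
  rewrite exchange_big /=; elim: K => [|K IH]; first by rewrite !big_ord0.
  rewrite [RHS]big_ord_recr /= -IH mulSnr big_split_ord /=; congr (_ * _).
  by apply: eq_bigr => i _; rewrite -mulrA -exprM -exprD addnC (mulnC K).
have Rm0 : (r ^+ m.+1) 0%N = 0 by rewrite fps_exp0.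
elim: (index_enum _) => [|i s IH]; first by rewrite !big_nil.
by rewrite !big_cons; apply: eqfpsM => //; apply: eqfps_qpoch.
Qed.

Lemma qpoch_sqr (a r : fps R) : r 0%N = 0 ->
  qpoch a r * qpoch (- a) r = qpoch (a ^+ 2) (r ^+ 2).
Proof.
move=> r0; apply/esym/qpochP => [|K]; first by rewrite fps_exp0.
exists K => // n nK.
rewrite -(eqfpsM (eqfps_qpoch a r0 (leqnn K)) (eqfps_qpoch (- a) r0 (leqnn K)) nK).
rewrite -big_split /=; congr (fps_coef _ n); apply: eq_bigr => i _.
by rewrite -exprM mulnC exprM; ring.
Qed.

End Congruence.

(** The absolute value changes nothing, as m(m-1) is nonnegative for every integer m; it only makes
    the value usable as an exponent. *)
Definition tri (m : int) : nat := `|((m * (m - 1)) %/ 2)%Z|%N.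

Lemma tri2 m : 2 * (tri m)%:Z = m * (m - 1).
Proof.
rewrite /tri; have [k [->|->]] : exists k, m = 2 * k \/ m = 2 * k + 1.
- by exists (m %/ 2)%Z; lia.
- by rewrite -mulrA mulKz //; nia.
- by rewrite addrK mulrCA mulKz //; nia.
Qed.

Lemma triD m : (tri (m + 1) + tri m)%N = (`|m| ^ 2)%N.
Proof. have := tri2 m; have := tri2 (m + 1); nia. Qed.

(** * Infinite sums of power series, coefficient by coefficient *)

Section FormalSum.
Variables (R : comUnitRingType).

Definition locfin (I : eqType) (e : I -> nat) :=
  forall n, exists r : seq I, forall i, i \notin r -> (n < e i)%N.

(** Each coefficient is a finitely supported sum, whose default value is 0 when the support is
    infinite; hence [summable] appears as a hypothesis wherever the sum has to be meaningful. *)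
Definition fsum (I : choiceType) (F : I -> fps R) : fps R :=
  Fps (fun n => \sum_(i \in [set: I]) F i n)%R.

Lemma fsumE (I : choiceType) (F : I -> fps R) (r : seq I) n : uniq r ->
  (forall i, i \notin r -> F i n = 0) -> fsum F n = \sum_(i <- r) F i n.
Proof.
move=> ur Fr; rewrite /fsum /= (fsbigE _ _ ur) //; last by move=> i _; exact: Fr.
by apply: eq_bigl => i; rewrite in_setT.
Qed.

Definition summable (I : choiceType) (F : I -> fps R) :=
  forall n, exists r : seq I, forall i, i \notin r -> forall k, (k <= n)%N -> F i k = 0.

Lemma summable_uniq (I : choiceType) (F : I -> fps R) n : summable F ->
  exists2 r : seq I, uniq r & forall i, i \notin r -> forall k, (k <= n)%N -> F i k = 0.
Proof.
move=> /(_ n)[r rP]; exists (undup r); first exact: undup_uniq.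
by move=> i; rewrite mem_undup => /rP.
Qed.

Lemma eq_fsum (I : choiceType) (F G : I -> fps R) : F =1 G -> fsum F = fsum G.
Proof. by move=> FG; apply: fpsP => n /=; apply: eq_fsbigr => i _; rewrite FG. Qed.

Lemma fsumM (I J : choiceType) (F : I -> fps R) (G : J -> fps R) :
  summable F -> summable G ->
  fsum F * fsum G = fsum (fun p : I * J => F p.1 * G p.2).
Proof.
move=> sF sG; apply: fpsP => n.
have [r ur rP] := summable_uniq n sF; have [t ut tP] := summable_uniq n sG.
rewrite (@fsumE _ _ [seq (i, j) | i <- r, j <- t]); first last.
- move=> [i j] /negP nij.
  have [ir|/rP Fi0] := boolP (i \in r); last exact: fps_coefM_smalll.
  have [jt|/tP Gj0] := boolP (j \in t); last exact: fps_coefM_small.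
  by case: nij; apply/allpairsP; exists (i, j).
- by rewrite allpairs_uniq // => -[? ?] [? ?].
rewrite fps_coefM big_allpairs_dep.
transitivity (\sum_(k < n.+1) (\sum_(i <- r) \sum_(j <- t) F i k * G j (n - k)%N)).
  apply: eq_bigr => k _; rewrite (fsumE ur) ?(fsumE ut).
  - by rewrite mulr_suml; apply: eq_bigr => i _; rewrite mulr_sumr.
  - by move=> i /tP -> //; rewrite leq_subr.
  - by move=> i /rP -> //; rewrite -ltnS.
rewrite exchange_big; apply: eq_bigr => i _; rewrite exchange_big.
by apply: eq_bigr => j _; rewrite fps_coefM.
Qed.

Lemma fsumD (I : choiceType) (F G : I -> fps R) : summable F -> summable G ->
  fsum F + fsum G = fsum (fun i => F i + G i).
Proof.
move=> sF sG; apply: fpsP => n; rewrite fps_coefD.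
have [r rP] := sF n; have [t tP] := sG n.
have ur := undup_uniq (r ++ t).
have rtP i : i \notin undup (r ++ t) -> F i n = 0 /\ G i n = 0.
  by rewrite mem_undup mem_cat negb_or => /andP[/rP-> // /tP->].
rewrite (fsumE (F := F) ur) => [|i /rtP[] //].
rewrite (fsumE (F := G) ur) => [|i /rtP[] //].
rewrite (fsumE ur) -?big_split // => i /rtP[Fi Gi].
by rewrite fps_coefD Fi Gi addr0.
Qed.

Lemma fsumMl (I : choiceType) (c : fps R) (F : I -> fps R) : summable F ->
  c * fsum F = fsum (fun i => c * F i).
Proof.
move=> sF; apply: fpsP => n; have [r ur rP] := summable_uniq n sF.
rewrite (fsumE ur); last first.
  by move=> i /rP Fi; rewrite fps_coefM_small.
rewrite fps_coefM; under [RHS]eq_bigr do rewrite fps_coefM.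
rewrite [RHS]exchange_big; apply: eq_bigr => k _; rewrite (fsumE ur).
  by rewrite mulr_sumr.
by move=> i /rP -> //; rewrite leq_subr.
Qed.

(* [c] is the classifying map of a partition of [I] into [K] classes, the k-th
   of which is parametrized bijectively by [h k], with inverse [g k]. *)
Lemma fsum_split (I J : choiceType) (K : nat) (c : I -> nat) (h : nat -> J -> I)
    (g : nat -> I -> J) (F : I -> fps R) :
  summable F -> (forall i, (c i < K)%N /\ h (c i) (g (c i) i) = i) ->
  (forall k j, (k < K)%N -> c (h k j) = k /\ g k (h k j) = j) ->
  fsum F = \sum_(k < K) fsum (F \o h k).
Proof.
move=> sF hg ch; apply: fpsP => n; have [r ur rP] := summable_uniq n sF.
rewrite fps_coef_sum (fsumE ur); last by move=> i /rP ->.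
rewrite (eq_bigr (fun k : 'I_K => \sum_(i <- r | c i == k) F i n)).
  rewrite (exchange_big_dep xpredT) //=; apply: eq_bigr => i _.
  by rewrite (big_pred1 (Ordinal (hg i).1)) // => k; rewrite eq_sym.
move=> k _; rewrite (@fsumE _ _ [seq g k i | i <- r & c i == k]).
- rewrite big_map big_filter; apply: eq_bigr => i /eqP ci /=.
  by rewrite -ci (hg i).2.
- rewrite map_inj_in_uniq ?filter_uniq // => i j.
  rewrite !mem_filter => /andP[/eqP ci _] /andP[/eqP cj _] gij.
  by rewrite -(hg i).2 -(hg j).2 ci cj gij.
- move=> j /negP jr /=; rewrite rP //; apply/negP => hr; apply: jr.
  apply/mapP; exists (h k j); last by rewrite (ch k j (ltn_ord k)).2.
  by rewrite mem_filter hr (ch k j (ltn_ord k)).1 eqxx.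
Qed.

End FormalSum.

(** * The Jacobi triple product *)

Definition int_range (n : nat) : seq int :=
  [seq k%:Z - n%:Z | k <- iota 0 (2 * n).+1].

Lemma mem_int_range n m : (m \in int_range n) = (`|m| <= n)%N.
Proof.
apply/mapP/idP => [[k]|mn]; first by rewrite mem_iota => kn ->; lia.
by exists (absz (m + n%:Z)); first rewrite mem_iota; lia.
Qed.

Lemma int_range_uniq n : uniq (int_range n).
Proof. by rewrite map_inj_uniq ?iota_uniq // => i j; lia. Qed.

Section JacobiTripleProduct.
Variable R : comUnitRingType.
Implicit Types A B r : fps R.

(** Ramanujan's general theta function f(A, B), the sum over Z of A^(m(m+1)/2) B^(m(m-1)/2). By
    [triD] its m-th term has order at least m^2. *)
Definition th A B : fps R := fsum (fun m : int => A ^+ tri (m + 1) * B ^+ tri m).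

Lemma th_term_order A B m n : A 0%N = 0 -> B 0%N = 0 -> (n < `|m| ^ 2)%N ->
  (A ^+ tri (m + 1) * B ^+ tri m) n = 0.
Proof.
move=> A0 B0 nm.
apply: (@fpsM_order _ _ _ (tri (m + 1)) (tri m)); last by rewrite triD.
- by move=> i; apply: fps_coef_exp_small.
- by move=> i; apply: fps_coef_exp_small.
Qed.

Definition fact_poch r n : fps R := \prod_(j < n) (1 - r ^+ j.+1).

Lemma fact_poch_unit r n : r 0%N = 0 -> fact_poch r n \is a GRing.unit.
Proof.
move=> r0; apply: rpred_prod => j _; apply: fps_unit1.
by rewrite fps_coefB fps_coef1 fps_exp0 // subr0.
Qed.

(** The Gaussian binomial coefficient of i + j over i; naming both parts makes the symmetry visible
    and avoids truncated subtraction. *)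
Definition qbin r i j : fps R := fact_poch r (i + j) / (fact_poch r i * fact_poch r j).

Lemma qbinC r i j : qbin r i j = qbin r j i.
Proof. by rewrite /qbin addnC [fact_poch r i * _]mulrC. Qed.

Lemma qbin0 r i : r 0%N = 0 -> qbin r 0 i = 1.
Proof.
by move=> r0; rewrite /qbin add0n /fact_poch big_ord0 mul1r divrr ?fact_poch_unit.
Qed.

Lemma qbinS r i j : r 0%N = 0 ->
  qbin r i.+1 j.+1 = qbin r i.+1 j + r ^+ j.+1 * qbin r i j.+1.
Proof.
move=> r0; rewrite /qbin addSn addnS.
have U k := @fact_poch_unit r k r0.
have S k : fact_poch r k.+1 = fact_poch r k * (1 - r ^+ k.+1).
  by rewrite /fact_poch big_ord_recr.
have V k : 1 - r ^+ k.+1 \is a GRing.unit.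
  by apply: fps_unit1; rewrite fps_coefB fps_coef1 fps_exp0 // subr0.
have fracM (x y z : fps R) : y \is a GRing.unit -> z \is a GRing.unit ->
    x / y = x * z / (y * z).
  by move=> yU zU; rewrite invrM // mulrA mulrK.
rewrite (fracM _ (fact_poch r i.+1 * fact_poch r j) (1 - r ^+ j.+1)) ?unitrM ?U //.
rewrite mulrA (fracM _ (fact_poch r i * fact_poch r j.+1) (1 - r ^+ i.+1)) ?unitrM ?U //.
rewrite !S.
have -> : fact_poch r i * (1 - r ^+ i.+1) * fact_poch r j * (1 - r ^+ j.+1) =
  fact_poch r i * (1 - r ^+ i.+1) * (fact_poch r j * (1 - r ^+ j.+1)) by ring.
have -> : fact_poch r i * (fact_poch r j * (1 - r ^+ j.+1)) * (1 - r ^+ i.+1) =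
  fact_poch r i * (1 - r ^+ i.+1) * (fact_poch r j * (1 - r ^+ j.+1)) by ring.
rewrite -mulrDl; congr (_ / _).
have -> : (i + j).+2 = (i.+1 + j.+1)%N by lia.
rewrite exprD; ring.
Qed.

(** The finite form of the triple product: the theta term of index m = k - N is weighted by the
    Gaussian binomial of M + N over k. *)
Definition jtp_sum A B M N : fps R :=
  \sum_(k < (M + N).+1) qbin (A * B) k (M + N - k)%N *
     (A ^+ tri (k%:Z - N%:Z + 1) * B ^+ tri (k%:Z - N%:Z)).

(** Reversing the sum turns m into -m, and [tri (- m)] equals [tri (m + 1)], so the exponents of A
    and B trade places. *)
Lemma jtp_sumC A B M N : jtp_sum A B M N = jtp_sum B A N M.
Proof.
rewrite /jtp_sum (reindex_inj rev_ord_inj) /= addnC; apply: eq_bigr => k _.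
have kNM := ltn_ord k; rewrite qbinC (mulrC A) [X in _ * X]mulrC.
rewrite subSS subKn; last by rewrite -ltnS.
set u := (N + M - k)%N.
congr (_ * (_ ^+ _ * _ ^+ _)).
  have := tri2 (u%:Z - N%:Z); have := tri2 (k%:Z - M%:Z + 1); rewrite /u; nia.
have := tri2 (u%:Z - N%:Z + 1); have := tri2 (k%:Z - M%:Z); rewrite /u; nia.
Qed.

(** The q-Pascal rule splits the sum in two. The second half, shifted by one, is the first times A
    (AB)^M, because the ratio of consecutive theta terms is A^(m+1) B^m; this is [tS]. *)
Lemma jtp_sumS A B M N : A 0%N = 0 -> B 0%N = 0 ->
  jtp_sum A B M.+1 N = jtp_sum A B M N * (1 + A * (A * B) ^+ M).
Proof.
move=> A0 B0; set r := A * B; have r0 : r 0%N = 0 by rewrite fps_coefM0 A0 mul0r.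
set L := (M + N)%N.
pose t (k : nat) := A ^+ tri (k%:Z - N%:Z + 1) * B ^+ tri (k%:Z - N%:Z).
have tS k : (k <= L)%N -> t k * (A * r ^+ M) = r ^+ (L - k) * t k.+1.
  move=> kL; rewrite /t /r !exprMn.
  transitivity (A ^+ (1 + M + tri (k%:Z - N%:Z + 1)) * B ^+ (M + tri (k%:Z - N%:Z))).
    by rewrite !exprD expr1; ring.
  transitivity (A ^+ (L - k + tri (k.+1%:Z - N%:Z + 1)) * B ^+ (L - k + tri (k.+1%:Z - N%:Z))); last first.
    by rewrite !exprD; ring.
  have := tri2 (k%:Z - N%:Z); have := tri2 (k%:Z - N%:Z + 1).
  have := tri2 (k.+1%:Z - N%:Z); have := tri2 (k.+1%:Z - N%:Z + 1) => ? ? ? ?.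
  by congr (_ ^+ _ * _ ^+ _); nia.
(* The two conditionals make the rule hold at both ends i = 0 and i = L + 1, where one of the two
   binomials is missing. *)
have pascal (i : nat) : (i <= L.+1)%N -> qbin r i (L.+1 - i) =
    (if (i <= L)%N then qbin r i (L - i) else 0) +
    (if (0 < i)%N then r ^+ (L.+1 - i) * qbin r i.-1 (L.+1 - i) else 0).
  case: i => [|i] iL; first by rewrite leq0n ltnn addr0 !qbin0.
  rewrite subSS /=; have [iL'|iL'] := ltnP i L.
    have -> : (L - i = (L - i.+1).+1)%N by lia.
    by rewrite qbinS.
  have -> : (L - i = 0)%N by lia.
  by rewrite qbinC qbin0 // add0r expr0 qbinC qbin0 // mul1r.
rewrite /jtp_sum -/L -/r addSn -/L.
under eq_bigr => k _ do rewrite pascal ?(leq_ord k) // mulrDl -/(t k).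
rewrite big_split /= mulrDr mulr1; congr (_ + _).
  rewrite big_ord_recr /= ltnn mul0r addr0; apply: eq_bigr => k _.
  by rewrite (leq_ord k).
rewrite big_ord_recl /= mul0r add0r mulr_suml; apply: eq_bigr => k _.
transitivity (qbin r k (L - k)%N * (t k * (A * r ^+ M))); last by rewrite mulrA.
by rewrite tS ?leq_ord // /bump /= add1n subSS /t; ring.
Qed.

Lemma finite_jtp A B M N : A 0%N = 0 -> B 0%N = 0 ->
  jtp_sum A B M N =
  \prod_(j < M) (1 + A * (A * B) ^+ j) * \prod_(j < N) (1 + B * (A * B) ^+ j).
Proof.
move=> A0 B0.
have base A' B' M' : A' 0%N = 0 -> B' 0%N = 0 ->
    jtp_sum A' B' M' 0 = \prod_(j < M') (1 + A' * (A' * B') ^+ j).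
  move=> A'0 B'0; elim: M' => [|M' IH].
    by rewrite big_ord0 /jtp_sum big_ord1 qbin0 ?fps_coefM0 ?A'0 ?mul0r // !expr0 !mulr1.
  by rewrite jtp_sumS // IH big_ord_recr.
elim: M => [|M IH].
  by rewrite big_ord0 mul1r jtp_sumC base // mulrC.
by rewrite jtp_sumS // IH big_ord_recr /= mulrAC.
Qed.

Lemma th_coef A B n N : A 0%N = 0 -> B 0%N = 0 -> (n < N)%N ->
  th A B n = \sum_(k < (N + N).+1)
    (A ^+ tri (k%:Z - N%:Z + 1) * B ^+ tri (k%:Z - N%:Z)) n.
Proof.
move=> A0 B0 nN; rewrite /th (fsumE (int_range_uniq N)); last first.
  move=> m; rewrite mem_int_range => mN; apply: th_term_order => //.
  by apply: leq_trans (leq_pexp2l _ (isT : (1 <= 2)%N)); lia.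
by rewrite /int_range big_map mul2n -addnn -[X in iota 0 X]subn0 -/(index_iota 0 _) big_mkord.
Qed.

(** Limit of [finite_jtp]: multiplied by (r; r)_oo, a Gaussian binomial with both parts large is 1
    up to high order, and the terms near the ends of the sum have high order themselves. *)
Lemma jacobi_triple A B : A 0%N = 0 -> B 0%N = 0 ->
  th A B = qpoch (- A) (A * B) * qpoch (- B) (A * B) * qpoch (A * B) (A * B).
Proof.
move=> A0 B0; set r := A * B; have r0 : r 0%N = 0 by rewrite fps_coefM0 A0 mul0r.
set Q := qpoch r r; have QU : Q \is a GRing.unit by apply: fps_unit1; rewrite qpoch_coef0.
have QP K N : (K <= N)%N -> eqfps K (fact_poch r N) Q.
  move=> KN; have := eqfps_qpoch r r0 KN; rewrite /fact_poch.
  by under eq_bigr => j _ do rewrite -exprS.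
(* With N = 2K every k outside the window K <= k <= 2N - K has |k - N| > K, so its theta term
   vanishes up to degree n; inside the window both parts of the binomial are at least K. *)
apply: fpsP => n; pose K := n.+1; pose N := (K + K)%N; have nK : (n < K)%N by [].
have Kn2 : (K <= N)%N by rewrite leq_addr.
have P C : eqfps K (\prod_(j < N) (1 + C * r ^+ j)) (qpoch (- C) r).
  have := eqfps_qpoch (- C) r0 Kn2.
  by under eq_bigr => j _ do rewrite mulNr opprK.
have E := eqfpsM (eqfpsM (P A) (P B)) (@eqfps_refl _ K (Q)).
rewrite -(E n nK) -finite_jtp // /jtp_sum mulr_suml fps_coef_sum.
rewrite (th_coef A0 B0 (leq_trans nK Kn2)).
apply: eq_bigr => k _; rewrite -/r mulrAC.
set t := A ^+ _ * _.
have [/andP[Kk KNk]|small] := boolP ((K <= k) && (K <= N + N - k))%N.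
  have -> : t n = (1 * t) n by rewrite mul1r.
  suff H : eqfps K (qbin r k (N + N - k) * Q) 1 by rewrite (eqfpsM H (@eqfps_refl _ K (t))).
  have H : eqfps K (qbin r k (N + N - k) * (Q * Q)) Q.
    apply: eqfps_trans (QP K (N + N)%N _); last exact: leq_trans (leq_addr _ _).
    have -> : fact_poch r (N + N) =
        qbin r k (N + N - k) * (fact_poch r k * fact_poch r (N + N - k)).
      by rewrite /qbin subnKC ?mulrVK ?unitrM ?fact_poch_unit // -ltnS.
    apply: eqfpsM => //; apply: eqfpsM; apply: eqfps_sym; exact: QP.
  have := eqfpsM H (@eqfps_refl _ K (Q^-1)); rewrite divrr // !mulrA mulrK //.
have t0 i : (i <= n)%N -> t i = 0.
  move=> ein; apply: th_term_order => //.
  apply: leq_trans (leq_pexp2l _ (isT : (1 <= 2)%N)); rewrite ?expn1; lia.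
by rewrite t0 // fps_coefM_small.
Qed.

End JacobiTripleProduct.

(** * Sums of signed powers of one series *)

Section MonomialSum.
Variables (R : comUnitRingType) (r : fps R).
Hypothesis r0 : r 0%N = 0.

(** The base is an argument, and not the series fixed by the section, because the sums are also
    taken at - r and at r^k. *)
Definition qsum (r : fps R) (I : choiceType) (s : I -> int) (e : I -> nat) : fps R :=
  fsum (fun i => r ^+ e i *~ s i).

Lemma fps_coefMz (f : fps R) (z : int) n : (f *~ z) n = f n *~ z.
Proof.
have H k : (f *+ k) n = f n *+ k by elim: k => // k IH; rewrite !mulrS fps_coefD IH.
by case: z => k; rewrite /intmul ?fps_coefN H.
Qed.

Lemma locfin_summable (I : choiceType) s (e : I -> nat) : locfin e ->
  summable (fun i => r ^+ e i *~ s i).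
Proof.
move=> pe n; have [l lP] := pe n; exists l => i /lP ni k kn.
by rewrite fps_coefMz fps_coef_exp_small ?mul0rz // (leq_ltn_trans kn).
Qed.

Lemma locfinM (I J : choiceType) (e : I -> nat) (e' : J -> nat) :
  locfin e -> locfin e' -> locfin (fun p : I * J => e p.1 + e' p.2)%N.
Proof.
move=> pe pe' n; have [l lP] := pe n; have [l' lP'] := pe' n.
exists [seq (i, j) | i <- l, j <- l'] => -[i j] /negP nij.
have [il|/lP Fi0] := boolP (i \in l); last exact: leq_trans (leq_addr _ _).
have [jt|/lP' Gj0] := boolP (j \in l'); last exact: leq_trans (leq_addl _ _).
by case: nij; apply/allpairsP; exists (i, j).
Qed.

Lemma locfin_comp (I J : choiceType) (e : I -> nat) (h : J -> I) (g : I -> J) :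
  cancel h g -> locfin e -> locfin (e \o h).
Proof.
move=> hK pe n; have [l lP] := pe n; exists (map g l) => j /negP jl.
by apply: lP; apply/negP => hl; apply: jl; apply/mapP; exists (h j).
Qed.

Lemma eq_qsum (I : choiceType) (s s' : I -> int) (e e' : I -> nat) :
  (forall i, s i = s' i /\ e i = e' i) -> qsum r s e = qsum r s' e'.
Proof. by move=> H; apply: eq_fsum => i; have [-> ->] := H i. Qed.

Lemma qsumM (I J : choiceType) s s' (e : I -> nat) (e' : J -> nat) :
  locfin e -> locfin e' ->
  qsum r s e * qsum r s' e' =
  qsum r (fun p : I * J => s p.1 * s' p.2) (fun p => e p.1 + e' p.2)%N.
Proof.
move=> pe pe'; rewrite /qsum fsumM; first last.
- exact: locfin_summable.
- exact: locfin_summable.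
by apply: eq_fsum => p; rewrite exprD mulrzAl mulrzAr -mulrzA [s _ * _]mulrC.
Qed.

Lemma qsumD (I : choiceType) s s' (e : I -> nat) : locfin e ->
  qsum r s e + qsum r s' e = qsum r (fun i => s i + s' i) e.
Proof.
move=> pe; rewrite /qsum fsumD; first last.
- exact: locfin_summable.
- exact: locfin_summable.
by apply: eq_fsum => i; rewrite mulrzDr.
Qed.

Lemma qsumX (I : choiceType) k s (e : I -> nat) : locfin e ->
  r ^+ k * qsum r s e = qsum r s (fun i => k + e i)%N.
Proof.
move=> pe; rewrite /qsum fsumMl; last exact: locfin_summable.
by apply: eq_fsum => i; rewrite exprD mulrzAr.
Qed.

Lemma qsumZ (I : choiceType) (c : int) s (e : I -> nat) : locfin e ->
  c%:~R * qsum r s e = qsum r (fun i => c * s i) e.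
Proof.
move=> pe; rewrite /qsum fsumMl; last exact: locfin_summable.
by apply: eq_fsum => i; rewrite mulrzl -mulrzA [s _ * _]mulrC.
Qed.

Lemma qsum_opp (I : choiceType) s (e : I -> nat) :
  qsum (- r) s e = qsum r (fun i => (-1) ^+ e i * s i) e.
Proof.
apply: eq_fsum => i; rewrite [(- r) ^+ _]exprNn -signr_odd -[in RHS]signr_odd mulrzA.
by case: (odd _); rewrite ?expr1 ?expr0 ?mulrNz ?mulr1z ?mulN1r ?mul1r.
Qed.

Lemma qsum_exp (I : choiceType) k s (e : I -> nat) :
  qsum (r ^+ k) s e = qsum r s (fun i => k * e i)%N.
Proof. by apply: eq_fsum => i; rewrite exprM. Qed.

Lemma qsum_split (I J : choiceType) (K : nat) (c : I -> nat) (h : nat -> J -> I)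
    (g : nat -> I -> J) s (e : I -> nat) :
  locfin e -> (forall i, (c i < K)%N /\ h (c i) (g (c i) i) = i) ->
  (forall k j, (k < K)%N -> c (h k j) = k /\ g k (h k j) = j) ->
  qsum r s e = \sum_(k < K) qsum r (s \o h k) (e \o h k).
Proof. by move=> pe hg ch; apply: fsum_split hg ch; exact: locfin_summable. Qed.

End MonomialSum.

(** * Theta functions and sublattices of Z^2 *)

(** The sign (-1)^m for an integer m, in a form that linear arithmetic can decide. *)
Definition eps (m : int) : int := 1 - 2 * (m %% 2)%Z.

Lemma epsD (m n : int) : eps (m + n) = eps m * eps n.
Proof.
rewrite /eps; have [E|E] : (m %% 2)%Z = 0 \/ (m %% 2)%Z = 1 by lia.
- by rewrite (_ : ((m + n) %% 2)%Z = (n %% 2)%Z) ?E; lia.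
- by rewrite (_ : ((m + n) %% 2)%Z = 1 - (n %% 2)%Z) ?E; lia.
Qed.

Lemma sign_eps n : (-1) ^+ n = eps n%:Z.
Proof. by rewrite -signr_odd /eps; case: (boolP (odd n)) => on; rewrite ?expr1 ?expr0; lia. Qed.

Ltac tri_lia :=
  repeat match goal with
  | |- context [tri ?x] => have := tri2 x; move: (tri x) => ? ?
  end; lia.

Section ThetaSums.
Variables (R : comUnitRingType) (r : fps R).
Hypothesis r0 : r 0%N = 0.

Definition the (a b : nat) (m : int) : nat := (a * tri (m + 1) + b * tri m)%N.

Lemma the_gt a b m n : (0 < a)%N -> (0 < b)%N -> (n < `|m|)%N -> (n < the a b m)%N.
Proof.
move=> a0 b0 nm; have := triD m; rewrite /the -mulnn => H.
have H1 : (`|m| <= `|m| * `|m|)%N by rewrite leq_pmulr //; lia.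
have H2 : (tri (m + 1) <= a * tri (m + 1))%N by rewrite leq_pmull.
have H3 : (tri m <= b * tri m)%N by rewrite leq_pmull.
by rewrite -H in H1; apply: leq_trans nm (leq_trans H1 (leq_add H2 H3)).
Qed.

Lemma locfin_the a b : (0 < a)%N -> (0 < b)%N -> locfin (the a b).
Proof.
move=> a0 b0 n; exists (int_range n) => m; rewrite mem_int_range -ltnNge.
exact: the_gt.
Qed.

Lemma locfin_tri : locfin tri.
Proof.
move=> n; exists (int_range n.+1) => m; rewrite mem_int_range -ltnNge => nm.
by have := tri2 m; nia.
Qed.

Lemma th_pos a b : th (r ^+ a) (r ^+ b) = qsum r (fun=> 1) (the a b).
Proof. by apply: eq_fsum => m; rewrite mulr1z -!exprM -exprD. Qed.

Lemma th_neg a b : th (- r ^+ a) (- r ^+ b) = qsum r eps (the a b).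
Proof.
apply: eq_fsum => m; rewrite exprNn [(- r ^+ b) ^+ _]exprNn mulrACA -exprD -!exprM -exprD.
rewrite triD -signr_odd /eps.
case: (boolP (odd (`|m| ^ 2))) => om; rewrite ?expr1 ?expr0 ?mulN1r ?mul1r.
  by have -> : (m %% 2)%Z = 1 by move: om; rewrite oddX orFb; lia.
by have -> : (m %% 2)%Z = 0 by move: om; rewrite oddX orFb; lia.
Qed.

Lemma qsum0 (I : choiceType) (s : I -> int) (e : I -> nat) :
  (forall i, s i = 0) -> qsum r s e = 0.
Proof.
move=> s0; apply: fpsP => n; rewrite (fsumE (r := [::])) ?big_nil // => i _.
by rewrite s0 mulr0z.
Qed.

Lemma qsumN (I : choiceType) (s : I -> int) (e : I -> nat) : locfin e ->
  - qsum r s e = qsum r (fun i => - s i) e.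
Proof.
move=> pe; have -> : - qsum r s e = (-1)%:~R * qsum r s e.
  by rewrite mulrNz mulr1z mulN1r.
by rewrite qsumZ //; apply: eq_qsum => i; rewrite mulN1r.
Qed.

(** The index set is kept and terms of the wrong parity get coefficient 0, so that after a split
    whole classes drop out. *)
Lemma qsum_oddpart (I : choiceType) (s : I -> int) (e : I -> nat) : locfin e ->
  qsum r s e - qsum (- r) s e = qsum r (fun i => if odd (e i) then 2 * s i else 0) e.
Proof.
move=> pe; rewrite qsum_opp qsumN // qsumD //.
apply: eq_qsum => i; split => //; rewrite -signr_odd; case: ifP => _; rewrite ?expr1 ?expr0; ring.
Qed.

Lemma qsum_evenpart (I : choiceType) (s : I -> int) (e : I -> nat) : locfin e ->
  qsum r s e + qsum (- r) s e = qsum r (fun i => if odd (e i) then 0 else 2 * s i) e.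
Proof.
move=> pe; rewrite qsum_opp qsumD //.
apply: eq_qsum => i; split => //; rewrite -signr_odd; case: ifP => _; rewrite ?expr1 ?expr0; ring.
Qed.

(** As [tri (1 - m)] equals [tri m], the even integers 2i and the odd integers 1 - 2i give the same
    exponents 2i^2 - i. The doubled series thus has exponent m(m-1)/2 over all of Z, the shape used
    in the lattice arguments; the factor 2 is cancelled later. *)
Lemma psi_tri : 2 * th r (r ^+ 3) = qsum r (fun=> 1) tri.
Proof.
rewrite -{1}(expr1 r) th_pos.
rewrite [RHS](@qsum_split _ r r0 _ int 2 (fun m => if (m %% 2 == 0)%Z then 0 else 1)%N
  (fun k (i : int) => if k is 0 then 2 * i else 1 - 2 * i)
  (fun k m => if k is 0 then (m %/ 2)%Z else ((1 - m) %/ 2)%Z)); first last.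
- move=> k i; case: k => [|[|k]] //= _; split; try case: ifP; lia.
- move=> m; case: ifP => H /=; split => //; lia.
- exact: locfin_tri.
rewrite !big_ord_recl big_ord0 addr0 mulr_natl mulr2n; congr (_ + _).
  by apply: eq_qsum => i; split => //=; rewrite /the; tri_lia.
by apply: eq_qsum => i; split => //=; rewrite /the; tri_lia.
Qed.

End ThetaSums.

Local Notation quo m d := (m %/ d)%Z (only parsing).
Local Notation rem m d := (m %% d)%Z (only parsing).

Section Lattice.
Variable R : comUnitRingType.
Implicit Types r : fps R.

Definition phi r := th r r.
Definition psi r := th r (r ^+ 3).

Lemma phiE r k : phi (r ^+ k) = qsum r (fun=> 1) (the k k).
Proof. exact: th_pos. Qed.

Lemma phiNE r k : phi (- r ^+ k) = qsum r eps (the k k).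
Proof. exact: th_neg. Qed.

Lemma locfin_add (I : eqType) (e : I -> nat) k : locfin e ->
  locfin (fun i => k + e i)%N.
Proof.
move=> pe n; have [l lP] := pe n; exists l => i /lP; move/leq_trans; apply.
exact: leq_addl.
Qed.

Definition kmul (I : Type) (k : nat) (e : I -> nat) (i : I) : nat := (k * e i)%N.

Lemma qsum_kmul (I : choiceType) r k s (e : I -> nat) :
  qsum (r ^+ k) s e = qsum r s (kmul k e).
Proof. exact: qsum_exp. Qed.

Lemma psiE r k : (0 < k)%N -> r 0%N = 0 ->
  2 * psi (r ^+ k) = qsum r (fun=> 1) (kmul k tri).
Proof. by move=> k0 r0; rewrite psi_tri ?fps_exp0 // qsum_kmul. Qed.

Lemma locfin_kmul (I : eqType) (e : I -> nat) k : (0 < k)%N -> locfin e ->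
  locfin (kmul k e).
Proof.
move=> k0 pe n; have [l lP] := pe n; exists l => i /lP; move/leq_trans; apply.
exact: leq_pmull.
Qed.

Lemma psiNE r k : psi (- r ^+ k) = qsum r eps (the k (k * 3)).
Proof. by rewrite /psi exprNn -signr_odd expr1 mulN1r -exprM th_neg. Qed.

Definition Af r := th r (r ^+ 2).
Definition Bf r := th (- r) (- r ^+ 5).

Lemma AfE r k : Af (r ^+ k) = qsum r (fun=> 1) (the k (k * 2)).
Proof. by rewrite /Af -exprM th_pos. Qed.

Lemma BfE r k : Bf (r ^+ k) = qsum r eps (the k (k * 5)).
Proof. by rewrite /Bf -exprM th_neg. Qed.

(** The arguments - r^k and r^(2k) have different signs, so neither [th_pos] nor [th_neg] applies;
    the sign is the parity of the exponent of - r^k. *)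
Lemma AfNE r k : Af (- r ^+ k) = qsum r (fun m => eps (the 1 2 m)%:Z) (kmul k (the 1 2)).
Proof.
rewrite -{1}(expr1 (- r ^+ k)) AfE qsum_opp qsum_kmul.
by apply: eq_qsum => i; rewrite sign_eps mulr1.
Qed.

End Lattice.

Ltac locfin_tac := by repeat first
  [ apply: locfin_tri | apply: locfin_the | apply: locfin_kmul
  | apply: locfin_add | apply: locfinM ].

Definition on2 {T : Type} (f : int -> int -> T) (p : int * int) : T := f p.1 p.2.

(** The separate case K = 1 avoids a leading 0, so that a split into K classes unfolds to exactly K
    summands, matched one by one with [congr]. *)
Fixpoint sum_upto (V : zmodType) (F : nat -> V) (K : nat) : V :=
  match K with 0 => 0 | 1 => F 0%N | K'.+1 => sum_upto F K' + F K' end.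

Lemma sum_uptoE (V : zmodType) (F : nat -> V) K : \sum_(k < K) F k = sum_upto F K.
Proof.
elim: K => [|[|K] IH]; first by rewrite big_ord0.
  by rewrite big_ord1.
by rewrite big_ord_recr IH.
Qed.

Lemma qsum_split1 (R : comUnitRingType) (r : fps R) (K : nat) (c : int -> nat)
    (h g : nat -> int -> int) (s : int -> int) (e : int -> nat) :
  r 0%N = 0 -> locfin e ->
  (forall m, (c m < K)%N /\ h (c m) (g (c m) m) = m) ->
  (forall k i, (k < K)%N -> c (h k i) = k /\ g k (h k i) = i) ->
  qsum r s e = sum_upto (fun k => qsum r (s \o h k) (e \o h k)) K.
Proof. by move=> r0 pe hg ch; rewrite -sum_uptoE; apply: qsum_split hg ch. Qed.

Lemma qsum_split2 (R : comUnitRingType) (r : fps R) (K : nat) (c : int -> int -> nat)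
    (h g : nat -> int -> int -> int * int) (s : int * int -> int) (e : int * int -> nat) :
  r 0%N = 0 -> locfin e ->
  (forall m n, (c m n < K)%N /\ on2 (h (c m n)) (g (c m n) m n) = (m, n)) ->
  (forall k i j, (k < K)%N -> on2 c (h k i j) = k /\ on2 (g k) (h k i j) = (i, j)) ->
  qsum r s e = sum_upto (fun k => qsum r (s \o on2 (h k)) (e \o on2 (h k))) K.
Proof.
move=> r0 pe hg ch; rewrite -sum_uptoE.
apply: (@qsum_split R r r0 _ _ K (on2 c) (fun k => on2 (h k)) (fun k => on2 (g k))) => //.
- by move=> [m n]; exact: hg.
- by move=> k [i j] kK; exact: ch.
Qed.

Ltac pair_lia := match goal with |- (_, _) = (_, _) => congr (_, _); lia | _ => lia end.
Ltac split_cover := move=> ? ?; rewrite /on2; repeat case: ifP => ? /=; split; pair_lia.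
Ltac split_class := move=> [|[|[|[|[|[|?]]]]]] ? ? //; rewrite /on2 /=; move=> _;
  (split; [repeat case: ifP; lia | congr (_, _); lia]).
Ltac expand := rewrite [sum_upto _ _]/=.
(** Splits a sum over Z^2 into K cosets: [c] gives the class of a point, [h k] parametrizes class k
    by Z^2 and [g k] is the inverse. That these data fit together is left to linear arithmetic. *)
Ltac zsplit K c h g :=
  rewrite (@qsum_split2 _ _ K c h g) //; [ expand | locfin_tac | split_cover | split_class ].

Lemma eq_qsumZ (r : fps int) (I : choiceType) (c : int) (s s' : I -> int) (e e' : I -> nat) :
  (forall i, s i = c * s' i /\ e i = e' i) -> qsum r s e = c%:~R * qsum r s' e'.
Proof.
move=> H; apply: fpsP => n; rewrite mulrzl fps_coefMz -mulrzr mulr_fsuml.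
apply: eq_fsbigr => i _; have [-> ->] := H i.
by rewrite !fps_coefMz mulrzr [c * _]mulrC mulrzA.
Qed.

Ltac tri_cases :=
  repeat match goal with
  | |- context [tri ?x] => have := tri2 x; move: (tri x) => ? ?
  end; repeat case: ifP; rewrite /eps; lia.

(** One coset after a split: all its coefficients vanish, or it equals an integer multiple of the
    expected series term by term. *)
Ltac cell := first [apply: qsum0 => // | apply: eq_qsumZ] => -[? ?];
  rewrite /on2 /the /kmul /= ?mul1r ?mulr1 -?epsD; (try split); tri_cases.

(** * Level 3: the form m^2 + 3n^2 *)

Section L3.
Implicit Types r : fps int.

Lemma fpsN0 r : r 0%N = 0 -> (- r) 0%N = 0.
Proof. by move=> r0; rewrite fps_coefN r0 oppr0. Qed.

(** Eisenstein integers: [W] sums r^norm over the elements of Z[sqrt(-3)] of odd norm, and the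
    right-hand side over the elements ((2m-1) + (2n-1) sqrt(-3))/2, of norm 1 + 2 tri(m) + 6 tri(n).
    The two primitive cube roots of unity carry the first set onto the two halves of the second,
    according to the parity of m - n. *)
Lemma lattice_3_phi r : r 0%N = 0 ->
  phi r * phi (r ^+ 3) - phi (- r) * phi ((- r) ^+ 3) =
  4 * r * psi (r ^+ 2) * psi (r ^+ 6).
Proof.
move=> r0.
have U (x : fps int) : x 0%N = 0 -> phi x * phi (x ^+ 3) =
    qsum x (fun p : int * int => 1 * 1) (fun p => the 1 1 p.1 + the 3 3 p.2)%N.
  by move=> x0; rewrite -{1}(expr1 x) !phiE qsumM //; locfin_tac.
rewrite !U ?fpsN0 // qsum_oddpart //; last by locfin_tac.
transitivity (r ^+ 1 * (2 * psi (r ^+ 2) * (2 * psi (r ^+ 6)))); last by rewrite expr1; ring.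
rewrite !psiE // qsumM //; [|locfin_tac|locfin_tac].
rewrite qsumX //; last by locfin_tac.
pose W := qsum r (fun=> 1) (on2 (fun i j => the 1 1 (2 * i - 1 + j) + the 3 3 j)%N).
transitivity (0 + 2%:~R * W).
  zsplit 2%N (fun m n : int => if ((m - n) %% 2 == 0)%Z then 0 else 1)%N
    (fun (k : nat) (i j : int) => match k with 0 => (2 * i + j, j) | _ => (2 * i - 1 + j, j) end)
    (fun (k : nat) (m n : int) => match k with 0 => ((m - n) %/ 2, n)%Z | _ => ((m - n + 1) %/ 2, n)%Z end).
  by congr (_ + _); cell.
transitivity (1%:~R * W + 1%:~R * W); first by ring.
zsplit 2%N (fun m n : int => if ((m - n) %% 2 == 0)%Z then 0 else 1)%N
  (fun (k : nat) (i j : int) => match k with 0 => (i + 2 * j, i) | _ => (1 - i - 2 * j, i) end)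
  (fun (k : nat) (m n : int) => match k with 0 => (n, (m - n) %/ 2)%Z | _ => (n, (1 - n - m) %/ 2)%Z end).
by congr (_ + _); apply/esym; cell.
Qed.

(** The exponent m^2 + 3n^2 - 2n on the left has the parity of m + n, so on the even part the sign
    (-1)^(m+n) is 1. *)
Lemma lattice_3_even r : r 0%N = 0 ->
  phi (- r) * Bf r + phi (- (- r)) * Bf (- r) = 2 * psi (r ^+ 2) * Af (r ^+ 2).
Proof.
move=> r0.
have U (x : fps int) : x 0%N = 0 -> phi (- x) * Bf x =
    qsum x (fun p : int * int => eps p.1 * eps p.2) (fun p => the 1 1 p.1 + the 1 5 p.2)%N.
  by move=> x0; rewrite -(expr1 x) phiNE BfE expr1 qsumM //; locfin_tac.
rewrite !U ?fpsN0 // qsum_evenpart //; last by locfin_tac.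
rewrite !psiE // AfE qsumM //; [|locfin_tac|locfin_tac].
pose W := qsum r (fun=> 1) (on2 (fun i j => the 1 1 (i + 2 * j) + the 1 5 i)%N).
transitivity (2%:~R * W + 0).
  zsplit 2%N (fun m n : int => if ((m - n) %% 2 == 0)%Z then 0 else 1)%N
    (fun (k : nat) (i j : int) => match k with 0 => (i + 2 * j, i) | _ => (i + 2 * j + 1, i) end)
    (fun (k : nat) (m n : int) => match k with 0 => (n, (m - n) %/ 2)%Z | _ => (n, (m - n - 1) %/ 2)%Z end).
  by congr (_ + _); cell.
transitivity (1%:~R * W + 1%:~R * W); first by ring.
zsplit 2%N (fun m n : int => if ((m + n) %% 2 == 0)%Z then 0 else 1)%N
  (fun (k : nat) (i j : int) => match k with 0 => (i - j, i + j) | _ => (1 - i + j, i + j) end)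
  (fun (k : nat) (m n : int) => match k with 0 => ((m + n) %/ 2, (n - m) %/ 2)%Z
     | _ => ((n + 1 - m) %/ 2, (n + m - 1) %/ 2)%Z end).
by congr (_ + _); apply/esym; cell.
Qed.

Lemma lattice_3_odd r : r 0%N = 0 ->
  Af r * psi ((- r) ^+ 3) - Af (- r) * psi ((- (- r)) ^+ 3) =
  2 * r * Af (- r ^+ 2) * Bf (r ^+ 4).
Proof.
move=> r0.
have U (x : fps int) : x 0%N = 0 -> Af x * psi ((- x) ^+ 3) =
    qsum x (fun p : int * int => 1 * eps p.2) (fun p => the 1 2 p.1 + the 3 9 p.2)%N.
  move=> x0; rewrite exprNn -signr_odd expr1 mulN1r -{1}(expr1 x) AfE psiNE qsumM //; locfin_tac.
rewrite !U ?fpsN0 // qsum_oddpart //; last by locfin_tac.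
transitivity (2 * (r ^+ 1 * (Af (- r ^+ 2) * Bf (r ^+ 4)))); last by rewrite expr1; ring.
rewrite AfNE BfE qsumM //; [|locfin_tac|locfin_tac].
rewrite qsumX //; last by locfin_tac.
(* The exponent is odd for m = 2i with i + n odd and for m = 1 - 2i with i + n even; there [eps n]
   is [- eps i] and [eps i] respectively, which gives the signs of [W1] and [W2]. *)
pose W1 := qsum r (fun p => - eps p.1) (on2 (fun k j => the 1 2 (2 * k) + the 3 9 (2 * j + 1 - k))%N).
pose W2 := qsum r (fun p => eps p.1) (on2 (fun k j => the 1 2 (1 - 2 * k) + the 3 9 (k + 2 * j))%N).
transitivity (0 + 2%:~R * W1 + 2%:~R * W2 + 0).
  zsplit 4%N (fun m n : int => if rem m 2 == 0 then if rem (quo m 2 + n) 2 == 0 then 0%N else 1%N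
    else if rem (quo (1 - m) 2 + n) 2 == 0 then 2%N else 3%N)
    (fun (k : nat) (i j : int) => match k with 0 => (2 * i, i + 2 * j) | 1 => (2 * i, 2 * j + 1 - i)
       | 2 => (1 - 2 * i, i + 2 * j) | _ => (1 - 2 * i, i + 2 * j + 1) end)
    (fun (k : nat) (m n : int) => match k with 0 => (quo m 2, quo (n - quo m 2) 2)
       | 1 => (quo m 2, quo (n + quo m 2 - 1) 2) | 2 => (quo (1 - m) 2, quo (n - quo (1 - m) 2) 2)
       | _ => (quo (1 - m) 2, quo (n - quo (1 - m) 2 - 1) 2) end).
  by congr (_ + _ + _ + _); cell.
transitivity (2 * (1%:~R * W2 + 1%:~R * W1)); first by ring.
congr (_ * _); apply/esym.
zsplit 2%N (fun m n : int => if (m %% 2 == 0)%Z then 0 else 1)%N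
  (fun (k : nat) (i j : int) => match k with 0 => (- 2 * j, i + j) | _ => (1 - 2 * (i - j), - j) end)
  (fun (k : nat) (m n : int) => match k with 0 => (n + quo m 2, - quo m 2)
     | _ => (quo (1 - m) 2 - n, - n) end).
by congr (_ + _); cell.
Qed.
End L3.

Lemma fps_double_eq0 (f : fps int) : f = - f -> f = 0.
Proof.
move=> fN; apply: fpsP => n; have : f n = - f n by rewrite {1}fN.
by rewrite fps_coef0; lia.
Qed.

Lemma qsum_antisym (r : fps int) (s : int * int -> int) (e : int * int -> nat)
    (h : int -> int -> int * int) :
  r 0%N = 0 -> locfin e -> (forall m n, on2 h (h m n) = (m, n)) ->
  (forall p, s (on2 h p) = - s p /\ e (on2 h p) = e p) -> qsum r s e = 0.
Proof.
move=> r0 pe hK seh; apply: fps_double_eq0.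
rewrite {1}(@qsum_split2 _ _ 1 (fun _ _ => 0%N) (fun=> h) (fun=> h)) //=; last by case.
have -> : qsum r (s \o on2 h) (e \o on2 h) = (-1)%:~R * qsum r s e.
  by apply: eq_qsumZ => p; rewrite mulN1r; exact: seh.
by rewrite mulrNz mulr1z mulN1r.
Qed.

(** [sT] and [tT] are the theta functions of the Rogers-Ramanujan identities; [sT r / tT r] at r = q
    is q^(-1/5) times the Rogers-Ramanujan continued fraction. [sP] and [tP] are their analogues
    without signs. *)
Definition sT (R : comUnitRingType) (r : fps R) := th (- r) (- r ^+ 4).
Definition tT (R : comUnitRingType) (r : fps R) := th (- r ^+ 2) (- r ^+ 3).
Definition sP (R : comUnitRingType) (r : fps R) := th r (r ^+ 4).
Definition tP (R : comUnitRingType) (r : fps R) := th (r ^+ 2) (r ^+ 3).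
Definition n1 (R : comUnitRingType) (r : fps R) := th (- r) (- r ^+ 9).
Definition n3 (R : comUnitRingType) (r : fps R) := th (- r ^+ 3) (- r ^+ 7).

(** * Levels 5 and 25: sums of two squares and multiplication by 2 + i *)

Section L5.
Implicit Types r : fps int.

Lemma sTE r k : sT (r ^+ k) = qsum r eps (the k (k * 4)).
Proof. by rewrite /sT -exprM th_neg. Qed.

Lemma tTE r k : tT (r ^+ k) = qsum r eps (the (k * 2) (k * 3)).
Proof. by rewrite /tT -!exprM th_neg. Qed.

Lemma sPE r k : sP (r ^+ k) = qsum r (fun=> 1) (the k (k * 4)).
Proof. by rewrite /sP -exprM th_pos. Qed.

Lemma tPE r k : tP (r ^+ k) = qsum r (fun=> 1) (the (k * 2) (k * 3)).
Proof. by rewrite /tP -!exprM th_pos. Qed.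

Lemma n1E r : n1 r = qsum r eps (the 1 9).
Proof. by rewrite /n1 -{1}(expr1 r) th_neg. Qed.

Lemma n3E r : n3 r = qsum r eps (the 3 7).
Proof. by rewrite /n3 th_neg. Qed.

(** Gaussian integers m + n i are sorted by m - 2n modulo 5. Class 0 is the ideal generated by 2 + i
    and gives phi(r^5)^2; multiplication by i permutes the four other classes cyclically, so they
    contribute equally. *)
Lemma lattice_5_phi r : r 0%N = 0 ->
  phi r ^+ 2 - phi (r ^+ 5) ^+ 2 = 4 * r * th r (r ^+ 9) * th (r ^+ 3) (r ^+ 7).
Proof.
move=> r0; rewrite -[RHS]mulrA [4 * r]mulrC -mulrA [4 * _]mulrC mulrA.
rewrite -{1 3 4}(expr1 r) !expr2 !phiE !th_pos !qsumM //; try locfin_tac.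
rewrite qsumX //; last by locfin_tac.
set V := qsum r _ (fun p => the 5 5 p.1 + _)%N; set W := qsum r _ (fun p => 1 + _)%N.
apply: (canLR (addrK _)).
transitivity (1%:~R * V + 1%:~R * W + 1%:~R * W + 1%:~R * W + 1%:~R * W); last by ring.
zsplit 5%N (fun m n : int => let d := rem (m - 2 * n) 5 in
    if d == 0 then 0%N else if d == 1 then 1%N else if d == 2 then 2%N else
    if d == 3 then 3%N else 4%N)
  (fun (k : nat) (a b : int) => match k with
    | 0 => (2 * a - b, a + 2 * b) | 1 => (1 - 2 * a - b, - a + 2 * b)
    | 2 => (2 * b - a, 2 * a + b - 1) | 3 => (a - 2 * b, 1 - 2 * a - b)
    | _ => (2 * a + b - 1, a - 2 * b) end)
  (fun (k : nat) (m n : int) => match k with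
    | 0 => (quo (2 * m + n) 5, quo (2 * n - m) 5)
    | 1 => (- quo (2 * (m - 1) + n) 5, quo (2 * n - m + 1) 5)
    | 2 => (- quo (2 * (- n - 1) + m) 5, quo (2 * m + n + 1) 5)
    | 3 => (- quo (2 * (n - 1) - m) 5, quo (- 2 * m - n + 1) 5)
    | _ => (- quo (2 * (- m - 1) - n) 5, quo (- 2 * n + m + 1) 5) end).
by congr (_ + _ + _ + _ + _); cell.
Qed.

(** As for phi, but with 8 (tri m + tri n) + 2 = (2m-1)^2 + (2n-1)^2, hence quarter turns about
    (1/2, 1/2). The class they fix is m - 2n = -1/2 = 2 modulo 5, and it yields the term r
    psi(r^5)^2. *)
Lemma lattice_5_psi r : r 0%N = 0 ->
  psi r ^+ 2 - r * psi (r ^+ 5) ^+ 2 = sP r * tP r.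
Proof.
move=> r0; apply/eqP; rewrite -subr_eq0; apply/eqP; apply: fpsP => n.
have : (4 * (psi r ^+ 2 - r * psi (r ^+ 5) ^+ 2 - sP r * tP r)) n = 0; last first.
  by rewrite [4 * _]mulr_natl !mulrS !fps_coefD !fps_coef0 addr0; lia.
suff -> : 4 * (psi r ^+ 2 - r * psi (r ^+ 5) ^+ 2 - sP r * tP r) = 0 by [].
have -> : 4 * (psi r ^+ 2 - r * psi (r ^+ 5) ^+ 2 - sP r * tP r) =
  (2 * psi (r ^+ 1)) * (2 * psi (r ^+ 1)) -
  (r ^+ 1 * ((2 * psi (r ^+ 5)) * (2 * psi (r ^+ 5))) + 4 * (sP (r ^+ 1) * tP (r ^+ 1))).
  by rewrite !expr1; ring.
apply/eqP; rewrite subr_eq0; apply/eqP.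
rewrite !psiE // sPE tPE !qsumM //; try locfin_tac.
rewrite qsumX //; last by locfin_tac.
set V := qsum r _ (fun p => 1 + _)%N; set W := qsum r _ (fun p => the _ _ p.1 + _)%N.
transitivity (1%:~R * W + 1%:~R * W + 1%:~R * V + 1%:~R * W + 1%:~R * W); last by ring.
zsplit 5%N (fun m n : int => let d := rem (m - 2 * n) 5 in
    if d == 0 then 0%N else if d == 1 then 1%N else if d == 2 then 2%N else
    if d == 3 then 3%N else 4%N)
  (fun (k : nat) (a b : int) => match k with
    | 0 => (2 * a - b, a + 2 * b) | 1 => (1 - a - 2 * b, 2 * a - b)
    | 2 => (2 * a - b, a + 2 * b - 1) | 3 => (a + 2 * b, 1 - 2 * a + b)
    | _ => (1 - 2 * a + b, 1 - a - 2 * b) end)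
  (fun (k : nat) (m n : int) => match k with
    | 0 => (quo (2 * m + n) 5, quo (2 * n - m) 5)
    | 1 => (quo (2 * n + 1 - m) 5, quo (2 * (1 - m) - n) 5)
    | 2 => (quo (2 * m + n + 1) 5, quo (2 * n + 2 - m) 5)
    | 3 => (quo (2 * (1 - n) + m) 5, quo (2 * m + n - 1) 5)
    | _ => (quo (2 * (1 - m) + 1 - n) 5, quo (2 * (1 - n) - 1 + m) 5) end).
by congr (_ + _ + _ + _ + _); cell.
Qed.

(** An instance of f(a,b) f(c,d) = f(ac,bd) f(ad,bc) + a f(b/c, ac^2d) f(b/d, acd^2), valid for ab =
    cd: the sublattice m + n even is turned by 45 degrees. [lattice_5_sub] is the companion with the
    signs exchanged. *)
Lemma lattice_5_add r : r 0%N = 0 ->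
  tT r * sP r = tT (r ^+ 2) * n3 r + r * (sT (r ^+ 2) * n1 r).
Proof.
move=> r0; rewrite -{1 2 5}(expr1 r).
rewrite n1E n3E !tTE sPE sTE !qsumM //; try locfin_tac.
rewrite qsumX //; last by locfin_tac.
set V := (X in _ = X + _); set W := (X in _ = _ + X).
transitivity (1%:~R * V + 1%:~R * W); last by ring.
zsplit 2%N (fun m n : int => if rem (m + n) 2 == 0 then 0%N else 1%N)
  (fun (k : nat) (a b : int) => match k with 0 => (b - a, b + a) | _ => (b - a, 1 - a - b) end)
  (fun (k : nat) (m n : int) => match k with 0 => (quo (n - m) 2, quo (m + n) 2)
   | _ => (quo (1 - m - n) 2, quo (m - n + 1) 2) end).
by congr (_ + _); cell.
Qed.

Lemma lattice_5_sub r : r 0%N = 0 ->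
  sT r * tP r = tT (r ^+ 2) * n3 r - r * (sT (r ^+ 2) * n1 r).
Proof.
move=> r0; rewrite -{1 2 5}(expr1 r).
rewrite n1E n3E !tTE tPE !sTE !qsumM //; try locfin_tac.
rewrite qsumX //; last by locfin_tac.
set V := (X in _ = X - _); set W := (X in _ = _ - X).
transitivity (1%:~R * V + (-1)%:~R * W); last by ring.
zsplit 2%N (fun m n : int => if rem (m + n) 2 == 0 then 0%N else 1%N)
  (fun (k : nat) (a b : int) => match k with 0 => (b + a, b - a) | _ => (1 - a - b, b - a) end)
  (fun (k : nat) (n m : int) => match k with 0 => (quo (n - m) 2, quo (m + n) 2)
   | _ => (quo (1 - m - n) 2, quo (m - n + 1) 2) end).
by congr (_ + _); cell.
Qed.

(** The 5-dissection of the Euler product, in the form of an identity for (q;q)_oo (q^5;q^5)_oo. Of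
    the five classes of 3n - m modulo 5, three give the terms on the right and two vanish. *)
Lemma lattice_25 r : r 0%N = 0 ->
  sT r * tT r = tT (r ^+ 5) ^+ 2 - r * (sT (r ^+ 5) * tT (r ^+ 5)) -
    r ^+ 2 * sT (r ^+ 5) ^+ 2.
Proof.
move=> r0; rewrite -{1 2 4}(expr1 r) [tT _ ^+ 2]expr2 [sT _ ^+ 2]expr2.
rewrite !tTE !sTE !qsumM //; try locfin_tac.
rewrite !qsumX //; try locfin_tac.
set T0 := (X in _ = X - _ - _); set T1 := (X in _ = _ - X - _); set T2 := (X in _ = _ - _ - X).
transitivity (1%:~R * T0 + 0 + 0 + (-1)%:~R * T2 + (-1)%:~R * T1); last by ring.
zsplit 5%N (fun m n : int => let d := rem (3 * n - m) 5 in
    if d == 0 then 0%N else if d == 1 then 1%N else if d == 2 then 2%N else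
    if d == 3 then 3%N else 4%N)
  (fun (k : nat) (a b : int) => match k with
    | 0 => (a + 2 * b, 2 * a - b) | 1 => (3 * a - 5 * b - 1, a)
    | 2 => (3 * a - 5 * b - 2, a) | 3 => (2 * a - b, 1 - a - 2 * b)
    | _ => (1 - 2 * a - b, a - 2 * b) end)
  (fun (k : nat) (m n : int) => match k with
    | 0 => (quo (m + 2 * n) 5, quo (2 * m - n) 5)
    | 1 => (n, quo (3 * n - m - 1) 5)
    | 2 => (n, quo (3 * n - m - 2) 5)
    | 3 => (quo (2 * m + 1 - n) 5, quo (2 * (1 - n) - m) 5)
    | _ => (quo (2 * (1 - m) + n) 5, quo (1 - m - 2 * n) 5) end).
congr (_ + _ + _ + _ + _); try cell.
(* With X = 10m - 3 and Y = 10n - 1, 40 times the exponent plus 10 is X^2 + Y^2. The involution is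
   the reflection (X, Y) |-> ((-3X + 4Y)/5, (4X + 3Y)/5), integral on this class and reversing the
   sign there. *)
- apply: (@qsum_antisym _ _ _ (fun n k => (3 * n - 4 * k - 1, 2 * n - 3 * k - 1))) => //.
  + apply: (@locfin_comp _ _ _ _ (on2 (fun m n => (n, quo (3 * n - m - 1) 5)))).
      by move=> [m n]; rewrite /on2 /=; congr (_, _); lia.
    by locfin_tac.
  + by move=> m n; rewrite /on2 /=; congr (_, _); lia.
  + by move=> [m n]; rewrite /on2 /the /= -!epsD; split; tri_cases.
(* On this class the opposite of the previous reflection is the one that preserves integrality. *)
- apply: (@qsum_antisym _ _ _ (fun n k => (4 * k + 2 - 3 * n, 3 * k - 2 * n + 1))) => //.
  + apply: (@locfin_comp _ _ _ _ (on2 (fun m n => (n, quo (3 * n - m - 2) 5)))).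
      by move=> [m n]; rewrite /on2 /=; congr (_, _); lia.
    by locfin_tac.
  + by move=> m n; rewrite /on2 /=; congr (_, _); lia.
  + by move=> [m n]; rewrite /on2 /the /= -!epsD; split; tri_cases.
Qed.
End L5.

(** * Level 9: 3-dissections of psi and phi *)

Section L9.
Implicit Types r : fps int.

(** In the doubled series the classes 3i and 1 - 3i both give [Af (r ^+ 3)], while [tri (3 * i - 1)]
    is 1 + 9 [tri i]. *)
Lemma psi_dissect3 r : r 0%N = 0 -> psi r = Af (r ^+ 3) + r * psi (r ^+ 9).
Proof.
move=> r0; apply/eqP; rewrite -subr_eq0; apply/eqP; apply: fps_double_eq0.
apply/eqP; rewrite -subr_eq0 opprK -mulr2n -mulr_natl; apply/eqP.
have -> : 2 * (psi r - (Af (r ^+ 3) + r * psi (r ^+ 9))) =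
  2 * psi (r ^+ 1) - (2 * Af (r ^+ 3) + r ^+ 1 * (2 * psi (r ^+ 9))) by rewrite !expr1; ring.
rewrite (psiE (k := 1) isT r0) (psiE (k := 9) isT r0) AfE.
rewrite (qsumX r0 1); last by locfin_tac.
apply/eqP; rewrite subr_eq0; apply/eqP.
set V := qsum r _ (the _ _); set W := qsum r _ (fun i => 1 + _)%N.
transitivity (1%:~R * V + 1%:~R * V + 1%:~R * W); last by ring.
rewrite (@qsum_split1 _ _ 3 (fun m => if rem m 3 == 0 then 0%N else if rem m 3 == 1 then 1%N else 2%N)
  (fun (k : nat) (i : int) => match k with 0 => 3 * i | 1 => 1 - 3 * i | _ => 3 * i - 1 end)
  (fun (k : nat) (m : int) => match k with 0 => quo m 3 | 1 => quo (1 - m) 3 | _ => quo (m + 1) 3 end)).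
- rewrite [sum_upto _ _]/=.
  by congr (_ + _ + _); apply: eq_qsumZ => i; rewrite /the /kmul /=; split => //; tri_cases.
- by [].
- by locfin_tac.
- by move=> i; repeat case: ifP => ? /=; split => //; lia.
- by move=> [|[|[|k]]] i //= _; split; repeat case: ifP; lia.
Qed.

Lemma phi_dissect3 r : r 0%N = 0 -> phi (- r) = phi (- r ^+ 9) - 2 * r * Bf (r ^+ 3).
Proof.
move=> r0; rewrite -{1}(expr1 r).
have -> : 2 * r * Bf (r ^+ 3) = 2 * (r ^+ 1 * Bf (r ^+ 3)) by rewrite expr1; ring.
rewrite !phiNE BfE (qsumX r0 1); last by locfin_tac.
set V := (X in _ = X - _); set W := qsum r _ (fun i => 1 + _)%N.
transitivity (1%:~R * V + (-1)%:~R * W + (-1)%:~R * W); last by ring.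
rewrite (@qsum_split1 _ _ 3 (fun m => if rem m 3 == 0 then 0%N else if rem m 3 == 1 then 1%N else 2%N)
  (fun (k : nat) (i : int) => match k with 0 => 3 * i | 1 => 1 - 3 * i | _ => 3 * i - 1 end)
  (fun (k : nat) (m : int) => match k with 0 => quo m 3 | 1 => quo (1 - m) 3 | _ => quo (m + 1) 3 end)).
- rewrite [sum_upto _ _]/=.
  by congr (_ + _ + _); apply: eq_qsumZ => i; rewrite /the /kmul /=; split => //; tri_cases.
- by [].
- by locfin_tac.
- by move=> i; repeat case: ifP => ? /=; split => //; lia.
- by move=> [|[|[|k]]] i //= _; split; repeat case: ifP; lia.
Qed.
End L9.

Ltac theta_ring := repeat match goal with
  | |- context [psi ?x] => move: (psi x) => ?
  | |- context [phi ?x] => move: (phi x) => ?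
  end; ring.

(** * Level 15: the forms m^2 + 15n^2 and 3m^2 + 5n^2 *)

Section L15.
Implicit Types r : fps int.

Lemma mulf2_inj (f g : fps int) : 2 * f = 2 * g -> f = g.
Proof.
move=> fg; apply: fpsP => n; have : (2 * f) n = (2 * g) n by rewrite fg.
rewrite !mulr_natl !mulr2n !fps_coefD; move: (f n) (g n) => a b; lia.
Qed.

Lemma lattice_15_phi r : r 0%N = 0 ->
  phi r * phi (r ^+ 15) =
  phi (- r ^+ 6) * phi (- r ^+ 10) + 2 * r * psi (r ^+ 3) * psi (r ^+ 5).
Proof.
move=> r0; apply: mulf2_inj.
transitivity (2 * (phi (r ^+ 1) * phi (r ^+ 15))); first by rewrite expr1.
transitivity (2 * (phi (- r ^+ 6) * phi (- r ^+ 10)) +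
   r ^+ 1 * ((2 * psi (r ^+ 3)) * (2 * psi (r ^+ 5)))); last by rewrite expr1; theta_ring.
rewrite !phiE !phiNE !psiE // !qsumM //; try locfin_tac.
rewrite qsumX //; last by locfin_tac.
pose C0 := qsum r (fun=> 1) (on2 (fun i y => 1 + (3 * tri (i + 3 * y) + 5 * tri (i - y)))%N).
pose Ce := qsum r (fun=> 1) (on2 (fun u y => 1 + (3 * tri (3 * u + 2 * y - 1) + 5 * tri (u - 2 * y)))%N).
pose Co := qsum r (fun=> 1) (on2 (fun t v => 1 + (3 * tri (3 * t + 8 * v + 3) + 5 * tri t))%N).
pose E := qsum r (fun=> 1) (on2 (fun s y => the 1 1 (4 * s + y) + the 15 15 y)%N).
transitivity (2 * (1%:~R * C0 + 1%:~R * E + 1%:~R * Ce)).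
  congr (_ * _).
  zsplit 3%N (fun m n : int => if rem (m - n) 2 == 1 then 0%N else if rem (m - n) 4 == 0 then 1%N else 2%N)
    (fun (k : nat) (i y : int) => match k with 0 => (2 * i - 1 + y, y) | 1 => (4 * i + y, y)
      | _ => (4 * i - 2 + y, y) end)
    (fun (k : nat) (m n : int) => match k with 0 => (quo (m - n + 1) 2, n) | 1 => (quo (m - n) 4, n)
      | _ => (quo (m - n + 2) 4, n) end).
  by congr (_ + _ + _); cell.
(* [Co] is absent from the left-hand side: it comes with a minus sign from the points with m - n odd
   in the alternating phi product, and two of the six classes of the psi product cancel it. *)
transitivity (2 * (1%:~R * E + (-1)%:~R * Co) + (1%:~R * C0 + 1%:~R * C0 + 1%:~R * Ce + 1%:~R * Co + 1%:~R * Ce + 1%:~R * Co)).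
  by ring.
congr (_ * _ + _); apply/esym.
  zsplit 2%N (fun m n : int => if rem (m - n) 2 == 0 then 0%N else 1%N)
    (fun (k : nat) (i y : int) => match k with 0 => (i - y, i + y) | _ => (i + y, i + 3 * y + 1) end)
    (fun (k : nat) (m n : int) => match k with 0 => (quo (m + n) 2, quo (n - m) 2)
      | _ => (m - quo (n - m - 1) 2, quo (n - m - 1) 2) end).
  by congr (_ + _); cell.
zsplit 6%N (fun s t : int => if rem (s - t) 4 == 0 then 0%N else if rem (s + t) 4 == 1 then 1%N
    else if rem (s + t) 4 == 3 then if rem (s - 3 * t + 1) 8 == 0 then 2%N else 3%N
    else if rem (2 - s - 3 * t) 8 == 0 then 4%N else 5%N)
  (fun (k : nat) (i y : int) => match k with 0 => (i + 3 * y, i - y) | 1 => (1 - i - 3 * y, i - y)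
     | 2 => (3 * i + 2 * y - 1, i - 2 * y) | 3 => (3 * i + 8 * y + 3, i)
     | 4 => (2 - 3 * i - 2 * y, i - 2 * y) | _ => (- 2 - 3 * i - 8 * y, i) end)
  (fun (k : nat) (s t : int) => match k with 0 => (t + quo (s - t) 4, quo (s - t) 4)
     | 1 => (t + quo (1 - s - t) 4, quo (1 - s - t) 4)
     | 2 => (t + 2 * quo (s - 3 * t + 1) 8, quo (s - 3 * t + 1) 8)
     | 3 => (t, quo (s - 3 * t - 3) 8)
     | 4 => (t + 2 * quo (2 - s - 3 * t) 8, quo (2 - s - 3 * t) 8)
     | _ => (t, quo (- 2 - s - 3 * t) 8) end).
by congr (_ + _ + _ + _ + _ + _); cell.
Qed.

Lemma lattice_15_phi35 r : r 0%N = 0 ->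
  phi (r ^+ 3) * phi (r ^+ 5) =
  phi (- r ^+ 2) * phi (- r ^+ 30) + 2 * r ^+ 2 * psi r * psi (r ^+ 15).
Proof.
move=> r0; apply: mulf2_inj.
transitivity (2 * (phi (- r ^+ 2) * phi (- r ^+ 30)) +
   r ^+ 2 * ((2 * psi (r ^+ 1)) * (2 * psi (r ^+ 15)))); last by rewrite expr1; theta_ring.
rewrite !phiE !phiNE !psiE // !qsumM //; try locfin_tac.
rewrite qsumX //; last by locfin_tac.
pose A := qsum r (fun=> 1) (on2 (fun i y => the 3 3 (2 * i - 1 + y) + the 5 5 y)%N).
pose B := qsum r (fun=> 1) (on2 (fun i y => the 2 2 (2 * i - 1 + y) + the 30 30 y)%N).
pose C := qsum r (fun=> 1) (on2 (fun w u => the 3 3 (w + 2 * u - 1) + the 5 5 (w - 2 * u + 1))%N).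
pose E := qsum r (fun=> 1) (on2 (fun w n => the 3 3 (w - 2 * n) + the 5 5 (w + 2 * n))%N).
transitivity (2 * (1%:~R * A + 1%:~R * E + 1%:~R * C)).
  congr (_ * _).
  zsplit 3%N (fun m n : int => if rem (m - n) 2 == 1 then 0%N else if rem (m - n) 4 == 0 then 1%N else 2%N)
    (fun (k : nat) (i y : int) => match k with 0 => (2 * i - 1 + y, y) | 1 => (i - 2 * y, i + 2 * y)
      | _ => (i + 2 * y - 1, i - 2 * y + 1) end)
    (fun (k : nat) (m n : int) => match k with 0 => (quo (m - n + 1) 2, n)
      | 1 => (quo (m + n) 2, quo (n - m) 4)
      | _ => (quo (m + n) 2, quo (m - n + 2) 4) end).
  by congr (_ + _ + _); cell.
(* Here [B] is the series that cancels between the alternating phi product and the psi product. *)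
transitivity (2 * (1%:~R * E + (-1)%:~R * B) + (1%:~R * A + 1%:~R * A + 1%:~R * B + 1%:~R * C + 1%:~R * B + 1%:~R * C)).
  by ring.
congr (_ * _ + _); apply/esym.
  zsplit 2%N (fun m n : int => if rem (m - n) 2 == 0 then 0%N else 1%N)
    (fun (k : nat) (i y : int) => match k with 0 => (y + 2 * i, y) | _ => (2 * i - 1 + y, y) end)
    (fun (k : nat) (m n : int) => match k with 0 => (quo (m - n) 2, n)
      | _ => (quo (m - n + 1) 2, n) end).
  by congr (_ + _); cell.
zsplit 6%N (fun s t : int => if rem (s + t) 4 == 3 then 0%N else if rem (s - t) 4 == 2 then 1%N
    else if rem (s - t) 8 == 0 then 2%N else if rem (s - t) 8 == 4 then 3%N
    else if rem (s + t) 8 == 1 then 4%N else 5%N)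
  (fun (k : nat) (i y : int) => match k with 0 => (3 * i - 1 + 4 * y, i) | 1 => (2 - 3 * i - 4 * y, i)
     | 2 => (i + 8 * y, i) | 3 => (i + 7 * y - 3, i - y + 1)
     | 4 => (1 - i - 8 * y, i) | _ => (4 - i - 7 * y, i - y + 1) end)
  (fun (k : nat) (s t : int) => match k with 0 => (t, quo (s - 3 * t + 1) 4)
     | 1 => (t, quo (2 - s - 3 * t) 4)
     | 2 => (t, quo (s - t) 8)
     | 3 => (t - 1 + quo (s - t + 4) 8, quo (s - t + 4) 8)
     | 4 => (t, quo (1 - s - t) 8)
     | _ => (t - 1 + quo (5 - s - t) 8, quo (5 - s - t) 8) end).
by congr (_ + _ + _ + _ + _ + _); cell.
Qed.

Lemma mulf4_inj (f g : fps int) : 4 * f = 4 * g -> f = g.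
Proof. by move=> fg; do 2 apply: mulf2_inj; rewrite !mulrA -natrM. Qed.

Lemma lattice_15_psi35 r : r 0%N = 0 ->
  psi (r ^+ 3) * psi (r ^+ 5) - psi ((- r) ^+ 3) * psi ((- r) ^+ 5) =
  2 * r ^+ 3 * psi (r ^+ 2) * psi (r ^+ 30).
Proof.
move=> r0; apply: mulf4_inj.
have U (x : fps int) : x 0%N = 0 -> 4 * (psi (x ^+ 3) * psi (x ^+ 5)) =
    qsum x (fun p : int * int => 1 * 1) (fun p => kmul 3 tri p.1 + kmul 5 tri p.2)%N.
  move=> x0; transitivity ((2 * psi (x ^+ 3)) * (2 * psi (x ^+ 5))); first by theta_ring.
  by rewrite !psiE // qsumM; [|exact: x0|locfin_tac|locfin_tac].
rewrite mulrBr; etransitivity.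
  exact: (f_equal2 (fun a b => a - b) (U r r0) (U (- r) (fpsN0 r0))).
transitivity (2 * (r ^+ 3 * ((2 * psi (r ^+ 2)) * (2 * psi (r ^+ 30))))); last by theta_ring.
rewrite (psiE (k := 2) isT r0) (psiE (k := 30) isT r0) qsumM; [|exact: r0|locfin_tac|locfin_tac].
rewrite qsumX //; last by locfin_tac.
rewrite qsum_oddpart //; last by locfin_tac.
pose T := qsum r (fun=> 1) (on2 (fun t v => (3 * tri (3 * t - 1 + 4 * v) + 5 * tri t))%N).
transitivity (0 + 0 + 2%:~R * T + 2%:~R * T).
  zsplit 4%N (fun s t : int => if rem (s - t) 4 == 0 then 0%N else if rem (s + t) 4 == 1 then 1%N
    else if rem (s + t) 4 == 3 then 2%N else 3%N)
  (fun (k : nat) (i y : int) => match k with 0 => (i + 4 * y, i) | 1 => (1 - i - 4 * y, i)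
     | 2 => (3 * i - 1 + 4 * y, i) | _ => (2 - 3 * i - 4 * y, i) end)
  (fun (k : nat) (s t : int) => match k with 0 => (t, quo (s - t) 4)
     | 1 => (t, quo (1 - s - t) 4)
     | 2 => (t, quo (s - 3 * t + 1) 4)
     | _ => (t, quo (2 - s - 3 * t) 4) end).
  by congr (_ + _ + _ + _); cell.
transitivity (2 * (1%:~R * T + 1%:~R * T)); first by theta_ring.
congr (_ * _); apply/esym.
zsplit 2%N (fun m n : int => if rem (m - n) 2 == 0 then 0%N else 1%N)
    (fun (k : nat) (t v : int) => match k with 0 => (t + 3 * v, t + v) | _ => (1 - t - 3 * v, t + v) end)
    (fun (k : nat) (m n : int) => match k with 0 => (n - quo (m - n) 2, quo (m - n) 2)
      | _ => (n - quo (1 - m - n) 2, quo (1 - m - n) 2) end).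
by congr (_ + _); cell.
Qed.

Lemma lattice_15_psi r : r 0%N = 0 ->
  psi r * psi (r ^+ 15) + psi (- r) * psi ((- r) ^+ 15) =
  2 * psi (r ^+ 6) * psi (r ^+ 10).
Proof.
move=> r0; apply: mulf4_inj.
have U (x : fps int) : x 0%N = 0 -> 4 * (psi x * psi (x ^+ 15)) =
    qsum x (fun p : int * int => 1 * 1) (fun p => kmul 1 tri p.1 + kmul 15 tri p.2)%N.
  move=> x0; transitivity ((2 * psi (x ^+ 1)) * (2 * psi (x ^+ 15))); first by rewrite expr1; theta_ring.
  by rewrite !psiE // qsumM; [|exact: x0|locfin_tac|locfin_tac].
rewrite mulrDr; etransitivity.
  exact: (f_equal2 +%R (U r r0) (U (- r) (fpsN0 r0))).
transitivity (2 * ((2 * psi (r ^+ 6)) * (2 * psi (r ^+ 10)))); last by theta_ring.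
rewrite (psiE (k := 6) isT r0) (psiE (k := 10) isT r0) qsumM; [|exact: r0|locfin_tac|locfin_tac].
rewrite qsum_evenpart //; last by locfin_tac.
pose T := qsum r (fun=> 1) (on2 (fun t v => (tri (t + 4 * v) + 15 * tri t))%N).
transitivity (2%:~R * T + 2%:~R * T + 0 + 0).
  zsplit 4%N (fun s t : int => if rem (s - t) 4 == 0 then 0%N else if rem (s + t) 4 == 1 then 1%N
    else if rem (s + t) 4 == 3 then 2%N else 3%N)
  (fun (k : nat) (i y : int) => match k with 0 => (i + 4 * y, i) | 1 => (1 - i - 4 * y, i)
     | 2 => (3 * i - 1 + 4 * y, i) | _ => (2 - 3 * i - 4 * y, i) end)
  (fun (k : nat) (s t : int) => match k with 0 => (t, quo (s - t) 4)
     | 1 => (t, quo (1 - s - t) 4)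
     | 2 => (t, quo (s - 3 * t + 1) 4)
     | _ => (t, quo (2 - s - 3 * t) 4) end).
  by congr (_ + _ + _ + _); cell.
transitivity (2 * (1%:~R * T + 1%:~R * T)); first by theta_ring.
congr (_ * _); apply/esym.
zsplit 2%N (fun m n : int => if rem (m - n) 2 == 0 then 0%N else 1%N)
    (fun (k : nat) (t v : int) => match k with 0 => (t - v, t + v) | _ => (1 - t + v, t + v) end)
    (fun (k : nat) (m n : int) => match k with 0 => (quo (m + n) 2, quo (n - m) 2)
      | _ => (quo (n + 1 - m) 2, quo (n + m - 1) 2) end).
by congr (_ + _); cell.
Qed.
End L15.

(** Euler's pentagonal number series f(-r, -r^2). *)
Definition pent (R : comUnitRingType) (r : fps R) := th (- r) (- r ^+ 2).

(** * Levels 7 and 11 *)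

Section L7.
Implicit Types r : fps int.

Lemma pentE r k : pent (r ^+ k) = qsum r eps (the k (k * 2)).
Proof. by rewrite /pent -exprM th_neg. Qed.

Lemma lattice_7 r : r 0%N = 0 ->
  pent r * pent (r ^+ 7) - pent (- r) * pent ((- r) ^+ 7) =
  - 2 * (r * (pent (r ^+ 4) * pent (r ^+ 28))).
Proof.
move=> r0.
have U (x : fps int) : x 0%N = 0 -> pent x * pent (x ^+ 7) =
    qsum x (fun p : int * int => eps p.1 * eps p.2) (fun p => the 1 2 p.1 + the 7 14 p.2)%N.
  by move=> x0; rewrite -{1}(expr1 x) !pentE qsumM; [|exact: x0|locfin_tac|locfin_tac].
etransitivity.
  exact: (f_equal2 (fun a b => a - b) (U r r0) (U (- r) (fpsN0 r0))).
rewrite qsum_oddpart //; last by locfin_tac.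
rewrite -{2}(expr1 r) !pentE qsumM; [|exact: r0|locfin_tac|locfin_tac].
rewrite (qsumX r0 1); last by locfin_tac.
pose P := qsum r (fun=> 1) (on2 (fun b c => 1 + (the 4 8 (b + 2 * c) + the 28 56 b))%N).
pose Q := qsum r (fun=> 1) (on2 (fun b c => 1 + (the 4 8 (b + 2 * c + 1) + the 28 56 b))%N).
pose T := qsum r (fun=> 1) (on2 (fun i j => the 1 2 (3 * j - 2 * i) + the 7 14 (j + 1 + 2 * i))%N).
(* Classes 2 and 3 have the same exponents and opposite signs, so [T] cancels; the exponents on the
   last two classes are even. *)
transitivity ((-2)%:~R * P + 2%:~R * Q + (-2)%:~R * T + 2%:~R * T + 0 + 0).
  zsplit 6%N (fun m n : int => if rem (m + n) 4 == 1 then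
        if rem (n - quo (m + n - 1) 4) 2 == 0 then 0%N else 2%N
      else if rem (m + n) 4 == 3 then 4%N
      else if rem (m - n) 4 == 2 then
        if rem (n + quo (m - n - 2) 4) 2 == 0 then 1%N else 3%N
      else 5%N)
    (fun (k : nat) (i j : int) => match k with
      | 0 => (1 - 5 * i - 3 * j, i - j) | 1 => (3 * j + 2 - 2 * i, - 2 * i - j)
      | 2 => (3 * j - 2 * i, j + 1 + 2 * i) | 3 => (- 3 * j - 5 * i - 2, j - i)
      | 4 => (3 - i + 4 * j, i) | _ => (i + 4 * j, i) end)
    (fun (k : nat) (m n : int) => match k with
      | 0 => (quo (n - quo (m + n - 1) 4) 2, quo (n - quo (m + n - 1) 4) 2 - n)
      | 1 => (- quo (n + quo (m - n - 2) 4) 2, quo (m - n - 2) 4)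
      | 2 => (quo (n - quo (m + n - 1) 4 - 1) 2, quo (m + n - 1) 4)
      | 3 => (- quo (m + 3 * n + 2) 8, n - quo (m + 3 * n + 2) 8)
      | 4 => (n, quo (m + n - 3) 4) | _ => (n, quo (m - n) 4) end).
  by congr (_ + _ + _ + _ + _ + _); cell.
transitivity (- 2 * (1%:~R * P + (-1)%:~R * Q)); first by ring.
congr (_ * _); apply/esym.
zsplit 2%N (fun m n : int => if rem (m - n) 2 == 0 then 0%N else 1%N)
  (fun (k : nat) (i j : int) => match k with 0 => (i + 2 * j, i) | _ => (i + 2 * j + 1, i) end)
  (fun (k : nat) (m n : int) => match k with 0 => (n, quo (m - n) 2) | _ => (n, quo (m - n - 1) 2) end).
by congr (_ + _); cell.
Qed.

Lemma lattice_11 r : r 0%N = 0 ->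
  phi r * phi (r ^+ 11) - phi (- r) * phi ((- r) ^+ 11) =
  4 * (r * (pent (r ^+ 2) * pent (r ^+ 22))) +
  4 * (r ^+ 3 * (psi (r ^+ 2) * psi (r ^+ 22))).
Proof.
move=> r0.
have U (x : fps int) : x 0%N = 0 -> phi x * phi (x ^+ 11) =
    qsum x (fun p : int * int => 1 * 1) (fun p => the 1 1 p.1 + the 11 11 p.2)%N.
  by move=> x0; rewrite -{1}(expr1 x) !phiE qsumM; [|exact: x0|locfin_tac|locfin_tac].
etransitivity.
  exact: (f_equal2 (fun a b => a - b) (U r r0) (U (- r) (fpsN0 r0))).
rewrite qsum_oddpart //; last by locfin_tac.
have -> : 4 * (r ^+ 3 * (psi (r ^+ 2) * psi (r ^+ 22))) =
   r ^+ 3 * ((2 * psi (r ^+ 2)) * (2 * psi (r ^+ 22))).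
  by move: (psi (r ^+ 2)) (psi (r ^+ 22)) => a b; ring.
rewrite (psiE (k := 2) isT r0) (psiE (k := 22) isT r0) qsumM; [|exact: r0|locfin_tac|locfin_tac].
rewrite -{2}(expr1 r) !pentE qsumM; [|exact: r0|locfin_tac|locfin_tac].
rewrite (qsumX r0 1); last by locfin_tac.
rewrite (qsumX r0 3); last by locfin_tac.
pose eH := fun p : int * int => (3 + (kmul 2 tri p.1 + kmul 22 tri p.2))%N.
have pH : locfin eH by locfin_tac.
(* The symmetry n |-> 1 - n keeps the exponent and changes the parity of m - n, so the added sign
   sums to 0. The psi product is thereby concentrated on m - n odd, like the odd part of the phi
   product, and both can be sorted by m - n modulo 6. *)
have -> : qsum r (fun p : int * int => 1 * 1) eH = qsum r (fun p => 1 - eps (p.1 - p.2)) eH.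
  have X0 : qsum r (fun p => eps (p.1 - p.2)) eH = 0.
    apply: (@qsum_antisym _ _ _ (fun m n => (m, 1 - n))) => //.
      by move=> m n; rewrite /on2 /=; congr (_, _); lia.
    by move=> [m n]; rewrite /on2 /eH /kmul /=; split; tri_cases.
  rewrite -[LHS]subr0 -X0 (qsumN r0) // (qsumD r0) //.
pose S := qsum r (fun=> 1) (on2 (fun i j => the 1 1 (6 * i - 1 + j) + the 11 11 j)%N).
pose S3 := qsum r (fun=> 1) (on2 (fun i j => the 1 1 (6 * i + 3 + j) + the 11 11 j)%N).
pose H := qsum r (fun=> 1) (on2 (fun i j => eH (6 * i - 1 + j, j))).
transitivity (0 + 2%:~R * S + 0 + 2%:~R * S3 + 0 + 2%:~R * S).
  zsplit 6%N (fun m n : int => let d := rem (m - n) 6 in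
      if d == 0 then 0%N else if d == 1 then 1%N else if d == 2 then 2%N
      else if d == 3 then 3%N else if d == 4 then 4%N else 5%N)
    (fun (k : nat) (i j : int) => match k with
      | 0 => (6 * i + j, j) | 1 => (1 - 6 * i - j, - j) | 2 => (6 * i + 2 + j, j)
      | 3 => (6 * i + 3 + j, j) | 4 => (6 * i + 4 + j, j) | _ => (6 * i - 1 + j, j) end)
    (fun (k : nat) (m n : int) => match k with
      | 0 => (quo (m - n) 6, n) | 1 => (- quo (m - n - 1) 6, - n) | 2 => (quo (m - n - 2) 6, n)
      | 3 => (quo (m - n - 3) 6, n) | 4 => (quo (m - n - 4) 6, n)
      | _ => (quo (m - n + 1) 6, n) end).
  by congr (_ + _ + _ + _ + _ + _); cell.
transitivity (4 * (1%:~R * S + (-1)%:~R * H) +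
    (0 + 2%:~R * H + 0 + 2%:~R * S3 + 0 + 2%:~R * H)); first by ring.
congr (_ * _ + _); apply/esym.
  zsplit 2%N (fun m n : int => if rem (m - n) 2 == 0 then 0%N else 1%N)
    (fun (k : nat) (i j : int) => match k with 0 => (i + 2 * j, i) | _ => (i + 2 * j - 1, i) end)
    (fun (k : nat) (m n : int) => match k with 0 => (n, quo (m - n) 2) | _ => (n, quo (m - n + 1) 2) end).
  rewrite /H /eH.
  by congr (_ + _); cell.
rewrite /eH; clear pH.
zsplit 6%N (fun m n : int => let d := rem (m - n) 6 in
    if d == 0 then 0%N else if d == 1 then 1%N else if d == 2 then 2%N
    else if d == 3 then 3%N else if d == 4 then 4%N else 5%N)
  (fun (k : nat) (i j : int) => match k with
    | 0 => (6 * i + j, j) | 1 => (2 - 6 * i - j, 1 - j) | 2 => (6 * i + 2 + j, j)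
    | 3 => (5 * i + 3 - j, - i - j) | 4 => (6 * i + 4 + j, j) | _ => (6 * i - 1 + j, j) end)
  (fun (k : nat) (m n : int) => match k with
    | 0 => (quo (m - n) 6, n) | 1 => (- quo (m - n - 1) 6, 1 - n) | 2 => (quo (m - n - 2) 6, n)
    | 3 => (quo (m - n - 3) 6, - quo (m - n - 3) 6 - n) | 4 => (quo (m - n - 4) 6, n)
    | _ => (quo (m - n + 1) 6, n) end).
rewrite /H /eH.
by congr (_ + _ + _ + _ + _ + _); cell.
Qed.
End L7.

(** * Level 23: theta series of binary quadratic forms *)

Section L23.
Implicit Types r : fps int.

(* Representatives of the principal and non-principal classes of binary quadratic forms of
   discriminant -23. *)
Definition eA (a b : int) : nat := absz (a * a + a * b + 6 * b * b).
Definition eB (a b : int) : nat := absz (2 * a * a + a * b + 3 * b * b).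

Lemma locfin_bound (e : int * int -> nat) c :
  (forall a b, (`|a| <= c * e (a, b))%N /\ (`|b| <= c * e (a, b))%N) -> locfin e.
Proof.
move=> H n; exists [seq (a, b) | a <- int_range (c * n), b <- int_range (c * n)].
move=> [a b] /negP nin; rewrite ltnNge; apply/negP => en; apply: nin.
have [Ha Hb] := H a b; have cn : (c * e (a, b) <= c * n)%N by rewrite leq_mul2l en orbT.
by apply/allpairsP; exists (a, b); rewrite !mem_int_range (leq_trans Ha) // (leq_trans Hb).
Qed.

Lemma absz_le_sqr (x y : int) : x * x <= 2 * y -> (`|x| <= 2 * `|y|)%N.
Proof.
move=> xy; have H : `|x|%:Z <= x * x.
  have [->|x0] := eqVneq x 0; first by [].
  have [x1|x1] : x <= -1 \/ 1 <= x by lia.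
    by have : 0 <= (x + 1) * x; [nia | lia].
  by have : 0 <= (x - 1) * x; [nia | lia].
by lia.
Qed.

Lemma locfin_eA : locfin (on2 eA).
Proof.
apply: (@locfin_bound _ 2) => a b; rewrite /on2 /eA /=.
(* Completing squares: 24 E = 23 a^2 + (a + 12 b)^2 and 4 E = 23 b^2 + (2a + b)^2 for the form E,
   whence a^2, b^2 <= 2 E. *)
have H1 : 0 <= (a + 12 * b) * (a + 12 * b) by rewrite -expr2 Num.Theory.sqr_ge0.
have H2 : 0 <= (2 * a + b) * (2 * a + b) by rewrite -expr2 Num.Theory.sqr_ge0.
have Ha : 0 <= a * a by rewrite -expr2 Num.Theory.sqr_ge0.
have Hb : 0 <= b * b by rewrite -expr2 Num.Theory.sqr_ge0.
by split; apply: absz_le_sqr; lia.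
Qed.

Lemma locfin_eB : locfin (on2 eB).
Proof.
apply: (@locfin_bound _ 2) => a b; rewrite /on2 /eB /=.
have H1 : 0 <= (a + 6 * b) * (a + 6 * b) by rewrite -expr2 Num.Theory.sqr_ge0.
have H2 : 0 <= (4 * a + b) * (4 * a + b) by rewrite -expr2 Num.Theory.sqr_ge0.
have Ha : 0 <= a * a by rewrite -expr2 Num.Theory.sqr_ge0.
have Hb : 0 <= b * b by rewrite -expr2 Num.Theory.sqr_ge0.
by split; apply: absz_le_sqr; lia.
Qed.

Definition thA r := qsum r (fun=> 1) (on2 eA).
Definition thB r := qsum r (fun=> 1) (on2 eB).

Local Ltac cell23 := first [apply: qsum0 => // | apply: eq_qsumZ] => -[? ?];
  rewrite /on2 /the /kmul /eA /eB /= ?mul1r ?mulr1 -?epsD; (try split); tri_cases.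

Local Ltac zsplit23 K c h g :=
  rewrite (@qsum_split2 _ _ K c h g) //;
  [ expand | first [exact: locfin_eA | exact: locfin_eB | exact: locfin_kmul locfin_eA
             | exact: locfin_kmul locfin_eB | locfin_tac] | split_cover | split_class ].

(** The classical expression of eta(z) eta(23 z) as half the difference of two theta series. The
    parts [EV] and [TH] occur in both theta series and cancel. *)
Lemma pent23_theta r : r 0%N = 0 ->
  2 * (r * (pent r * pent (r ^+ 23))) = thA r - thB r.
Proof.
move=> r0; rewrite -{1 2}(expr1 r) !pentE qsumM; [|exact: r0|locfin_tac|locfin_tac].
rewrite (qsumX r0 1); last by locfin_tac.
pose G1 := qsum r (fun=> 1) (on2 (fun n b => eA (6 * n - 1) b)).
pose G2 := qsum r (fun=> 1) (on2 (fun n l => eB (l + 1 - 3 * n) (3 * n + l))).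
pose EV := qsum r (fun=> 1) (on2 (fun k b => eA (2 * k) b)).
pose TH := qsum r (fun=> 1) (on2 (fun n b => eA (6 * n + 3) b)).
have -> : thA r = 1%:~R * EV + 1%:~R * TH + 1%:~R * G1 + 1%:~R * G1.
  rewrite /thA.
  zsplit23 4%N (fun a b : int => if rem a 2 == 0 then 0%N else if rem a 6 == 3 then 1%N
      else if rem a 6 == 5 then 2%N else 3%N)
    (fun (k : nat) (n b : int) => match k with 0 => (2 * n, b) | 1 => (6 * n + 3, b)
      | 2 => (6 * n - 1, b) | _ => (1 - 6 * n, - b) end)
    (fun (k : nat) (a b : int) => match k with 0 => (quo a 2, b) | 1 => (quo (a - 3) 6, b)
      | 2 => (quo (a + 1) 6, b) | _ => (quo (1 - a) 6, - b) end).
  by congr (_ + _ + _ + _); cell23.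
have -> : thB r = 1%:~R * EV + 1%:~R * TH + 1%:~R * G2 + 1%:~R * G2.
  rewrite /thB.
  zsplit23 4%N (fun a b : int => if rem (b - a) 2 == 0 then 0%N else if rem (b - a) 6 == 3 then 1%N
      else if rem (b - a) 6 == 5 then 2%N else 3%N)
    (fun (k : nat) (n b : int) => match k with 0 => (b - n, b + n)
      | 1 => (- 2 * (2 * n + 1) - b, 2 * n + 1 - b)
      | 2 => (b + 1 - 3 * n, 3 * n + b) | _ => (3 * n - b - 1, - 3 * n - b) end)
    (fun (k : nat) (a b : int) => match k with 0 => (quo (b - a) 2, quo (a + b) 2)
      | 1 => (quo (b - a - 3) 6, 2 * quo (b - a - 3) 6 + 1 - b)
      | 2 => (quo (b - a + 1) 6, b - 3 * quo (b - a + 1) 6)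
      | _ => (quo (a - b + 1) 6, - b - 3 * quo (a - b + 1) 6) end).
  by congr (_ + _ + _ + _); cell23.
transitivity (2 * (1%:~R * G1 + (-1)%:~R * G2)); last by ring.
congr (_ * _).
zsplit23 2%N (fun m n : int => if rem (m - n) 2 == 0 then 0%N else 1%N)
  (fun (k : nat) (n b : int) => match k with 0 => (n + 2 * b, n) | _ => (n + 2 * b + 1, n) end)
  (fun (k : nat) (m n : int) => match k with 0 => (n, quo (m - n) 2) | _ => (n, quo (m - n - 1) 2) end).
by congr (_ + _); cell23.
Qed.

(** The form a^2 + ab + 6b^2 is even exactly when a or a + b is even. These are the two prime ideals
    above 2, both non-principal, and on each the form is twice one of the class of [eB]; their
    intersection 2 Z^2 contributes [thA (r ^+ 4)]. The proof carries out this inclusion-exclusion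
    with disjoint classes. *)
Lemma thA_even r : r 0%N = 0 ->
  thA r + thA (- r) = 2 * (2 * thB (r ^+ 2) - thA (r ^+ 4)).
Proof.
move=> r0; rewrite {1 2}/thA qsum_evenpart //; last exact: locfin_eA.
rewrite /thB /thA !qsum_kmul.
set A4 := qsum r _ (kmul 4 _).
pose Z := qsum r (fun=> 1) (on2 (fun k l => 2 * eB k (2 * l + 1))%N).
have B2 : qsum r (fun=> 1) (kmul 2 (on2 eB)) = 1%:~R * A4 + 1%:~R * Z.
  zsplit23 2%N (fun a b : int => if rem b 2 == 0 then 0%N else 1%N)
    (fun (k : nat) (a b : int) => match k with 0 => (a, 2 * b) | _ => (a, 2 * b + 1) end)
    (fun (k : nat) (a b : int) => match k with 0 => (a, quo b 2) | _ => (a, quo (b - 1) 2) end).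
  by congr (_ + _); cell23.
transitivity (2%:~R * qsum r (fun=> 1) (kmul 2 (on2 eB)) + 2%:~R * Z + 0); last first.
  by rewrite B2; ring.
zsplit23 3%N (fun a b : int => if rem a 2 == 0 then 0%N else if rem b 2 == 1 then 1%N else 2%N)
  (fun (k : nat) (a b : int) => match k with 0 => (2 * a, b)
     | 1 => (- 2 * a - (2 * b + 1), 2 * b + 1) | _ => (2 * a + 1, 2 * b) end)
  (fun (k : nat) (a b : int) => match k with 0 => (quo a 2, b)
     | 1 => (- quo (a + b) 2, quo (b - 1) 2) | _ => (quo (a - 1) 2, quo b 2) end).
by congr (_ + _ + _); cell23.
Qed.

(** Likewise 2a^2 + ab + 3b^2 is even when b or a + b is even. On the first sublattice it is twice
    [eA], on the second twice a form equivalent to [eB], and on the intersection 4 [eB]. *)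
Lemma thB_even r : r 0%N = 0 ->
  thB r + thB (- r) = 2 * (thA (r ^+ 2) + thB (r ^+ 2) - thB (r ^+ 4)).
Proof.
move=> r0; rewrite {1 2}/thB qsum_evenpart //; last exact: locfin_eB.
rewrite /thB /thA !qsum_kmul.
set B4 := qsum r _ (kmul 4 _); set A2 := qsum r _ (kmul 2 (on2 eA)).
pose Z := qsum r (fun=> 1) (on2 (fun i j => 2 * eB i (i + 2 * j + 1))%N).
have -> : qsum r (fun=> 1) (kmul 2 (on2 eB)) = 1%:~R * B4 + 1%:~R * Z.
  zsplit23 2%N (fun a b : int => if rem (b - a) 2 == 0 then 0%N else 1%N)
    (fun (k : nat) (a b : int) => match k with 0 => (b - a, b + a) | _ => (a, a + 2 * b + 1) end)
    (fun (k : nat) (a b : int) => match k with 0 => (quo (b - a) 2, quo (b + a) 2)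
       | _ => (a, quo (b - a - 1) 2) end).
  by congr (_ + _); cell23.
transitivity (2%:~R * A2 + 2%:~R * Z + 0); last by ring.
zsplit23 3%N (fun a b : int => if rem b 2 == 0 then 0%N else if rem a 2 == 1 then 1%N else 2%N)
  (fun (k : nat) (a b : int) => match k with 0 => (a, 2 * b)
     | 1 => (2 * b + 1, 2 * a + 2 * b + 1) | _ => (2 * a, 2 * b + 1) end)
  (fun (k : nat) (a b : int) => match k with 0 => (a, quo b 2)
     | 1 => (quo (b - a) 2, quo (a - 1) 2) | _ => (quo a 2, quo (b - 1) 2) end).
by congr (_ + _ + _); cell23.
Qed.

End L23.

(** * Product evaluations *)

Section Products.
Variables (R : comUnitRingType) (r : fps R).
Hypothesis r0 : r 0%N = 0.

Let P a n := qpoch (r ^+ a) (r ^+ n).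
Let M a n := qpoch (- r ^+ a) (r ^+ n).

Lemma PM_dissect a n m : (0 < n)%N ->
  P a n = \prod_(i < m.+1) P (a + n * i) (n * m.+1) /\
  M a n = \prod_(i < m.+1) M (a + n * i) (n * m.+1).
Proof.
move=> n0; rewrite /P /M; have rn0 : (r ^+ n) 0%N = 0 by rewrite fps_exp0.
split; rewrite (qpoch_dissect m _ rn0); apply: eq_bigr => i _.
  by rewrite -!exprM -exprD.
by rewrite -!exprM mulNr -exprD.
Qed.

Lemma prod2 (F : nat -> fps R) : \prod_(i < 2) F i = F 0%N * F 1%N.
Proof. by rewrite !big_ord_recl big_ord0 mulr1. Qed.

Lemma prod3 (F : nat -> fps R) : \prod_(i < 3) F i = F 0%N * F 1%N * F 2%N.
Proof. by rewrite !big_ord_recl big_ord0 mulr1 !mulrA. Qed.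

Lemma prod5 (F : nat -> fps R) :
  \prod_(i < 5) F i = F 0%N * F 1%N * F 2%N * F 3%N * F 4%N.
Proof. by rewrite !big_ord_recl big_ord0 mulr1 !mulrA. Qed.

(** The new indices are passed together with equations, so that at numerals the products come out
    with literal exponents. *)
Lemma dissect2 a n b N : b = (a + n)%N -> N = (2 * n)%N -> (0 < n)%N ->
  P a n = P a N * P b N /\ M a n = M a N * M b N.
Proof.
move=> -> -> n0; have [p q] := PM_dissect a 1 n0.
rewrite p q (prod2 (fun i => P (a + n * i) (n * 2))) (prod2 (fun i => M (a + n * i) (n * 2))).
by rewrite muln0 addn0 muln1 mulnC.
Qed.

Lemma dissect3 a n b c N : b = (a + n)%N -> c = (a + 2 * n)%N -> N = (3 * n)%N ->
  (0 < n)%N ->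
  P a n = P a N * P b N * P c N /\ M a n = M a N * M b N * M c N.
Proof.
move=> -> -> -> n0; have [p q] := PM_dissect a 2 n0.
rewrite p q (prod3 (fun i => P (a + n * i) (n * 3))) (prod3 (fun i => M (a + n * i) (n * 3))).
by rewrite muln0 addn0 muln1 !(mulnC n).
Qed.

Lemma dissect5 a n b c d e N : b = (a + n)%N -> c = (a + 2 * n)%N ->
  d = (a + 3 * n)%N -> e = (a + 4 * n)%N -> N = (5 * n)%N -> (0 < n)%N ->
  P a n = P a N * P b N * P c N * P d N * P e N /\
  M a n = M a N * M b N * M c N * M d N * M e N.
Proof.
move=> -> -> -> -> -> n0; have [p q] := PM_dissect a 4 n0.
rewrite p q (prod5 (fun i => P (a + n * i) (n * 5))) (prod5 (fun i => M (a + n * i) (n * 5))).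
by rewrite muln0 addn0 muln1 !(mulnC n).
Qed.

Lemma jtp_neg a b : (0 < a)%N -> (0 < b)%N ->
  th (- r ^+ a) (- r ^+ b) = P a (a + b) * P b (a + b) * P (a + b) (a + b).
Proof.
move=> a0 b0; have A0 : (- r ^+ a) 0%N = 0 by rewrite fps_coefN fps_exp0 ?oppr0.
have B0 : (- r ^+ b) 0%N = 0 by rewrite fps_coefN fps_exp0 ?oppr0.
by rewrite (jacobi_triple A0 B0) !opprK mulrNN -exprD.
Qed.

Lemma jtp_pos a b : (0 < a)%N -> (0 < b)%N ->
  th (r ^+ a) (r ^+ b) = M a (a + b) * M b (a + b) * P (a + b) (a + b).
Proof.
move=> a0 b0.
by rewrite (jacobi_triple (fps_exp0 r0 a0) (fps_exp0 r0 b0)) -exprD.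
Qed.

Lemma PM_sqr a n : (0 < n)%N -> P a n * M a n = P (a * 2) (n * 2).
Proof. by move=> n0; rewrite /P /M (qpoch_sqr _ (fps_exp0 r0 n0)) -!exprM. Qed.

End Products.

Definition eul (R : comUnitRingType) (r : fps R) := qpoch r r.
Definition chi (R : comUnitRingType) (r : fps R) := qpoch r (r ^+ 2).

Ltac qpoch_ring := repeat match goal with
  | |- context [qpoch ?a ?b] => move: (qpoch a b) => ?
  end; ring.

Section EulerProducts.
Variables (R : comUnitRingType) (r : fps R).
Hypothesis r0 : r 0%N = 0.

Lemma chiX k : chi (r ^+ k) = qpoch (r ^+ k) (r ^+ (k * 2)). Proof. by rewrite /chi -exprM. Qed.

Lemma eul_chi : eul r = chi r * eul (r ^+ 2).
Proof. by rewrite /eul /chi -{1 2}(expr1 r) (dissect2 r0 (a := 1) (n := 1) (b := 2) (N := 2) erefl erefl isT).1 expr1. Qed.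

Lemma chi_opp : chi r * chi (- r) = chi (r ^+ 2).
Proof. by rewrite /chi sqrrN qpoch_sqr // fps_exp0. Qed.

Lemma eul0 : eul r 0%N = 1. Proof. exact: qpoch_coef0. Qed.
Lemma chi0 : chi r 0%N = 1. Proof. exact: qpoch_coef0. Qed.

Lemma pent_eul : pent r = eul r.
Proof.
rewrite /pent /eul -{1 3 4}(expr1 r) (jtp_neg r0 (a := 1) (b := 2) isT isT).
by rewrite (dissect3 r0 (a := 1) (n := 1) (b := 2) (c := 3) (N := 3) erefl erefl erefl isT).1.
Qed.

Lemma phi_chi : phi (- r) = chi r ^+ 2 * eul (r ^+ 2).
Proof.
rewrite /phi /chi /eul -{1 2 3}(expr1 r) (jtp_neg r0 (a := 1) (b := 1) isT isT) expr2 //.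
Qed.

Lemma psi_eul : psi r * chi r = eul (r ^+ 2).
Proof.
rewrite /psi /chi /eul -{1 3}(expr1 r) (jtp_pos r0 (a := 1) (b := 3) isT isT).
rewrite (dissect2 r0 (a := 2) (n := 2) (b := 4) (N := 4) erefl erefl isT).1.
rewrite -(PM_sqr r0 1 (n := 2) isT) (dissect2 r0 (a := 1) (n := 2) (b := 3) (N := 4) erefl erefl isT).2.
qpoch_ring.
Qed.

Lemma negpoch_eul k : (0 < k)%N ->
  qpoch (- r ^+ k) (r ^+ k) * eul (r ^+ k) = eul (r ^+ (k * 2)).
Proof. by move=> k0; rewrite /eul mulrC (PM_sqr r0 k k0). Qed.

Lemma Af_eul : Af r * eul (r ^+ 6) * eul r = eul (r ^+ 2) * eul (r ^+ 3) ^+ 2.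
Proof.
rewrite -(@negpoch_eul 3 isT) -(@negpoch_eul 1 isT).
rewrite /Af -{1 2}(expr1 r) (jtp_pos r0 (a := 1) (b := 2) isT isT) expr1.
have := (dissect3 r0 (a := 1) (n := 1) (b := 2) (c := 3) (N := 3) erefl erefl erefl isT).2.
rewrite expr1 => ->; rewrite /eul; qpoch_ring.
Qed.

Lemma Bf_chi : Bf r * chi (r ^+ 3) = chi r * eul (r ^+ 6).
Proof.
rewrite /Bf chiX /chi /eul -{1 4}(expr1 r) (jtp_neg r0 (a := 1) (b := 5) isT isT).
rewrite (dissect3 r0 (a := 1) (n := 2) (b := 3) (c := 5) (N := 6) erefl erefl erefl isT).1.
qpoch_ring.
Qed.

Lemma sT_tT : sT r * tT r = eul r * eul (r ^+ 5).
Proof.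
rewrite /sT /tT /eul -{1 5 6}(expr1 r) (jtp_neg r0 (a := 1) (b := 4) isT isT) (jtp_neg r0 (a := 2) (b := 3) isT isT).
rewrite (dissect5 r0 (a := 1) (n := 1) (b := 2) (c := 3) (d := 4) (e := 5) (N := 5) erefl erefl erefl erefl erefl isT).1.
qpoch_ring.
Qed.

Lemma sP_tP : sP r * tP r * eul r * eul (r ^+ 10) = eul (r ^+ 2) * eul (r ^+ 5) ^+ 3.
Proof.
rewrite -(@negpoch_eul 5 isT) -(@negpoch_eul 1 isT).
rewrite /sP /tP -{1}(expr1 r) (jtp_pos r0 (a := 1) (b := 4) isT isT) (jtp_pos r0 (a := 2) (b := 3) isT isT).
rewrite (dissect5 r0 (a := 1) (n := 1) (b := 2) (c := 3) (d := 4) (e := 5) (N := 5) erefl erefl erefl erefl erefl isT).2.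
rewrite expr1 /eul; qpoch_ring.
Qed.

Lemma n1_n3 : n1 r * n3 r * chi (r ^+ 5) = chi r * eul (r ^+ 10) ^+ 2.
Proof.
rewrite /n1 /n3 chiX /chi /eul -{1 5}(expr1 r).
rewrite (jtp_neg r0 (a := 1) (b := 9) isT isT) (jtp_neg r0 (a := 3) (b := 7) isT isT).
rewrite (dissect5 r0 (a := 1) (n := 2) (b := 3) (c := 5) (d := 7) (e := 9) (N := 10) erefl erefl erefl erefl erefl isT).1.
qpoch_ring.
Qed.

Lemma sT_sP : sT r * sP r * eul (r ^+ 10) = sT (r ^+ 2) * eul (r ^+ 5) ^+ 2.
Proof.
rewrite /sT /sP -!exprM -{1 3}(expr1 r) /eul.
rewrite (jtp_neg r0 (a := 1) (b := 4) isT isT) (jtp_pos r0 (a := 1) (b := 4) isT isT).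
rewrite (jtp_neg r0 (a := 2) (b := 8) isT isT).
rewrite -(PM_sqr r0 1 (n := 5) isT) -(PM_sqr r0 4 (n := 5) isT).
qpoch_ring.
Qed.

Lemma tT_tP : tT r * tP r * eul (r ^+ 10) = tT (r ^+ 2) * eul (r ^+ 5) ^+ 2.
Proof.
rewrite /tT /tP -!exprM /eul.
rewrite (jtp_neg r0 (a := 2) (b := 3) isT isT) (jtp_pos r0 (a := 2) (b := 3) isT isT).
rewrite (jtp_neg r0 (a := 4) (b := 6) isT isT).
rewrite -(PM_sqr r0 2 (n := 5) isT) -(PM_sqr r0 3 (n := 5) isT).
qpoch_ring.
Qed.

Lemma sT_n1 : sT r * eul (r ^+ 10) ^+ 2 = n1 r * tT (r ^+ 2) * eul (r ^+ 5).
Proof.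
rewrite /sT /n1 /tT -!exprM -{1 4}(expr1 r) /eul.
rewrite (jtp_neg r0 (a := 1) (b := 4) isT isT) (jtp_neg r0 (a := 1) (b := 9) isT isT).
rewrite (jtp_neg r0 (a := 4) (b := 6) isT isT).
rewrite (dissect2 r0 (a := 1) (n := 5) (b := 6) (N := 10) erefl erefl isT).1.
rewrite (dissect2 r0 (a := 4) (n := 5) (b := 9) (N := 10) erefl erefl isT).1.
qpoch_ring.
Qed.

Lemma tT_n3 : tT r * eul (r ^+ 10) ^+ 2 = n3 r * sT (r ^+ 2) * eul (r ^+ 5).
Proof.
rewrite /tT /n3 /sT -!exprM /eul.
rewrite (jtp_neg r0 (a := 2) (b := 3) isT isT) (jtp_neg r0 (a := 3) (b := 7) isT isT).
rewrite (jtp_neg r0 (a := 2) (b := 8) isT isT).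
rewrite (dissect2 r0 (a := 2) (n := 5) (b := 7) (N := 10) erefl erefl isT).1.
rewrite (dissect2 r0 (a := 3) (n := 5) (b := 8) (N := 10) erefl erefl isT).1.
qpoch_ring.
Qed.

End EulerProducts.

(** * Substitutions *)

(** The lowest nonzero coefficients of the two factors multiply to a nonzero coefficient of the
    product. *)
Fact fps_int_integral : GRing.integral_domain_axiom (fps int).
Proof.
move=> f g fg0; apply/orP.
have low (h : fps int) : h != 0 ->
    exists2 n, h n != 0 & forall i, (i < n)%N -> h i = 0.
  move=> hN0; have ex : exists n, h n != 0.
    apply: contrapT => nex; move/eqP: hN0; apply; apply: fpsP => n.
    by apply/eqP; apply: contraPT nex => hn; apply; exists n.
  case: (ex_minnP ex) => n hn minn; exists n => // i; apply: contraTeq => hi.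
  by rewrite -leqNgt minn.
have [f0|/low[i fi fi0]] := boolP (f == 0); first by left.
have [g0|/low[j gj gj0]] := boolP (g == 0); first by right.
have : (f * g) (i + j)%N = 0 by rewrite fg0.
rewrite fps_coefM (bigD1 (Ordinal (leq_addr j i : (i < (i + j).+1)%N))) //= big1 => [|k].
  by rewrite addr0 addKn => /eqP; rewrite mulf_eq0 (negbTE fi) (negbTE gj).
rewrite -val_eqE /= => ki; have [lt|ge] := ltnP k i; first by rewrite fi0 ?mul0r.
by rewrite gj0 ?mulr0 //; have := ltn_ord k; lia.
Qed.

HB.instance Definition _ :=
  GRing.ComUnitRing_isIntegral.Build (fps int) fps_int_integral.

Lemma fpsXM (f : fps int) n :
  (fpsX int * f) n = if n is n'.+1 then f n' else 0.
Proof.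
rewrite fps_coefM; case: n => [|n]; first by rewrite big_ord1 mul0r.
rewrite big_ord_recl mul0r add0r big_ord_recl mul1r big1 ?addr0; first by rewrite subn1.
by move=> i _; rewrite mul0r.
Qed.

Lemma fpsXnM k (f : fps int) n :
  (fpsX int ^+ k * f) n = if (n < k)%N then 0 else f (n - k)%N.
Proof.
elim: k f n => [|k IH] f n; first by rewrite expr0 mul1r subn0.
by rewrite exprS -mulrA fpsXM; case: n => [|n] //; rewrite IH ltnS subSS.
Qed.

Lemma fpsXn_coef k n : (fpsX int ^+ k) n = (n == k)%:R.
Proof.
rewrite -[fpsX int ^+ k]mulr1 fpsXnM fps_coef1 subn_eq0.
by case: ltngtP.
Qed.

Section Dilation.
Variables (c : int) (k : nat).
Implicit Types f g : fps int.

(* f(q) |-> f(c q^(k+1)) *)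
Definition dil f : fps int :=
  Fps (fun n => if (k.+1 %| n)%N then c ^+ (n %/ k.+1) * f (n %/ k.+1)%N else 0).

Lemma dil_coef f m : dil f (k.+1 * m)%N = c ^+ m * f m.
Proof. by rewrite /= dvdn_mulr // mulKn. Qed.

Lemma dil_coefN f n : ~~ (k.+1 %| n)%N -> dil f n = 0.
Proof. by move=> /negbTE /= ->. Qed.

Fact dil_additive : zmod_morphism dil.
Proof.
move=> f g; apply: fpsP => n; rewrite fps_coefB.
have [/dvdnP[m ->]|nk] := boolP (k.+1 %| n)%N; last by rewrite !dil_coefN ?subr0.
by rewrite mulnC !dil_coef fps_coefB mulrBr.
Qed.

Lemma sum_multiples (F : nat -> int) m : (forall i, ~~ (k.+1 %| i)%N -> F i = 0) ->
  \sum_(i < (k.+1 * m).+1) F i = \sum_(j < m.+1) F (k.+1 * j)%N.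
Proof.
move=> F0; elim: m => [|m IH]; first by rewrite muln0 !big_ord1 muln0.
have -> : ((k.+1 * m.+1).+1 = (k.+1 * m).+1 + k.+1)%N by lia.
rewrite big_split_ord IH [RHS]big_ord_recr; congr (_ + _).
rewrite big_ord_recr big1 => [|i _].
  by rewrite [LHS]add0r; congr F; rewrite /=; lia.
apply: F0; rewrite /= addSnnS dvdn_addr ?dvdn_mulr //.
by apply/negP => /dvdn_leq; have := ltn_ord i; lia.
Qed.

Fact dil_multiplicative : monoid_morphism dil.
Proof.
split=> [|f g].
  apply: fpsP => n; have [/dvdnP[m ->]|nk] := boolP (k.+1 %| n)%N.
    by rewrite mulnC dil_coef !fps_coef1; case: m => [|m]; rewrite ?muln0 ?expr0 ?mulr1 ?mulr0.
  by rewrite dil_coefN // fps_coef1; case: eqP nk => // ->; rewrite dvdn0.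
apply: fpsP => n; have [/dvdnP[m ->]|nk] := boolP (k.+1 %| n)%N.
  rewrite mulnC dil_coef !fps_coefM.
  rewrite (sum_multiples (F := fun i => dil f i * dil g (k.+1 * m - i)%N)) => [|i /dil_coefN ->]; last by rewrite mul0r.
  rewrite mulr_sumr; apply: eq_bigr => j _; rewrite -mulnBr !dil_coef.
  by rewrite mulrACA -exprD subnKC // -ltnS.
rewrite dil_coefN // fps_coefM big1 // => i _.
have [ki|ki] := boolP (k.+1 %| i)%N; last by rewrite dil_coefN ?mul0r.
rewrite [dil g _]dil_coefN ?mulr0 //; apply: contra nk => kni.
by rewrite -(subnKC (leq_ord i)) dvdn_add.
Qed.

HB.instance Definition _ :=
  GRing.isZmodMorphism.Build (fps int) (fps int) dil dil_additive.
HB.instance Definition _ :=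
  GRing.isMonoidMorphism.Build (fps int) (fps int) dil dil_multiplicative.

Lemma dil_X : dil (fpsX int) = (fpsX int ^+ k.+1) *~ c.
Proof.
apply: fpsP => n; rewrite fps_coefMz fpsXn_coef.
have [/dvdnP[m ->]|nk] := boolP (k.+1 %| n)%N.
  rewrite mulnC dil_coef /= -{2}(muln1 k.+1) eqn_pmul2l //.
  by case: eqP => [->|_]; rewrite ?mulr0 ?mul0rz // expr1 mulr1 intz.
by rewrite dil_coefN //; case: eqP nk => [->|_ _]; rewrite ?dvdnn ?mul0rz.
Qed.

Lemma dil_qpoch (a r : fps int) : r 0%N = 0 -> dil (qpoch a r) = qpoch (dil a) (dil r).
Proof.
move=> r0; have dr0 : dil r 0%N = 0 by rewrite -(muln0 k.+1) dil_coef r0 mulr0.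
have prodE N : \prod_(j < N) (1 - dil a * dil r ^+ j) = dil (\prod_(j < N) (1 - a * r ^+ j)).
  rewrite rmorph_prod; apply: eq_bigr => j _.
  by rewrite rmorphB rmorph1 rmorphM rmorphXn.
apply: fpsP => n; rewrite -(qpoch_stable _ dr0 (leqnn n.+1)) prodE.
have [/dvdnP[m ->]|nk] := boolP (k.+1 %| n)%N; last by rewrite !dil_coefN.
rewrite mulnC !dil_coef qpoch_stable //; lia.
Qed.

End Dilation.

(** * Modular equations in the field of fractions *)

Local Notation K := {fraction (fps int)}.
Local Notation "x %:F" := (@FracField.tofrac (fps int) x).

Lemma tofrac_inj (f g : fps int) : f%:F = g%:F :> K -> f = g.
Proof. by move/eqP; rewrite tofrac_eq => /eqP. Qed.

Lemma tofrac_neq0 (f : fps int) n : f n != 0 -> f%:F != 0 :> K.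
Proof. by rewrite tofrac_eq0; apply: contraNneq => ->. Qed.

Lemma oppX (r : fps int) k : odd k -> (- r) ^+ k = - r ^+ k.
Proof. by move=> ok; rewrite exprNn -signr_odd ok expr1 mulN1r. Qed.

Lemma solve_Af (F : fieldType) (A x1 x3 e1 e2 e3 e6 : F) :
  e1 = x1 * e2 -> e3 = x3 * e6 -> x1 != 0 -> e2 != 0 -> e6 != 0 ->
  A * e6 * e1 = e2 * e3 ^+ 2 -> A = x3 ^+ 2 * e6 / x1.
Proof.
move=> -> -> nx1 ne2 ne6 H.
have -> : A = (A * e6 * (x1 * e2)) / (e6 * (x1 * e2)) by field; rewrite ne6 nx1 ne2.
by rewrite H; field; rewrite ne6 nx1 ne2.
Qed.

(* In the notation of the header, at q = r: [xx_ r k] is x_k, [yy_ r k] is the image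
   of x_k under q |-> -q when k is odd, and [ee_ r k] is (q^k; q^k)_oo. *)
HB.lock Definition xx_ (r : fps int) (k : nat) : K := (chi (r ^+ k))%:F.
HB.lock Definition yy_ (r : fps int) (k : nat) : K := (chi (- r ^+ k))%:F.
HB.lock Definition ee_ (r : fps int) (k : nat) : K := (eul (r ^+ k))%:F.
Notation xx := xx_.
Notation yy := yy_.
Notation ee := ee_.

Section Quotients.
Variable r : fps int.
Hypothesis r0 : r 0%N = 0.
Local Notation xx := (xx_ r).
Local Notation yy := (yy_ r).
Local Notation ee := (ee_ r).

Lemma xxE k : xx k = (chi (r ^+ k))%:F. Proof. by rewrite xx_.unlock. Qed.
Lemma yyE k : yy k = (chi (- r ^+ k))%:F. Proof. by rewrite yy_.unlock. Qed.
Lemma eeE k : ee k = (eul (r ^+ k))%:F. Proof. by rewrite ee_.unlock. Qed.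

Lemma exp0 k : (0 < k)%N -> (r ^+ k) 0%N = 0. Proof. exact: fps_exp0. Qed.
Lemma expN0 k : (0 < k)%N -> (- r ^+ k) 0%N = 0.
Proof. by move=> k0; rewrite fps_coefN exp0 // oppr0. Qed.

Lemma xx_neq0 k : (0 < k)%N -> xx k != 0.
Proof. by move=> k0; rewrite xxE; apply: (@tofrac_neq0 _ 0); rewrite (chi0 (exp0 k0)). Qed.
Lemma yy_neq0 k : (0 < k)%N -> yy k != 0.
Proof. by move=> k0; rewrite yyE; apply: (@tofrac_neq0 _ 0); rewrite (chi0 (expN0 k0)). Qed.
Lemma ee_neq0 k : (0 < k)%N -> ee k != 0.
Proof. by move=> k0; rewrite eeE; apply: (@tofrac_neq0 _ 0); rewrite (eul0 (exp0 k0)). Qed.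

Lemma ee_xx k n : (0 < k)%N -> n = (k * 2)%N -> ee k = xx k * ee n.
Proof. by move=> k0 ->; rewrite xxE !eeE (eul_chi (exp0 k0)) rmorphM -exprM. Qed.

Lemma ee_yy k n : (0 < k)%N -> n = (k * 2)%N -> (eul (- r ^+ k))%:F = yy k * ee n.
Proof. by move=> k0 ->; rewrite yyE eeE (eul_chi (expN0 k0)) rmorphM sqrrN -exprM. Qed.

Lemma xx_yy k n : (0 < k)%N -> n = (k * 2)%N -> xx k * yy k = xx n.
Proof. by move=> k0 ->; rewrite !xxE yyE -rmorphM (chi_opp (exp0 k0)) -exprM. Qed.

Lemma psi_xx k n : (0 < k)%N -> n = (k * 2)%N -> (psi (r ^+ k))%:F = ee n / xx k :> K.
Proof.
move=> k0 ->; apply: (canRL (mulfK (xx_neq0 k0))).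
by rewrite xxE eeE -rmorphM (psi_eul (exp0 k0)) -exprM.
Qed.

Lemma psi_yy k n : (0 < k)%N -> n = (k * 2)%N -> (psi (- r ^+ k))%:F = ee n / yy k :> K.
Proof.
move=> k0 ->; apply: (canRL (mulfK (yy_neq0 k0))).
by rewrite yyE eeE -rmorphM (psi_eul (expN0 k0)) sqrrN -exprM.
Qed.

Lemma phi_xx k n : (0 < k)%N -> n = (k * 2)%N -> (phi (- r ^+ k))%:F = xx k ^+ 2 * ee n :> K.
Proof. by move=> k0 ->; rewrite xxE eeE (phi_chi (exp0 k0)) rmorphM rmorphXn -exprM. Qed.

Lemma phi_yy k n : (0 < k)%N -> n = (k * 2)%N -> (phi (r ^+ k))%:F = yy k ^+ 2 * ee n :> K.
Proof.
move=> k0 ->; rewrite -[r ^+ k]opprK (phi_chi (expN0 k0)) rmorphM rmorphXn.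
by rewrite yyE eeE sqrrN -exprM.
Qed.

Lemma Bf_xx k k3 k6 : (0 < k)%N -> k3 = (k * 3)%N -> k6 = (k * 6)%N ->
  (Bf (r ^+ k))%:F = xx k * ee k6 / xx k3 :> K.
Proof.
move=> k0 -> ->; apply: (canRL (mulfK (xx_neq0 _))); first by rewrite muln_gt0 k0.
by rewrite !xxE eeE !exprM -!rmorphM (Bf_chi (exp0 k0)).
Qed.

Lemma Af_xx k k3 k6 : (0 < k)%N -> k3 = (k * 3)%N -> k6 = (k * 6)%N ->
  (Af (r ^+ k))%:F = xx k3 ^+ 2 * ee k6 / xx k :> K.
Proof.
move=> k0 -> ->; have k30 : (0 < k * 3)%N by rewrite muln_gt0 k0.
have k60 : (0 < k * 6)%N by rewrite muln_gt0 k0.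
have k20 : (0 < k * 2)%N by rewrite muln_gt0 k0.
apply: (@solve_Af _ _ (xx k) (xx (k * 3)) (ee k) (ee (k * 2)) (ee (k * 3))).
- exact: ee_xx.
- by apply: ee_xx => //; lia.
- exact: xx_neq0.
- exact: ee_neq0.
- exact: ee_neq0.
- by rewrite !eeE !exprM -!rmorphM -rmorphXn -rmorphM (Af_eul (exp0 k0)).
Qed.

End Quotients.

Lemma Af_yy (r : fps int) (r0 : r 0%N = 0) k k3 k6 : (0 < k)%N -> k3 = (k * 3)%N -> k6 = (k * 6)%N ->
  (Af (- r ^+ k))%:F = yy r k3 ^+ 2 * ee r k6 / yy r k :> K.
Proof.
move=> k0 -> ->; have e3 : (- r ^+ k) ^+ 3 = - r ^+ (k * 3) by rewrite oppX // exprM.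
have e6 : (- r ^+ k) ^+ 6 = r ^+ (k * 6) by rewrite exprNn -signr_odd expr0 mul1r exprM.
have := @Af_xx _ (expN0 r0 k0) 1 3 6 isT erefl erefl.
by rewrite !xxE !yyE !eeE e3 e6 !expr1.
Qed.

Lemma Bf_yy (r : fps int) (r0 : r 0%N = 0) k k3 k6 : (0 < k)%N -> k3 = (k * 3)%N -> k6 = (k * 6)%N ->
  (Bf (- r ^+ k))%:F = yy r k * ee r k6 / yy r k3 :> K.
Proof.
move=> k0 -> ->; have e3 : (- r ^+ k) ^+ 3 = - r ^+ (k * 3) by rewrite oppX // exprM.
have e6 : (- r ^+ k) ^+ 6 = r ^+ (k * 6) by rewrite exprNn -signr_odd expr0 mul1r exprM.
have := @Bf_xx _ (expN0 r0 k0) 1 3 6 isT erefl erefl.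
by rewrite !xxE !yyE !eeE e3 e6 !expr1.
Qed.

Lemma pent_ee (r : fps int) (r0 : r 0%N = 0) k : (0 < k)%N -> (pent (r ^+ k))%:F = ee r k :> K.
Proof. by move=> k0; rewrite eeE (pent_eul (exp0 r0 k0)). Qed.

Lemma pent_yy (r : fps int) (r0 : r 0%N = 0) k n : (0 < k)%N -> n = (k * 2)%N ->
  (pent (- r ^+ k))%:F = yy r k * ee r n :> K.
Proof. by move=> k0 kn; rewrite (pent_eul (expN0 r0 k0)) (ee_yy r0 k0 kn). Qed.

Section Sign.
Variable r : fps int.
Hypothesis r0 : r 0%N = 0.

Lemma oppX_even k : ~~ odd k -> (- r) ^+ k = r ^+ k.
Proof. by move=> ok; rewrite exprNn -signr_odd (negbTE ok) expr0 mul1r. Qed.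

Lemma xx_opp k : odd k -> xx (- r) k = yy r k.
Proof. by move=> ok; rewrite xxE yyE oppX. Qed.
Lemma xx_pow m k n : n = (m * k)%N -> xx (r ^+ m) k = xx r n.
Proof. by move=> ->; rewrite !xxE exprM. Qed.
Lemma yy_pow m k n : n = (m * k)%N -> yy (r ^+ m) k = yy r n.
Proof. by move=> ->; rewrite !yyE exprM. Qed.
End Sign.

Ltac nz := repeat first [ done | assumption | apply: mulf_neq0 | apply: expf_neq0
  | rewrite invr_neq0 ].
Ltac field_nz := field; rewrite ?andbT; repeat (apply/andP; split); nz.
Ltac nz_side := lazymatch goal with
  | |- is_true (negb (@eq_op _ ?t _)) => lazymatch t with
    | xx_ _ _ => exact: xx_neq0
    | yy_ _ _ => exact: yy_neq0
    | ee_ _ _ => exact: ee_neq0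
    end
  | |- _ => done
  end.
Ltac lift_frac := move=> /(congr1 (@FracField.tofrac (fps int)));
  rewrite !(rmorphB, rmorphD, rmorphM, rmorphN, rmorphXn, rmorph_nat) /=.

(** This and the other [_alg] lemmas are the elimination of the Euler products over a field of
    variables. A letter with an index stands for the product of that index, x, y and e for [xx],
    [yy] and [ee]; here m2 and m6 are [yy] at even indices. *)
Lemma level3_odd_alg (F : fieldType) (A A' P P' A2 B4 r : F) (x1 y1 x2 m2 x3 y3 x4 x6 m6 x12 e6 e12 e24 : F) :
  A = x3 ^+ 2 * e6 / x1 -> A' = y3 ^+ 2 * e6 / y1 ->
  P = e6 / x3 -> P' = e6 / y3 ->
  A2 = m6 ^+ 2 * e12 / m2 -> B4 = x4 * e24 / x12 ->
  x1 * y1 = x2 -> x3 * y3 = x6 -> x2 * m2 = x4 -> x6 * m6 = x12 ->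
  e6 = x6 * e12 -> e12 = x12 * e24 ->
  A * P' - A' * P = 2 * r * A2 * B4 ->
  x1 != 0 -> y1 != 0 -> x3 != 0 -> y3 != 0 -> x4 != 0 -> x12 != 0 -> e24 != 0 ->
  x3 ^+ 3 / x1 - y3 ^+ 3 / y1 = 2 * r / (x6 ^+ 3 / x2).
Proof.
move=> -> -> -> -> -> -> <- <- h2 h6 -> -> H nx1 ny1 nx3 ny3 nx4 nx12 ne24.
have m2E : m2 = x4 / (x1 * y1) by rewrite -h2; field_nz.
have m6E : m6 = x12 / (x3 * y3) by rewrite -h6; field_nz.
move: H; rewrite m2E m6E => H.
apply: (mulIf (x := (x3 * y3) * x12 ^+ 2 * e24 ^+ 2)); first by nz.
by etransitivity; [etransitivity; [|exact: H] |]; field_nz.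
Qed.

Lemma lift_odd3 (A A' P P' A2 B4 r : fps int) : A * P' - A' * P = 2 * r * A2 * B4 ->
  A%:F * P'%:F - A'%:F * P%:F = 2 * r%:F * A2%:F * B4%:F :> K.
Proof. by lift_frac. Qed.

Lemma level3_odd (r : fps int) : r 0%N = 0 ->
  xx r 3 ^+ 3 / xx r 1 - yy r 3 ^+ 3 / yy r 1 = 2 * r%:F / (xx r 6 ^+ 3 / xx r 2).
Proof.
move=> r0; have H : Af (r ^+ 1) * psi (- r ^+ 3) - Af (- r ^+ 1) * psi (r ^+ 3) =
    2 * r * Af (- r ^+ 2) * Bf (r ^+ 4).
  by rewrite expr1 -(lattice_3_odd r0) opprK (@oppX r 3 isT).
have a1 := Af_xx r0 (k := 1) (k3 := 3) (k6 := 6) isT erefl erefl.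
have a2 := @Af_yy r r0 1 3 6 isT erefl erefl.
have a3 := psi_xx r0 (k := 3) (n := 6) isT erefl.
have a4 := psi_yy r0 (k := 3) (n := 6) isT erefl.
have a5 := @Af_yy r r0 2 6 12 isT erefl erefl.
have a6 := Bf_xx r0 (k := 4) (k3 := 12) (k6 := 24) isT erefl erefl.
have b1 := xx_yy r0 (k := 1) (n := 2) isT erefl.
have b2 := xx_yy r0 (k := 3) (n := 6) isT erefl.
have b3 := xx_yy r0 (k := 2) (n := 4) isT erefl.
have b4 := xx_yy r0 (k := 6) (n := 12) isT erefl.
have b5 := ee_xx r0 (k := 6) (n := 12) isT erefl.
have b6 := ee_xx r0 (k := 12) (n := 24) isT erefl.
have L := lift_odd3 H.
apply: (level3_odd_alg a1 a2 a3 a4 a5 a6 b1 b2 b3 b4 b5 b6 L); nz_side.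
Qed.

Lemma level3_even_alg (F : fieldType) (f f' B B' P A x1 y1 x2 x3 y3 x6 e2 e4 e6 e12 : F) :
  f = x1 ^+ 2 * e2 -> f' = y1 ^+ 2 * e2 -> B = x1 * e6 / x3 -> B' = y1 * e6 / y3 ->
  P = e4 / x2 -> A = x6 ^+ 2 * e12 / x2 -> e2 = x2 * e4 -> e6 = x6 * e12 ->
  f * B + f' * B' = 2 * P * A ->
  x2 != 0 -> x3 != 0 -> y3 != 0 -> x6 != 0 -> e4 != 0 -> e12 != 0 ->
  x1 ^+ 3 / x3 + y1 ^+ 3 / y3 = 2 / (x2 ^+ 3 / x6).
Proof.
move=> -> -> -> -> -> -> -> -> H nx2 nx3 ny3 nx6 ne4 ne12.
apply: (mulIf (x := (x2 * e4) * (x6 * e12))); first by nz.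
by etransitivity; [etransitivity; [|exact: H] |]; field_nz.
Qed.

Lemma lift_even3 (f f' B B' P A : fps int) : f * B + f' * B' = 2 * P * A ->
  f%:F * B%:F + f'%:F * B'%:F = 2 * P%:F * A%:F :> K.
Proof. by lift_frac. Qed.

Lemma level3_even (r : fps int) : r 0%N = 0 ->
  xx r 1 ^+ 3 / xx r 3 + yy r 1 ^+ 3 / yy r 3 = 2 / (xx r 2 ^+ 3 / xx r 6).
Proof.
move=> r0.
have H : phi (- r ^+ 1) * Bf (r ^+ 1) + phi (r ^+ 1) * Bf (- r ^+ 1) = 2 * psi (r ^+ 2) * Af (r ^+ 2).
  by rewrite -(lattice_3_even r0) !expr1 opprK.
have a1 := phi_xx r0 (k := 1) (n := 2) isT erefl.
have a2 := phi_yy r0 (k := 1) (n := 2) isT erefl.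
have a3 := Bf_xx r0 (k := 1) (k3 := 3) (k6 := 6) isT erefl erefl.
have a4 := @Bf_yy r r0 1 3 6 isT erefl erefl.
have a5 := psi_xx r0 (k := 2) (n := 4) isT erefl.
have a6 := Af_xx r0 (k := 2) (k3 := 6) (k6 := 12) isT erefl erefl.
have b1 := ee_xx r0 (k := 2) (n := 4) isT erefl.
have b2 := ee_xx r0 (k := 6) (n := 12) isT erefl.
apply: (level3_even_alg a1 a2 a3 a4 a5 a6 b1 b2 (lift_even3 H)); nz_side.
Qed.

(** Serves two levels: s is 0 at level 3 and 4q at level 11, where 3, 6 and 12 are read as 11, 22
    and 44. The term - 0 in [level3_phi] comes from here. *)
Lemma lattice_phi_alg (F : fieldType) (a b a' b' x1 y1 x2 x3 y3 x6 e2 e4 e6 e12 p1 p2 s t : F) :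
  a = y1 ^+ 2 * e2 -> b = y3 ^+ 2 * e6 -> a' = x1 ^+ 2 * e2 -> b' = x3 ^+ 2 * e6 ->
  p1 = e4 / x2 -> p2 = e12 / x6 -> e2 = x2 * e4 -> e6 = x6 * e12 ->
  a * b - a' * b' = s * (e2 * e6) + t * (p1 * p2) ->
  x2 != 0 -> x6 != 0 -> e4 != 0 -> e12 != 0 ->
  (x1 * x3) ^+ 2 - (y1 * y3) ^+ 2 = - s - t / (x2 * x6) ^+ 2.
Proof.
move=> -> -> -> -> -> -> -> -> H nx2 nx6 ne4 ne12.
apply: (mulIf (x := (x2 * e4) * (x6 * e12))); first by nz.
by etransitivity; [etransitivity; [|exact: (congr1 -%R H)] |]; field_nz.
Qed.

Lemma lift_phi3 (a b a' b' p1 p2 r : fps int) : a * b - a' * b' = 4 * r * p1 * p2 ->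
  a%:F * b%:F - a'%:F * b'%:F = 4 * r%:F * p1%:F * p2%:F :> K.
Proof. by lift_frac. Qed.

Lemma level3_phi (r : fps int) : r 0%N = 0 ->
  (xx r 1 * xx r 3) ^+ 2 - (yy r 1 * yy r 3) ^+ 2 = - 0 - 4 * r%:F / (xx r 2 * xx r 6) ^+ 2.
Proof.
move=> r0.
have H : phi (r ^+ 1) * phi (r ^+ 3) - phi (- r ^+ 1) * phi (- r ^+ 3) = 4 * r * psi (r ^+ 2) * psi (r ^+ 6).
  by rewrite -(lattice_3_phi r0) !expr1 (@oppX r 3 isT).
have a1 := phi_yy r0 (k := 1) (n := 2) isT erefl.
have a2 := phi_yy r0 (k := 3) (n := 6) isT erefl.
have a3 := phi_xx r0 (k := 1) (n := 2) isT erefl.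
have a4 := phi_xx r0 (k := 3) (n := 6) isT erefl.
have a5 := psi_xx r0 (k := 2) (n := 4) isT erefl.
have a6 := psi_xx r0 (k := 6) (n := 12) isT erefl.
have b1 := ee_xx r0 (k := 2) (n := 4) isT erefl.
have b2 := ee_xx r0 (k := 6) (n := 12) isT erefl.
have L := lift_phi3 H.
apply: (lattice_phi_alg a1 a2 a3 a4 a5 a6 b1 b2); try nz_side.
by rewrite mul0r add0r [RHS]mulrA; exact: L.
Qed.

Lemma lift_phi11 (a b a' b' p1 p2 c d r : fps int) :
  a * b - a' * b' = 4 * (r * (c * d)) + 4 * (r ^+ 3 * (p1 * p2)) ->
  a%:F * b%:F - a'%:F * b'%:F = 4 * r%:F * (c%:F * d%:F) + 4 * r%:F ^+ 3 * (p1%:F * p2%:F) :> K.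
Proof. by lift_frac; rewrite !mulrA. Qed.

Lemma level11 (r : fps int) : r 0%N = 0 ->
  (xx r 1 * xx r 11) ^+ 2 - (yy r 1 * yy r 11) ^+ 2 =
  - (4 * r%:F) - 4 * r%:F ^+ 3 / (xx r 2 * xx r 22) ^+ 2.
Proof.
move=> r0.
have H : phi (r ^+ 1) * phi (r ^+ 11) - phi (- r ^+ 1) * phi (- r ^+ 11) =
   4 * (r * (pent (r ^+ 2) * pent (r ^+ 22))) + 4 * (r ^+ 3 * (psi (r ^+ 2) * psi (r ^+ 22))).
  by rewrite -(lattice_11 r0) !expr1 (@oppX r 11 isT).
have a1 := phi_yy r0 (k := 1) (n := 2) isT erefl.
have a2 := phi_yy r0 (k := 11) (n := 22) isT erefl.
have a3 := phi_xx r0 (k := 1) (n := 2) isT erefl.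
have a4 := phi_xx r0 (k := 11) (n := 22) isT erefl.
have a5 := psi_xx r0 (k := 2) (n := 4) isT erefl.
have a6 := psi_xx r0 (k := 22) (n := 44) isT erefl.
have b1 := ee_xx r0 (k := 2) (n := 4) isT erefl.
have b2 := ee_xx r0 (k := 22) (n := 44) isT erefl.
have L := lift_phi11 H.
apply: (lattice_phi_alg a1 a2 a3 a4 a5 a6 b1 b2); try nz_side.
by rewrite -(pent_ee r0 (k := 2) isT) -(pent_ee r0 (k := 22) isT); exact: L.
Qed.

(** With V = x5^5/x1, the phi identity becomes V - 4r = x1^3 x5 (e2/e10)^2 and the psi identity V +
    r = (x5/x1)^2 (e2/e10)^2. Their quotient is free of Euler products. *)
Lemma level5_alg (F : fieldType) (f1 f5 ps1 ps5 N SP r x1 x5 e1 e2 e5 e10 : F) :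
  f1 = x1 ^+ 2 * e2 -> f5 = x5 ^+ 2 * e10 -> ps1 = e2 / x1 -> ps5 = e10 / x5 ->
  e1 = x1 * e2 -> e5 = x5 * e10 ->
  N * x5 = x1 * e10 ^+ 2 -> SP * e1 * e10 = e2 * e5 ^+ 3 ->
  f1 ^+ 2 - f5 ^+ 2 = - (4 * r * N) -> ps1 ^+ 2 - r * ps5 ^+ 2 = SP ->
  x1 != 0 -> x5 != 0 -> e2 != 0 -> e10 != 0 ->
  x5 ^+ 5 / x1 - 4 * r = x1 ^+ 5 / x5 * (x5 ^+ 5 / x1 + r).
Proof.
move=> -> -> -> -> -> -> HN HS H1 H2 nx1 nx5 ne2 ne10.
have {}HN : N = x1 * e10 ^+ 2 / x5 by rewrite -HN; field_nz.
move: H1 HS; rewrite {}HN -{}H2 => H1 HS.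
have V4 : x5 ^+ 5 / x1 - 4 * r = x1 ^+ 3 * x5 * (e2 / e10) ^+ 2.
  apply: (mulIf (x := e10 ^+ 2 * x1 / x5)); first by nz.
  transitivity (x5 ^+ 4 * e10 ^+ 2 - 4 * r * (x1 * e10 ^+ 2 / x5)); first by field_nz.
  transitivity ((x1 ^+ 2 * e2) ^+ 2); last by field_nz.
  by rewrite -[LHS]opprK opprB -[X in - X = _]addrC; apply/eqP; rewrite -subr_eq0; apply/eqP;
     transitivity (- ((x1 ^+ 2 * e2) ^+ 2 - (x5 ^+ 2 * e10) ^+ 2 + (4 * r * (x1 * e10 ^+ 2 / x5)))); [ring | rewrite H1; ring].
have V1 : x5 ^+ 5 / x1 + r = (x5 / x1) ^+ 2 * (e2 / e10) ^+ 2.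
  apply: (mulIf (x := x1 * e10 ^+ 2 * e2 / x5 ^+ 2)); first by nz.
  transitivity (e2 * (x5 * e10) ^+ 3 / e10 + r * (x1 * e10 ^+ 2 * e2 / x5 ^+ 2)); first by field_nz.
  by rewrite -HS; field_nz.
by rewrite V4 V1; field_nz.
Qed.

Lemma lift_level5 (f1 f5 ps1 ps5 n m sp tp r : fps int) :
  f1 ^+ 2 - f5 ^+ 2 = - (4 * r * (n * m)) -> ps1 ^+ 2 - r * ps5 ^+ 2 = sp * tp ->
  (f1%:F ^+ 2 - f5%:F ^+ 2 = - (4 * r%:F * (n * m)%:F) :> K) /\
  (ps1%:F ^+ 2 - r%:F * ps5%:F ^+ 2 = (sp * tp)%:F :> K).
Proof. by move=> h1 h2; split; [move: h1 | move: h2]; lift_frac. Qed.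

Lemma lift_prod5 (N S x5 x1 e10 e1 e2 e5 : fps int) : N * x5 = x1 * e10 ^+ 2 -> S * e1 * e10 = e2 * e5 ^+ 3 ->
  (N%:F * x5%:F = x1%:F * e10%:F ^+ 2 :> K) /\ (S%:F * e1%:F * e10%:F = e2%:F * e5%:F ^+ 3 :> K).
Proof. by move=> h1 h2; split; [move: h1 | move: h2]; lift_frac. Qed.

Lemma level5 (r : fps int) : r 0%N = 0 ->
  xx r 5 ^+ 5 / xx r 1 - 4 * r%:F = xx r 1 ^+ 5 / xx r 5 * (xx r 5 ^+ 5 / xx r 1 + r%:F).
Proof.
move=> r0.
have H1 : phi (- r ^+ 1) ^+ 2 - phi (- r ^+ 5) ^+ 2 = - (4 * r * (n1 r * n3 r)).
  have := lattice_5_phi (fpsN0 r0); rewrite !oppX // !expr1 => ->.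
  by rewrite /n1 /n3; move: (th _ _) (th _ _) => a b; ring.
have H2 : psi (r ^+ 1) ^+ 2 - r * psi (r ^+ 5) ^+ 2 = sP r * tP r.
  by rewrite expr1; exact: lattice_5_psi.
have [L1 L2] := lift_level5 H1 H2.
have [P1 P2] := lift_prod5 (n1_n3 r0) (sP_tP r0).
have Q1 : (n1 r * n3 r)%:F * xx r 5 = xx r 1 * ee r 10 ^+ 2.
  by rewrite !xxE eeE expr1; exact: P1.
have Q2 : (sP r * tP r)%:F * ee r 1 * ee r 10 = ee r 2 * ee r 5 ^+ 3.
  by rewrite !eeE expr1; exact: P2.
apply: (level5_alg (phi_xx r0 (k := 1) (n := 2) isT erefl) (phi_xx r0 (k := 5) (n := 10) isT erefl)
  (psi_xx r0 (k := 1) (n := 2) isT erefl) (psi_xx r0 (k := 5) (n := 10) isT erefl)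
  (ee_xx r0 (k := 1) (n := 2) isT erefl) (ee_xx r0 (k := 5) (n := 10) isT erefl) Q1 Q2 L1 L2); nz_side.
Qed.

(** * Elimination between a modular equation and its images under q |-> -q and q |-> q^2 *)

Section FieldAlgebra.
Variable F : fieldType.
Implicit Types q u v V W P d y z : F.

(** As V W = P, the mixed term of the cube is 3 P (V - W) = 3a. This gives the cases where the
    series is a cube: mu_{3,3} from mu_{1,3} and zeta_{7,3} from zeta_{7,1}; [cube_add] does it for
    nu_{3,3}. *)
Lemma cube_sub V W P a : V * W = P -> V - W = a / P -> P != 0 ->
  V ^+ 3 - W ^+ 3 = 3 * a + a ^+ 3 / P ^+ 3.
Proof.
move=> <- H nP; transitivity ((V - W) ^+ 3 + 3 * (V * W) * (V - W)); first by ring.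
by rewrite H; move: nP; move: (V * W) => Q nQ; field_nz.
Qed.

Lemma cube_add V W P : V * W = P -> V + W = 2 / P -> P != 0 ->
  V ^+ 3 + W ^+ 3 = - 6 + 8 / P ^+ 3.
Proof.
move=> <- H nP; transitivity ((V + W) ^+ 3 - 3 * (V * W) * (V + W)); first by ring.
by rewrite H; move: nP; move: (V * W) => Q nQ; field_nz.
Qed.

(** V = x5^5/x1 and U = x1^5/x5; V', W are their images under q |-> -q, and V2, U2 under q |-> q^2.
    Multiplying the equations of V and V' and comparing with that of V2 eliminates U and W. Given V
    V' = V2, what remains is linear in V - V', with leading coefficient 5 q V2. *)
Lemma quintic_diff U W U2 V V' V2 q :
  V - 4 * q = U * (V + q) -> V' + 4 * q = W * (V' - q) -> V2 - 4 * q ^+ 2 = U2 * (V2 + q ^+ 2) ->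
  U * W = U2 -> V * V' = V2 -> V2 != 0 -> q != 0 -> 5 != 0 :> F ->
  V - V' = 2 * q + 4 * q ^+ 3 / V2.
Proof.
move=> h1 h2 h3 hU hV nV nq n5; apply: (mulIf (x := 5 * q * V2)); first by nz.
transitivity (2 * q * (5 * q * V2) + 20 * q ^+ 4); last by field_nz.
have h : (V - 4 * q) * (V' + 4 * q) * (V2 + q ^+ 2) = (V2 - 4 * q ^+ 2) * ((V + q) * (V' - q)).
  by rewrite h1 h2 h3 -hU; move: nV => _; move: (V + q) (V' - q) (V2 + q ^+ 2) => a b c; ring.
transitivity (2 * q * (5 * q * V2) + 20 * q ^+ 4 + ((V - 4 * q) * (V' + 4 * q) * (V2 + q ^+ 2) - (V2 - 4 * q ^+ 2) * ((V + q) * (V' - q)))).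
  by rewrite -hV; ring.
by rewrite h subrr addr0.
Qed.

(** The common denominator of U and W factors into the numerator and the denominator of U2, which is
    why U + W and V U - V' W simplify to expressions in U2 and V2. *)
Lemma quintic_den V V' V2 q : V * V' = V2 -> V - V' = 2 * q + 4 * q ^+ 3 / V2 -> V2 != 0 ->
  (V + q) * (V' - q) = (V2 - 4 * q ^+ 2) * (V2 + q ^+ 2) / V2.
Proof.
move=> hV hd nV; transitivity (V * V' - q * (V - V') - q ^+ 2); first by ring.
by rewrite hV hd; field_nz.
Qed.

Lemma quintic_sum U W U2 V V' V2 q :
  V - 4 * q = U * (V + q) -> V' + 4 * q = W * (V' - q) -> V2 - 4 * q ^+ 2 = U2 * (V2 + q ^+ 2) ->
  V * V' = V2 -> V - V' = 2 * q + 4 * q ^+ 3 / V2 ->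
  V2 != 0 -> U2 != 0 -> V + q != 0 -> V' - q != 0 -> V2 + q ^+ 2 != 0 ->
  U + W = - 2 + 4 / U2.
Proof.
move=> h1 h2 h3 hV hd nV nU n1 n2 n3; have := quintic_den hV hd nV; rewrite h3 => hD.
apply: (mulIf (x := (V + q) * (V' - q))); first by nz.
transitivity ((U * (V + q)) * (V' - q) + (W * (V' - q)) * (V + q)); first by ring.
rewrite -h1 -h2 hD; transitivity (2 * (V * V') + 3 * q * (V - V') + 8 * q ^+ 2); first by ring.
have U2E : U2 = (V2 - 4 * q ^+ 2) / (V2 + q ^+ 2) by rewrite h3; field_nz.
have n4 : V2 - 4 * q ^+ 2 != 0 by rewrite h3; nz.
by rewrite hV hd U2E; field_nz.
Qed.

Lemma quintic_prod U W U2 V V' V2 q :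
  V - 4 * q = U * (V + q) -> V' + 4 * q = W * (V' - q) -> V2 - 4 * q ^+ 2 = U2 * (V2 + q ^+ 2) ->
  V * V' = V2 -> V - V' = 2 * q + 4 * q ^+ 3 / V2 ->
  V2 != 0 -> U2 != 0 -> V + q != 0 -> V' - q != 0 -> V2 + q ^+ 2 != 0 ->
  V * U - V' * W = - (8 * q) - 16 * q ^+ 3 / (V2 * U2).
Proof.
move=> h1 h2 h3 hV hd nV nU n1 n2 n3; have := quintic_den hV hd nV; rewrite h3 => hD.
apply: (mulIf (x := (V + q) * (V' - q))); first by nz.
transitivity (V * (U * (V + q)) * (V' - q) - V' * (W * (V' - q)) * (V + q)); first by ring.
rewrite -h1 -h2 hD; transitivity ((V * V') * (V - V') - q * ((V - V') ^+ 2 + 2 * (V * V')) - 8 * q * (V * V') + 4 * q ^+ 2 * (V - V')); first by ring.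
have U2E : U2 = (V2 - 4 * q ^+ 2) / (V2 + q ^+ 2) by rewrite h3; field_nz.
have n4 : V2 - 4 * q ^+ 2 != 0 by rewrite h3; nz.
by rewrite hV hd U2E; field_nz.
Qed.

(** The level 3 identities express everything by V and V': q is V V' (V - V')/2, U is proportional
    to 2V' - V and U' to 2V - V' with the common factor (U + U')/(V + V'), and U U' (U + U') = 2
    fixes the cube of U + U'. So U^3, rather than U, becomes rational in V and V'. *)
Lemma cubic_relation U U' U2 V V' V2 q :
  V * V' = V2 -> U * U' = U2 -> V - V' = 2 * q / V2 -> U + U' = 2 / U2 ->
  U * V - U' * V' = - (4 * q) / (U2 * V2) -> V != 0 -> V' != 0 -> U2 != 0 -> 2 != 0 :> F -> 3 != 0 :> F ->
  U ^+ 3 * (V ^+ 3 + q) = V ^+ 3 - 8 * q.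
Proof.
move=> hV <- hd hs hp nV nV' nU2 n2 n3.
have [nU nU'] : U != 0 /\ U' != 0 by move: nU2; rewrite mulf_eq0 negb_or => /andP.
have nS : U + U' != 0 by rewrite hs; nz.
have qE : q = V * V' * (V - V') / 2.
  by rewrite hd -hV; field_nz.
have h1 : U * (V + V') = (U + U') * (2 * V' - V).
  transitivity ((U * V - U' * V') + (U + U') * V'); first by ring.
  rewrite hp hs qE -hV; by field_nz.
have n4 : V + V' != 0.
  apply/eqP => e; move: h1; rewrite e mulr0 => /esym/eqP; rewrite mulf_eq0 (negbTE nS) /=.
  have -> : 2 * V' - V = 3 * V' - (V + V') by ring.
  by rewrite e subr0 mulf_eq0 (negbTE n3) (negbTE nV').
have UE : U = (U + U') * (2 * V' - V) / (V + V') by rewrite -h1; field_nz.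
have UE' : U' = (U + U') * (2 * V - V') / (V + V').
  transitivity ((U + U') * (V + V') / (V + V') - U); first by field_nz.
  by rewrite {2}UE; field_nz.
have hc : (U + U') ^+ 3 * ((2 * V' - V) * (2 * V - V')) = 2 * (V + V') ^+ 2.
  transitivity ((U + U') * ((U + U') * (2 * V' - V) / (V + V') * ((U + U') * (2 * V - V') / (V + V'))) * (V + V') ^+ 2).
    by field_nz.
  rewrite -UE -UE' hs; by field_nz.
have n5 : 2 * V - V' != 0.
  by apply/eqP => e; move/eqP: hc; rewrite e !mulr0 eq_sym !mulf_eq0 (negbTE n2) (negbTE n4).
transitivity ((U + U') ^+ 3 * ((2 * V' - V) * (2 * V - V')) / (V + V') ^+ 2 * V / 2 * (2 * V' - V) ^+ 2).
  by rewrite {1}UE qE; field_nz.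
by rewrite hc qE; field_nz.
Qed.

(** Here y = x9^3/x3 and u = x1^3/x3, so that u y is the series eta_1 and u = (y - 2q)/(y + q).
    Again (y + q)(y' - q) factors, as (P - 2q^2)(P + q^2)/P. *)
Lemma eta_diff y y' P u u' q :
  u * (y + q) = y - 2 * q -> u' * (y' - q) = y' + 2 * q -> y * y' = P -> y - y' = 2 * q ^+ 3 / P ->
  P != 0 -> y + q != 0 -> y' - q != 0 -> P - 2 * q ^+ 2 != 0 -> P + q ^+ 2 != 0 ->
  u * y - u' * y' = - (6 * q) - 4 * q ^+ 3 / ((P - 2 * q ^+ 2) / (P + q ^+ 2) * P).
Proof.
move=> h1 h2 hP hd nP n1 n2 n3 n4.
have hD : (y + q) * (y' - q) = (P - 2 * q ^+ 2) * (P + q ^+ 2) / P.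
  by transitivity (y * y' - q * (y - y') - q ^+ 2); [ring | rewrite hP hd; field_nz].
apply: (mulIf (x := (y + q) * (y' - q))); first by nz.
transitivity ((u * (y + q)) * (y' - q) * y - (u' * (y' - q)) * (y + q) * y'); first by ring.
rewrite h1 h2 hD; transitivity ((y * y') * (y - y') - q * ((y - y') ^+ 2 + 2 * (y * y')) - 4 * q * (y * y') + 2 * q ^+ 2 * (y - y')); first by ring.
by rewrite hP hd; field_nz.
Qed.

(** The fraction in y is the reciprocal of eta_5, see [eta5_shape]; the product of the denominators
    for y and y' factors into the numerator and the denominator of the same fraction at P and q^2,
    divided by P^2. *)
Lemma eta_sum y y' P q :
  y * y' = P -> y - y' = 2 * q ^+ 3 / P -> P != 0 ->
  y ^+ 2 - y * q + q ^+ 2 != 0 -> y' ^+ 2 + y' * q + q ^+ 2 != 0 ->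
  P ^+ 2 - P * q ^+ 2 + q ^+ 4 != 0 -> P ^+ 2 + 2 * P * q ^+ 2 + 4 * q ^+ 4 != 0 ->
  (y ^+ 2 + 2 * y * q + 4 * q ^+ 2) / (y ^+ 2 - y * q + q ^+ 2) +
  (y' ^+ 2 - 2 * y' * q + 4 * q ^+ 2) / (y' ^+ 2 + y' * q + q ^+ 2) =
  6 - 4 / ((P ^+ 2 + 2 * P * q ^+ 2 + 4 * q ^+ 4) / (P ^+ 2 - P * q ^+ 2 + q ^+ 4)).
Proof.
move=> hP hd nP n1 n2 n3 n4.
have hD : (y ^+ 2 - y * q + q ^+ 2) * (y' ^+ 2 + y' * q + q ^+ 2) = 
   (P ^+ 2 + 2 * P * q ^+ 2 + 4 * q ^+ 4) * (P ^+ 2 - P * q ^+ 2 + q ^+ 4) / P ^+ 2.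
  transitivity ((y * y') ^+ 2 + q * (y * y') * (y - y') + q ^+ 2 * ((y - y') ^+ 2 + 2 * (y * y')) - q ^+ 2 * (y * y') - q ^+ 3 * (y - y') + q ^+ 4); first by ring.
  by rewrite hP hd; field_nz.
apply: (mulIf (x := (y ^+ 2 - y * q + q ^+ 2) * (y' ^+ 2 + y' * q + q ^+ 2))); first by nz.
transitivity (2 * (y * y') ^+ 2 - q * (y * y') * (y - y') + 5 * q ^+ 2 * ((y - y') ^+ 2 + 2 * (y * y')) + 4 * q ^+ 2 * (y * y') - 2 * q ^+ 3 * (y - y') + 8 * q ^+ 4).
  by field_nz.
by rewrite hD hP hd; field_nz.
Qed.

End FieldAlgebra.

(* Elements of [K] are shown to be nonzero by computing a nonzero constant term. *)
Definition cst (x : K) (c : int) := exists2 f : fps int, x = f%:F & f 0%N = c.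

Lemma cst_neq0 x c : cst x c -> c != 0 -> x != 0.
Proof. by move=> [f -> <-]; exact: tofrac_neq0. Qed.

Lemma cst_ser (f : fps int) c : f 0%N = c -> cst f%:F c. Proof. by exists f. Qed.

Lemma cst_nat n : cst n%:R n%:R.
Proof.
exists n%:R; first by rewrite rmorph_nat.
by elim: n => // n IH; rewrite !mulrS fps_coefD fps_coef1 IH.
Qed.

Lemma cst1 : cst 1 1. Proof. exact: cst_nat 1. Qed.

Lemma cstD x y a b : cst x a -> cst y b -> cst (x + y) (a + b).
Proof. by move=> [f -> <-] [g -> <-]; exists (f + g); rewrite ?rmorphD. Qed.

Lemma cstN x a : cst x a -> cst (- x) (- a).
Proof. by move=> [f -> <-]; exists (- f); rewrite ?rmorphN. Qed.

Lemma cstM x y a b : cst x a -> cst y b -> cst (x * y) (a * b).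
Proof. by move=> [f -> <-] [g -> <-]; exists (f * g); rewrite ?rmorphM // fps_coefM0. Qed.

Lemma cstX x a n : cst x a -> cst (x ^+ n) (a ^+ n).
Proof.
move=> xa; elim: n => [|n IH]; first by rewrite !expr0; exact: cst1.
by rewrite !exprS; apply: cstM.
Qed.

Lemma cstV x : cst x 1 -> cst x^-1 1.
Proof.
move=> [f -> f1]; have fU : f \is a GRing.unit by rewrite fps_unitE f1 unitr1.
exists f^-1; first by rewrite rmorphV.
have := fps_coefM0 f f^-1; rewrite divrr // f1 mul1r fps_coef1 => <- //.
Qed.

Lemma char0K n : n.+1%:R != 0 :> K.
Proof. by apply: (cst_neq0 (cst_nat n.+1)); rewrite natz. Qed.

Section Levels.
Variable r : fps int.
Hypothesis r0 : r 0%N = 0.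
Local Notation x := (xx_ r).
Local Notation y := (yy_ r).

Lemma cst_r : cst r%:F 0. Proof. exact: cst_ser. Qed.
Lemma cst_x k : (0 < k)%N -> cst (x k) 1.
Proof. by move=> k0; rewrite xxE; apply: cst_ser; apply: chi0; apply: exp0. Qed.
Lemma cst_y k : (0 < k)%N -> cst (y k) 1.
Proof. by move=> k0; rewrite yyE; apply: cst_ser; apply: chi0; apply: expN0. Qed.
Lemma cst_e k : (0 < k)%N -> cst (ee_ r k) 1.
Proof. by move=> k0; rewrite eeE; apply: cst_ser; apply: eul0; apply: exp0. Qed.
End Levels.

Lemma cstV_eq x a : cst x a -> a = 1 -> cst x^-1 1.
Proof. by move=> xa a1; apply: cstV; rewrite -a1. Qed.

(** Builds the constant term as an existential variable along the shape of the expression; [cst_nz]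
    then has it computed and compared with 0. *)
Ltac cst_tac r0 := lazymatch goal with
  | |- cst (_ + _) _ => eapply cstD; [cst_tac r0 | cst_tac r0]
  | |- cst (- _) _ => eapply cstN; cst_tac r0
  | |- cst (_ * _) _ => eapply cstM; [cst_tac r0 | cst_tac r0]
  | |- cst (_ ^+ _) _ => eapply cstX; cst_tac r0
  | |- cst (_^-1) _ => eapply cstV_eq; [cst_tac r0 | reflexivity]
  | |- cst (xx_ _ ?k) _ => exact (@cst_x _ r0 k isT)
  | |- cst (yy_ _ ?k) _ => exact (@cst_y _ r0 k isT)
  | |- cst (ee_ _ ?k) _ => exact (@cst_e _ r0 k isT)
  | |- cst 1 _ => exact cst1
  | |- cst (_ *+ _) _ => exact (cst_nat _)
  | |- _ => exact (cst_r r0)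
  end.
Ltac cst_nz r0 := eapply cst_neq0; [cst_tac r0 | reflexivity].

(** So the product of the series nu_{1,5} and mu_{1,5} is zeta_{5,4}; [quot_cancel3] relates
    nu_{1,3}, mu_{1,3} and zeta_{3,2} in the same way. *)
Lemma quot_cancel5 (F : fieldType) (a b : F) : a != 0 -> b != 0 ->
  a ^+ 5 / b * (b ^+ 5 / a) = b ^+ 4 * a ^+ 4.
Proof. by move=> na nb; field_nz. Qed.

Lemma quot_cancel3 (F : fieldType) (a b : F) : a != 0 -> b != 0 ->
  a ^+ 3 / b * (b ^+ 3 / a) = (a * b) ^+ 2.
Proof. by move=> na nb; field_nz. Qed.

Section Levels35.
Variable r : fps int.
Hypotheses (r0 : r 0%N = 0) (rn : r%:F != 0 :> K).
Local Notation x := (xx_ r).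
Local Notation y := (yy_ r).

Lemma level5_opp : y 5 ^+ 5 / y 1 + 4 * r%:F = y 1 ^+ 5 / y 5 * (y 5 ^+ 5 / y 1 - r%:F).
Proof.
have := level5 (fpsN0 r0); rewrite !xx_opp //.
by rewrite !rmorphN /= mulrN opprK.
Qed.

Lemma level5_sqr : x 10 ^+ 5 / x 2 - 4 * r%:F ^+ 2 = x 2 ^+ 5 / x 10 * (x 10 ^+ 5 / x 2 + r%:F ^+ 2).
Proof.
have := level5 (exp0 r0 (k := 2) isT); rewrite (xx_pow r (m := 2) (k := 5) (n := 10) erefl) (xx_pow r (m := 2) (k := 1) (n := 2) erefl).
by rewrite !rmorphXn /=.
Qed.

Lemma x1y1 : x 1 * y 1 = x 2. Proof. exact: xx_yy. Qed.
Lemma x3y3 : x 3 * y 3 = x 6. Proof. exact: xx_yy. Qed.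
Lemma x5y5 : x 5 * y 5 = x 10. Proof. exact: xx_yy. Qed.
Lemma x9y9 : x 9 * y 9 = x 18. Proof. exact: xx_yy. Qed.

Lemma quot_mul (a b c d e f : K) k l : a * b = e -> c * d = f ->
  (a ^+ k / c ^+ l) * (b ^+ k / d ^+ l) = e ^+ k / f ^+ l.
Proof. by move=> <- <-; rewrite mulf_div -!exprMn. Qed.

Lemma mu13_diff : x 3 ^+ 3 / x 1 - y 3 ^+ 3 / y 1 = 2 * r%:F / (x 6 ^+ 3 / x 2).
Proof. exact: level3_odd. Qed.

Lemma nu13_sum : x 1 ^+ 3 / x 3 + y 1 ^+ 3 / y 3 = 2 / (x 2 ^+ 3 / x 6).
Proof. exact: level3_even. Qed.

Lemma mu33_diff : (x 3 ^+ 3 / x 1) ^+ 3 - (y 3 ^+ 3 / y 1) ^+ 3 =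
  3 * (2 * r%:F) + (2 * r%:F) ^+ 3 / (x 6 ^+ 3 / x 2) ^+ 3.
Proof.
apply: cube_sub; [exact: (quot_mul 3 1 x3y3 x1y1) | exact: mu13_diff | cst_nz r0].
Qed.

Lemma nu33_sum : (x 1 ^+ 3 / x 3) ^+ 3 + (y 1 ^+ 3 / y 3) ^+ 3 = - 6 + 8 / (x 2 ^+ 3 / x 6) ^+ 3.
Proof.
apply: cube_add; [exact: (quot_mul 3 1 x1y1 x3y3) | exact: nu13_sum | cst_nz r0].
Qed.

Lemma mu15_diff : x 5 ^+ 5 / x 1 - y 5 ^+ 5 / y 1 = 2 * r%:F + 4 * r%:F ^+ 3 / (x 10 ^+ 5 / x 2).
Proof.
apply: (quintic_diff (level5 r0) level5_opp level5_sqr (quot_mul 5 1 x1y1 x5y5) (quot_mul 5 1 x5y5 x1y1)).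
- cst_nz r0.
- exact: rn.
- exact: char0K 4.
Qed.

Lemma nu15_sum : x 1 ^+ 5 / x 5 + y 1 ^+ 5 / y 5 = - 2 + 4 / (x 2 ^+ 5 / x 10).
Proof.
apply: (quintic_sum (level5 r0) level5_opp level5_sqr (quot_mul 5 1 x5y5 x1y1) mu15_diff); cst_nz r0.
Qed.

Lemma zeta54_diff0 : x 5 ^+ 5 / x 1 * (x 1 ^+ 5 / x 5) - y 5 ^+ 5 / y 1 * (y 1 ^+ 5 / y 5) =
  - (8 * r%:F) - 16 * r%:F ^+ 3 / (x 10 ^+ 5 / x 2 * (x 2 ^+ 5 / x 10)).
Proof.
apply: (quintic_prod (level5 r0) level5_opp level5_sqr (quot_mul 5 1 x5y5 x1y1) mu15_diff); cst_nz r0.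
Qed.

Lemma zeta54_diff : x 1 ^+ 4 * x 5 ^+ 4 - y 1 ^+ 4 * y 5 ^+ 4 =
  - (8 * r%:F) - 16 * r%:F ^+ 3 / (x 2 ^+ 4 * x 10 ^+ 4).
Proof.
have [nx1 nx5 nx2 nx10] : [/\ x 1 != 0, x 5 != 0, x 2 != 0 & x 10 != 0] by split; nz_side.
have [ny1 ny5] : y 1 != 0 /\ y 5 != 0 by split; nz_side.
have := zeta54_diff0; rewrite (quot_cancel5 nx5 nx1) (quot_cancel5 ny5 ny1) (quot_cancel5 nx10 nx2) //.
Qed.

Lemma zeta32_diff : (x 1 * x 3) ^+ 2 - (y 1 * y 3) ^+ 2 = - 0 - 4 * r%:F / (x 2 * x 6) ^+ 2.
Proof. exact: level3_phi. Qed.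

Lemma cubic3 : (x 1 ^+ 3 / x 3) ^+ 3 * ((x 3 ^+ 3 / x 1) ^+ 3 + r%:F) = (x 3 ^+ 3 / x 1) ^+ 3 - 8 * r%:F.
Proof.
apply: (cubic_relation (quot_mul 3 1 x3y3 x1y1) (quot_mul 3 1 x1y1 x3y3) mu13_diff nu13_sum).
- have [nx1 nx3 nx2 nx6] : [/\ x 1 != 0, x 3 != 0, x 2 != 0 & x 6 != 0] by split; nz_side.
  have [ny1 ny3] : y 1 != 0 /\ y 3 != 0 by split; nz_side.
  rewrite (quot_cancel3 nx1 nx3) (quot_cancel3 ny1 ny3) (quot_cancel3 nx2 nx6).
  by rewrite zeta32_diff oppr0 add0r mulNr.
- cst_nz r0.
- cst_nz r0.
- cst_nz r0.
- exact: char0K 1.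
- exact: char0K 2.
Qed.

End Levels35.

(** The dissection of psi gives e2/e18 = (x1/x9)(x9^3/x3 + q); inserting it in the dissection of phi
    removes the Euler products. *)
Lemma level9_alg (F : fieldType) (ps ps9 A f f9 B q x1 x3 x9 e2 e18 : F) :
  ps = e2 / x1 -> ps9 = e18 / x9 -> A = x9 ^+ 2 * e18 / x3 -> f = x1 ^+ 2 * e2 ->
  f9 = x9 ^+ 2 * e18 -> B = x3 * e18 / x9 ->
  ps = A + q * ps9 -> f = f9 - 2 * q * B ->
  x1 != 0 -> x3 != 0 -> x9 != 0 -> e18 != 0 ->
  x1 ^+ 3 / x3 * (x9 ^+ 3 / x3 + q) = x9 ^+ 3 / x3 - 2 * q.
Proof.
move=> -> -> -> -> -> -> H1 H2 n1 n3 n9 ne.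
have eE : e2 = e18 * x1 / x9 * (x9 ^+ 3 / x3 + q).
  by transitivity (e2 / x1 * x1); [field_nz | rewrite H1; field_nz].
apply: (mulIf (x := x3 * e18 / x9)); first by nz.
transitivity (x1 ^+ 2 * e2); first by rewrite eE; field_nz.
by rewrite H2; field_nz.
Qed.

Lemma lift_level9 (ps A p9 r f f9 B : fps int) : ps = A + r * p9 -> f = f9 - 2 * r * B ->
  (ps%:F = A%:F + r%:F * p9%:F :> K) /\ (f%:F = f9%:F - 2 * r%:F * B%:F :> K).
Proof. by move=> h1 h2; split; [move: h1 | move: h2]; lift_frac. Qed.

Lemma level9 (r : fps int) : r 0%N = 0 ->
  xx r 1 ^+ 3 / xx r 3 * (xx r 9 ^+ 3 / xx r 3 + r%:F) = xx r 9 ^+ 3 / xx r 3 - 2 * r%:F.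
Proof.
move=> r0.
have H1 : psi (r ^+ 1) = Af (r ^+ 3) + r * psi (r ^+ 9) by rewrite expr1; exact: psi_dissect3.
have H2 : phi (- r ^+ 1) = phi (- r ^+ 9) - 2 * r * Bf (r ^+ 3) by rewrite expr1; exact: phi_dissect3.
have [L1 L2] := lift_level9 H1 H2.
apply: (level9_alg (psi_xx r0 (k := 1) (n := 2) isT erefl) (psi_xx r0 (k := 9) (n := 18) isT erefl)
  (Af_xx r0 (k := 3) (k3 := 9) (k6 := 18) isT erefl erefl) (phi_xx r0 (k := 1) (n := 2) isT erefl)
  (phi_xx r0 (k := 9) (n := 18) isT erefl) (Bf_xx r0 (k := 3) (k3 := 9) (k6 := 18) isT erefl erefl) L1 L2); nz_side.
Qed.

Lemma level7_alg (F : fieldType) (p1 p7 p1' p7' p4 p28 q x1 x7 y1 y7 x2 x14 e1 e7 e2 e14 e4 e28 : F) :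
  p1 = e1 -> p7 = e7 -> p1' = y1 * e2 -> p7' = y7 * e14 -> p4 = e4 -> p28 = e28 ->
  e1 = x1 * e2 -> e7 = x7 * e14 -> e2 = x2 * e4 -> e14 = x14 * e28 ->
  p1 * p7 - p1' * p7' = - 2 * (q * (p4 * p28)) ->
  x2 != 0 -> x14 != 0 -> e4 != 0 -> e28 != 0 ->
  x1 * x7 - y1 * y7 = - (2 * q) / (x2 * x14).
Proof.
move=> -> -> -> -> -> -> -> -> -> -> H n1 n2 n3 n4.
apply: (mulIf (x := (x2 * e4) * (x14 * e28))); first by nz.
by etransitivity; [etransitivity; [|exact: H] |]; field_nz.
Qed.

Lemma lift_level7 (a b a' b' r c d : fps int) : a * b - a' * b' = - 2 * (r * (c * d)) ->
  a%:F * b%:F - a'%:F * b'%:F = - 2 * (r%:F * (c%:F * d%:F)) :> K.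
Proof. by lift_frac. Qed.

Lemma level7 (r : fps int) : r 0%N = 0 ->
  xx r 1 * xx r 7 - yy r 1 * yy r 7 = - (2 * r%:F) / (xx r 2 * xx r 14).
Proof.
move=> r0.
have H : pent (r ^+ 1) * pent (r ^+ 7) - pent (- r ^+ 1) * pent (- r ^+ 7) =
   - 2 * (r * (pent (r ^+ 4) * pent (r ^+ 28))).
  by rewrite -(lattice_7 r0) (@oppX r 7 isT) !expr1.
apply: (level7_alg (pent_ee r0 (k := 1) isT) (pent_ee r0 (k := 7) isT)
  (pent_yy r0 (k := 1) (n := 2) isT erefl) (pent_yy r0 (k := 7) (n := 14) isT erefl)
  (pent_ee r0 (k := 4) isT) (pent_ee r0 (k := 28) isT)
  (ee_xx r0 (k := 1) (n := 2) isT erefl) (ee_xx r0 (k := 7) (n := 14) isT erefl)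
  (ee_xx r0 (k := 2) (n := 4) isT erefl) (ee_xx r0 (k := 14) (n := 28) isT erefl) (lift_level7 H)); nz_side.
Qed.

(** Multiplied by 2q, the left-hand side is twice the even part of the theta difference A - B. The
    formulas for the even parts recombine into the same difference at q^2 and q^4, hence into
    products of pentagonal series again. *)
Lemma level23_theta (R : idomainType) (q p1 p23 p1' p23' p2 p46 p4 p92 A B A' B' A2 B2 A4 B4 : R) :
  2 * (q * (p1 * p23)) = A - B -> 2 * (- q * (p1' * p23')) = A' - B' ->
  2 * (q ^+ 2 * (p2 * p46)) = A2 - B2 -> 2 * (q ^+ 4 * (p4 * p92)) = A4 - B4 ->
  A + A' = 2 * (2 * B2 - A4) -> B + B' = 2 * (A2 + B2 - B4) ->
  2 != 0 :> R -> q != 0 ->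
  p1 * p23 - p1' * p23' = - 2 * q * (p2 * p46) - 2 * q ^+ 3 * (p4 * p92).
Proof.
move=> h1 h2 h3 h4 ha hb n2 nq; apply: (mulfI nq); apply: (mulfI n2).
transitivity (2 * (q * (p1 * p23)) + 2 * (- q * (p1' * p23'))); first by ring.
rewrite h1 h2; transitivity ((A + A') - (B + B')); first by ring.
rewrite ha hb; transitivity (- 2 * ((A2 - B2) + (A4 - B4))); first by ring.
by rewrite -h3 -h4; ring.
Qed.

Lemma level23_alg (F : fieldType) (p1 p23 p1' p23' p2 p46 p4 p92 q x1 x23 y1 y23 x2 x46 e1 e23 e2 e46 e4 e92 : F) :
  p1 = e1 -> p23 = e23 -> p1' = y1 * e2 -> p23' = y23 * e46 -> p2 = e2 -> p46 = e46 -> p4 = e4 -> p92 = e92 ->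
  e1 = x1 * e2 -> e23 = x23 * e46 -> e2 = x2 * e4 -> e46 = x46 * e92 ->
  p1 * p23 - p1' * p23' = - 2 * q * (p2 * p46) - 2 * q ^+ 3 * (p4 * p92) ->
  x2 != 0 -> x46 != 0 -> e4 != 0 -> e92 != 0 ->
  x1 * x23 - y1 * y23 = - (2 * q) - 2 * q ^+ 3 / (x2 * x46).
Proof.
move=> -> -> -> -> -> -> -> -> -> -> -> -> H n1 n2 n3 n4.
apply: (mulIf (x := (x2 * e4) * (x46 * e92))); first by nz.
by etransitivity; [etransitivity; [|exact: H] |]; field_nz.
Qed.

Lemma lift_level23 (a b a' b' r c d c' d' : fps int) :
  a * b - a' * b' = - 2 * r * (c * d) - 2 * r ^+ 3 * (c' * d') ->
  a%:F * b%:F - a'%:F * b'%:F = - 2 * r%:F * (c%:F * d%:F) - 2 * r%:F ^+ 3 * (c'%:F * d'%:F) :> K.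
Proof. by lift_frac. Qed.

Lemma level23 (r : fps int) : r 0%N = 0 -> r != 0 ->
  xx r 1 * xx r 23 - yy r 1 * yy r 23 = - (2 * r%:F) - 2 * r%:F ^+ 3 / (xx r 2 * xx r 46).
Proof.
move=> r0 rn.
have t1 := pent23_theta r0.
have t2 : 2 * (- r * (pent (- r ^+ 1) * pent (- r ^+ 23))) = thA (- r) - thB (- r).
  by rewrite -(pent23_theta (fpsN0 r0)) (@oppX r 23 isT) expr1.
have t3 : 2 * (r ^+ 2 * (pent (r ^+ 2) * pent (r ^+ 46))) = thA (r ^+ 2) - thB (r ^+ 2).
  by rewrite -(pent23_theta (exp0 r0 (k := 2) isT)) -exprM.
have t4 : 2 * (r ^+ 4 * (pent (r ^+ 4) * pent (r ^+ 92))) = thA (r ^+ 4) - thB (r ^+ 4).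
  by rewrite -(pent23_theta (exp0 r0 (k := 4) isT)) -exprM.
have n2 : 2 != 0 :> fps int.
  by rewrite -(tofrac_eq0 (R := fps int)) rmorph_nat; exact: char0K 1.
have H := level23_theta t1 t2 t3 t4 (thA_even r0) (thB_even r0) n2 rn.
have P1 : (pent r)%:F = ee r 1 by rewrite -(pent_ee r0 (k := 1) isT) expr1.
apply: (level23_alg P1 (pent_ee r0 (k := 23) isT)
  (pent_yy r0 (k := 1) (n := 2) isT erefl) (pent_yy r0 (k := 23) (n := 46) isT erefl)
  (pent_ee r0 (k := 2) isT) (pent_ee r0 (k := 46) isT)
  (pent_ee r0 (k := 4) isT) (pent_ee r0 (k := 92) isT)
  (ee_xx r0 (k := 1) (n := 2) isT erefl) (ee_xx r0 (k := 23) (n := 46) isT erefl)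
  (ee_xx r0 (k := 2) (n := 4) isT erefl) (ee_xx r0 (k := 46) (n := 92) isT erefl) (lift_level23 H)); nz_side.
Qed.

Lemma eta1_shape (F : fieldType) (x1 x3 x9 : F) : x3 != 0 ->
  x1 ^+ 3 / x3 * (x9 ^+ 3 / x3) = x1 ^+ 3 * x9 ^+ 3 / x3 ^+ 2.
Proof. by move=> n3; field_nz. Qed.

(** The reciprocal of eta_5 is v^3/u with v = x3^3/x9 and u = x1^3/x3. For y = x9^3/x3, level 9
    gives u = (y - 2q)/(y + q), and the cubic relation at q^3 gives v^3 = (y^3 - 8q^3)/(y^3 + q^3);
    the linear factors cancel. *)
Lemma eta5_shape (F : fieldType) (x1 x3 x9 q : F) :
  x1 ^+ 3 / x3 * (x9 ^+ 3 / x3 + q) = x9 ^+ 3 / x3 - 2 * q ->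
  (x3 ^+ 3 / x9) ^+ 3 * ((x9 ^+ 3 / x3) ^+ 3 + q ^+ 3) = (x9 ^+ 3 / x3) ^+ 3 - 8 * q ^+ 3 ->
  x1 != 0 -> x3 != 0 -> x9 != 0 -> x9 ^+ 3 / x3 + q != 0 ->
  (x9 ^+ 3 / x3) ^+ 2 - x9 ^+ 3 / x3 * q + q ^+ 2 != 0 ->
  x3 ^+ 10 / (x1 ^+ 3 * x9 ^+ 3) =
  ((x9 ^+ 3 / x3) ^+ 2 + 2 * (x9 ^+ 3 / x3) * q + 4 * q ^+ 2) /
  ((x9 ^+ 3 / x3) ^+ 2 - x9 ^+ 3 / x3 * q + q ^+ 2).
Proof.
move=> h1 h2 n1 n3 n9 np nq.
transitivity ((x3 ^+ 3 / x9) ^+ 3 / (x1 ^+ 3 / x3)); first by field_nz.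
have nu : x1 ^+ 3 / x3 != 0 by nz.
move: h1 h2 nu np nq; move: (x1 ^+ 3 / x3) (x9 ^+ 3 / x3) (x3 ^+ 3 / x9) => u y v.
move=> h1 h2 nu ny nD.
have nv : y - 2 * q != 0 by rewrite -h1; nz.
have -> : u = (y - 2 * q) / (y + q) by rewrite -h1; field_nz.
apply: (mulIf (x := y ^+ 3 + q ^+ 3)).
  have -> : y ^+ 3 + q ^+ 3 = (y + q) * (y ^+ 2 - y * q + q ^+ 2) by ring.
  by nz.
transitivity (v ^+ 3 * (y ^+ 3 + q ^+ 3) * (y + q) / (y - 2 * q)); first by field_nz.
by rewrite h2; field_nz.
Qed.

Lemma cubeN (F : fieldType) (q : F) : (- q) ^+ 3 = - q ^+ 3. Proof. by ring. Qed.

Section Level9.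
Variable r : fps int.
Hypotheses (r0 : r 0%N = 0) (rn : r%:F != 0 :> K).
Local Notation x := (xx_ r).
Local Notation y := (yy_ r).

Lemma level9_opp : y 1 ^+ 3 / y 3 * (y 9 ^+ 3 / y 3 - r%:F) = y 9 ^+ 3 / y 3 + 2 * r%:F.
Proof.
have := level9 (fpsN0 r0); rewrite !xx_opp //.
by rewrite !rmorphN /= mulrN opprK.
Qed.

Lemma level9_sqr : x 2 ^+ 3 / x 6 * (x 18 ^+ 3 / x 6 + r%:F ^+ 2) = x 18 ^+ 3 / x 6 - 2 * r%:F ^+ 2.
Proof.
have := level9 (exp0 r0 (k := 2) isT).
rewrite (xx_pow r (m := 2) (k := 1) (n := 2) erefl) (xx_pow r (m := 2) (k := 3) (n := 6) erefl).
by rewrite (xx_pow r (m := 2) (k := 9) (n := 18) erefl) !rmorphXn /=.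
Qed.

Lemma y9_diff : x 9 ^+ 3 / x 3 - y 9 ^+ 3 / y 3 = 2 * r%:F ^+ 3 / (x 18 ^+ 3 / x 6).
Proof.
have := mu13_diff (exp0 r0 (k := 3) isT).
rewrite (xx_pow r (m := 3) (k := 1) (n := 3) erefl) (xx_pow r (m := 3) (k := 3) (n := 9) erefl).
rewrite (yy_pow r (m := 3) (k := 1) (n := 3) erefl) (yy_pow r (m := 3) (k := 3) (n := 9) erefl).
rewrite (xx_pow r (m := 3) (k := 2) (n := 6) erefl) (xx_pow r (m := 3) (k := 6) (n := 18) erefl).
by rewrite !rmorphXn /=.
Qed.

Lemma cubic9 : (x 3 ^+ 3 / x 9) ^+ 3 * ((x 9 ^+ 3 / x 3) ^+ 3 + r%:F ^+ 3) = (x 9 ^+ 3 / x 3) ^+ 3 - 8 * r%:F ^+ 3.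
Proof.
have := cubic3 (exp0 r0 (k := 3) isT).
rewrite (xx_pow r (m := 3) (k := 1) (n := 3) erefl) (xx_pow r (m := 3) (k := 3) (n := 9) erefl).
by rewrite !rmorphXn /=.
Qed.

Lemma eta1_diff : x 1 ^+ 3 * x 9 ^+ 3 / x 3 ^+ 2 - y 1 ^+ 3 * y 9 ^+ 3 / y 3 ^+ 2 =
  - (6 * r%:F) - 4 * r%:F ^+ 3 / (x 2 ^+ 3 * x 18 ^+ 3 / x 6 ^+ 2).
Proof.
rewrite -(eta1_shape (x 1) (x 9) (xx_neq0 r0 (k := 3) isT)) -(eta1_shape (y 1) (y 9) (yy_neq0 r0 (k := 3) isT)) -(eta1_shape (x 2) (x 18) (xx_neq0 r0 (k := 6) isT)).
have n1 : x 18 ^+ 3 / x 6 + r%:F ^+ 2 != 0 by cst_nz r0.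
have -> : x 2 ^+ 3 / x 6 = (x 18 ^+ 3 / x 6 - 2 * r%:F ^+ 2) / (x 18 ^+ 3 / x 6 + r%:F ^+ 2).
  by apply: (canRL (mulfK n1)); exact: level9_sqr.
apply: (eta_diff (level9 r0) level9_opp (quot_mul 3 1 (x9y9 r0) (x3y3 r0)) y9_diff); cst_nz r0.
Qed.

Lemma level9_opp_cube : (y 3 ^+ 3 / y 9) ^+ 3 * ((y 9 ^+ 3 / y 3) ^+ 3 - r%:F ^+ 3) = (y 9 ^+ 3 / y 3) ^+ 3 + 8 * r%:F ^+ 3.
Proof.
have := cubic3 (exp0 (fpsN0 r0) (k := 3) isT).
rewrite (xx_pow (- r) (m := 3) (k := 1) (n := 3) erefl) (xx_pow (- r) (m := 3) (k := 3) (n := 9) erefl).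
by rewrite !xx_opp // (@oppX r 3 isT) rmorphN !rmorphXn /= mulrN opprK.
Qed.

Lemma cubic9_sqr : (x 6 ^+ 3 / x 18) ^+ 3 * ((x 18 ^+ 3 / x 6) ^+ 3 + (r%:F ^+ 2) ^+ 3) =
  (x 18 ^+ 3 / x 6) ^+ 3 - 8 * (r%:F ^+ 2) ^+ 3.
Proof.
have := cubic3 (exp0 r0 (k := 6) isT).
rewrite (xx_pow r (m := 6) (k := 1) (n := 6) erefl) (xx_pow r (m := 6) (k := 3) (n := 18) erefl).
by rewrite !rmorphXn /= -exprM.
Qed.

Lemma eta5_x : x 3 ^+ 10 / (x 1 ^+ 3 * x 9 ^+ 3) =
  ((x 9 ^+ 3 / x 3) ^+ 2 + 2 * (x 9 ^+ 3 / x 3) * r%:F + 4 * r%:F ^+ 2) /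
  ((x 9 ^+ 3 / x 3) ^+ 2 - x 9 ^+ 3 / x 3 * r%:F + r%:F ^+ 2).
Proof. by apply: (eta5_shape (level9 r0) cubic9); cst_nz r0. Qed.

Lemma eta5_y : y 3 ^+ 10 / (y 1 ^+ 3 * y 9 ^+ 3) =
  ((y 9 ^+ 3 / y 3) ^+ 2 - 2 * (y 9 ^+ 3 / y 3) * r%:F + 4 * r%:F ^+ 2) /
  ((y 9 ^+ 3 / y 3) ^+ 2 + y 9 ^+ 3 / y 3 * r%:F + r%:F ^+ 2).
Proof.
have h1 : y 1 ^+ 3 / y 3 * (y 9 ^+ 3 / y 3 + - r%:F) = y 9 ^+ 3 / y 3 - 2 * - r%:F.
  by rewrite [2 * _]mulrN opprK; exact: level9_opp.
have h2 : (y 3 ^+ 3 / y 9) ^+ 3 * ((y 9 ^+ 3 / y 3) ^+ 3 + (- r%:F) ^+ 3) =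
    (y 9 ^+ 3 / y 3) ^+ 3 - 8 * (- r%:F) ^+ 3.
  by rewrite cubeN [8 * _]mulrN opprK; exact: level9_opp_cube.
have := eta5_shape h1 h2; rewrite [2 * _ * - _]mulrN [_ / _ * - _]mulrN opprK sqrrN.
apply; cst_nz r0.
Qed.

Lemma eta5_x2 : x 6 ^+ 10 / (x 2 ^+ 3 * x 18 ^+ 3) =
  ((x 18 ^+ 3 / x 6) ^+ 2 + 2 * (x 18 ^+ 3 / x 6) * r%:F ^+ 2 + 4 * (r%:F ^+ 2) ^+ 2) /
  ((x 18 ^+ 3 / x 6) ^+ 2 - x 18 ^+ 3 / x 6 * r%:F ^+ 2 + (r%:F ^+ 2) ^+ 2).
Proof. by apply: (eta5_shape level9_sqr cubic9_sqr); cst_nz r0. Qed.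

Lemma eta5_sum : x 3 ^+ 10 / (x 1 ^+ 3 * x 9 ^+ 3) + y 3 ^+ 10 / (y 1 ^+ 3 * y 9 ^+ 3) =
  6 - 4 / (x 6 ^+ 10 / (x 2 ^+ 3 * x 18 ^+ 3)).
Proof.
rewrite eta5_x eta5_y eta5_x2 -[(r%:F ^+ 2) ^+ 2]exprM.
by apply: (eta_sum (quot_mul 3 1 (x9y9 r0) (x3y3 r0)) y9_diff); cst_nz r0.
Qed.

Lemma zeta71_diff : x 1 * x 7 - y 1 * y 7 = - (2 * r%:F) / (x 2 * x 14).
Proof. exact: level7. Qed.

Lemma zeta73_diff : (x 1 * x 7) ^+ 3 - (y 1 * y 7) ^+ 3 =
  3 * - (2 * r%:F) + (- (2 * r%:F)) ^+ 3 / (x 2 * x 14) ^+ 3.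
Proof.
apply: cube_sub; last by cst_nz r0.
  by rewrite mulrACA (x1y1 r0) (xx_yy r0 (k := 7) (n := 14) isT erefl).
exact: zeta71_diff.
Qed.

End Level9.

(** * Level 15 *)

Section Vieta.
Variable F : fieldType.

(** Divided differences: subtracting the equations of two roots and cancelling the difference of the
    roots lowers the degree. *)
Lemma vieta3 (a b c d X Y Z : F) :
  a * X ^+ 3 + b * X ^+ 2 + c * X + d = 0 ->
  a * Y ^+ 3 + b * Y ^+ 2 + c * Y + d = 0 ->
  a * Z ^+ 3 + b * Z ^+ 2 + c * Z + d = 0 ->
  X - Y != 0 -> X - Z != 0 -> Y - Z != 0 ->
  [/\ b = - a * (X + Y + Z), c = a * (X * Y + Y * Z + Z * X) & d = - a * (X * Y * Z)].
Proof.
move=> hX hY hZ nXY nXZ nYZ.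
have h1 : a * (X ^+ 2 + X * Y + Y ^+ 2) + b * (X + Y) + c = 0.
  by apply: (mulfI nXY); rewrite mulr0 -[RHS](subrr (a * Y ^+ 3 + b * Y ^+ 2 + c * Y + d)) {1}hY -{1}hX; ring.
have h2 : a * (X ^+ 2 + X * Z + Z ^+ 2) + b * (X + Z) + c = 0.
  by apply: (mulfI nXZ); rewrite mulr0 -[RHS](subrr (a * Z ^+ 3 + b * Z ^+ 2 + c * Z + d)) {1}hZ -{1}hX; ring.
have h3 : a * (X + Y + Z) + b = 0.
  apply: (mulfI nYZ); rewrite mulr0 -[RHS](subrr (a * (X ^+ 2 + X * Z + Z ^+ 2) + b * (X + Z) + c)) {1}h2 -{1}h1; ring.
have bE : b = - a * (X + Y + Z).
  by rewrite -[b](addr0 b) -[0]oppr0 -{1}h3; ring.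
have cE : c = a * (X * Y + Y * Z + Z * X).
  by rewrite -[c](addr0 c) -[0]oppr0 -{1}h1 bE; ring.
split=> //; rewrite -[d](addr0 d) -[0]oppr0 -{1}hX bE cE; ring.
Qed.

(** Both hypotheses are linear in R: k s = R (k - G^2) and G p = R (k + G^2). Eliminating R leaves a
    cubic in G alone. *)
Lemma level15_cubic (k s p G R : F) :
  G ^+ 2 * R = - k * (s - R) -> k * R = G * (p - G * R) ->
  p * G ^+ 3 + k * s * G ^+ 2 + - (k * p) * G + k ^+ 2 * s = 0.
Proof.
move=> h1 h2.
have e1 : k * s = R * (k - G ^+ 2) by rewrite -[k * s](addr0 _) -(subrr (G ^+ 2 * R)) {1}h1; ring.
have e2 : G * p = R * (k + G ^+ 2) by rewrite -[G * p](addr0 _) -(subrr (k * R)) {2}h2; ring.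
transitivity (k * s * (k + G ^+ 2) + G * p * (G ^+ 2 - k)); first by ring.
by rewrite e1 e2; ring.
Qed.

(* The [G_i] are the roots of p X^3 + k s X^2 - k p X + k^2 s, where s is the sum of
   the [R_i], and [R_i] is proportional to [G_i] minus the sum of the roots; the
   product of the [R_i] then forces p = 2 k. *)
Lemma level15_sym (k r G1 G2 G3 R1 R2 R3 : F) :
  G1 ^+ 2 * R1 = - k * (R2 + R3) -> G2 ^+ 2 * R2 = - k * (R1 + R3) -> G3 ^+ 2 * R3 = - k * (R1 + R2) ->
  k * R1 = G1 * (G2 * R2 + G3 * R3) -> k * R2 = G2 * (G1 * R1 + G3 * R3) -> k * R3 = G3 * (G1 * R1 + G2 * R2) ->
  G1 * G2 * G3 = r -> R1 * R2 * R3 = 2 * r ->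
  k != 0 -> r != 0 -> 2 != 0 :> F -> G1 - G2 != 0 -> G1 - G3 != 0 -> G2 - G3 != 0 ->
  let p := G1 * R1 + G2 * R2 + G3 * R3 in p != 0 -> p ^+ 2 + 2 * k * p + 4 * k ^+ 2 != 0 ->
  G1 * R1 ^+ 2 + G2 * R2 ^+ 2 + G3 * R3 ^+ 2 = 2 * r.
Proof.
move=> a1 a2 a3 b1 b2 b3 hG hR nk nr n2 n12 n13 n23 p np nq.
pose s := R1 + R2 + R3; pose S := G1 + G2 + G3.
have c1 : G1 ^+ 2 * R1 = - k * (s - R1) by rewrite a1 /s; ring.
have c2 : G2 ^+ 2 * R2 = - k * (s - R2) by rewrite a2 /s; ring.
have c3 : G3 ^+ 2 * R3 = - k * (s - R3) by rewrite a3 /s; ring.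
have d1 : k * R1 = G1 * (p - G1 * R1) by rewrite b1 /p; ring.
have d2 : k * R2 = G2 * (p - G2 * R2) by rewrite b2 /p; ring.
have d3 : k * R3 = G3 * (p - G3 * R3) by rewrite b3 /p; ring.
have [v1 v2 v3] := vieta3 (level15_cubic c1 d1) (level15_cubic c2 d2) (level15_cubic c3 d3) n12 n13 n23.
have e2 : G1 * G2 + G2 * G3 + G3 * G1 = - k.
  by apply: (mulfI np); rewrite -v2; ring.
have e3 : k * S = r.
  apply: (mulfI np); rewrite -hG; transitivity (- (k * (- p * S))); first by ring.
  by rewrite /S -v1; transitivity (- (k ^+ 2 * s)); [ring | rewrite v3; ring].
have RE G R : G ^+ 2 * R = - k * (s - R) -> k * R = G * (p - G * R) -> 2 * k * R = p * (G - S).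
  move=> h1 h2; have -> : p * (G - S) = G * p + - p * S by ring.
  rewrite /S -v1; transitivity (k * R + (k * s + - k * (s - R))); first by ring.
  by rewrite -h1 {1}h2; ring.
have [[r1 r2] r3] := (RE _ _ c1 d1, RE _ _ c2 d2, RE _ _ c3 d3).
(* Since S is the sum of the roots, this product is G1 G2 G3 - S e2 with e2 = - k the second
   symmetric function, that is r + k S = 2r. It equals R1 R2 R3, which turns the relations 2 k R_i =
   p (G_i - S) into p^3 = (2k)^3. *)
have pr : (G1 - S) * (G2 - S) * (G3 - S) = 2 * r.
  transitivity (G1 * G2 * G3 - S * (G1 * G2 + G2 * G3 + G3 * G1)); first by rewrite /S; ring.
  by rewrite hG e2 -e3; ring.
have p2k : p = 2 * k.
  apply/eqP; rewrite -subr_eq0; apply/eqP; apply: (mulfI nq); apply: (mulfI nr); apply: (mulfI n2).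
  transitivity (p ^+ 3 * (2 * r) - (2 * k) ^+ 3 * (2 * r)); first by ring.
  rewrite -{1}pr -hR; transitivity ((p * (G1 - S)) * (p * (G2 - S)) * (p * (G3 - S)) - (2 * k * R1) * (2 * k * R2) * (2 * k * R3)); first by ring.
  by rewrite r1 r2 r3; ring.
have n2k : 2 * k != 0 by nz.
have RS G R : 2 * k * R = p * (G - S) -> R = G - S by rewrite p2k => /(mulfI n2k).
rewrite (RS _ _ r1) (RS _ _ r2) (RS _ _ r3).
transitivity (S * (G1 * G2 + G2 * G3 + G3 * G1) + 3 * (G1 * G2 * G3)); first by rewrite /S; ring.
by rewrite hG e2 -e3; ring.
Qed.

(** [level15_sym] is applied with G = (a/s, - b/t, - r s t/(a b)) and R = (s, - t, - 2r/(s t)). The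
    six hypotheses are its six relations, and the sum of the G_i R_i^2 is a s - b t - 4 r^3/(a b s
    t). *)
Lemma level15_alg (a b s t k r : F) :
  a ^+ 2 = k * (s * t + 2 * r / t) -> b ^+ 2 = k * (s * t - 2 * r / s) ->
  k * s ^+ 2 = a * b + 2 * r ^+ 2 / b -> k * t ^+ 2 = a * b + 2 * r ^+ 2 / a ->
  k * (1 / t - 1 / s) = 2 * r ^+ 3 / (a * b) ^+ 2 -> 1 / b + 1 / a = 2 * k / (s * t) ^+ 2 ->
  a != 0 -> b != 0 -> s != 0 -> t != 0 -> k != 0 -> r != 0 -> 2 != 0 :> F ->
  a / s + b / t != 0 -> a / s + r * (s * t) / (a * b) != 0 -> - (b / t) + r * (s * t) / (a * b) != 0 ->
  let p := a + b + 2 * r ^+ 2 / (a * b) in p != 0 -> p ^+ 2 + 2 * k * p + 4 * k ^+ 2 != 0 ->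
  b * t - a * s = - (2 * r) - 4 * r ^+ 3 / ((a * b) * (s * t)).
Proof.
move=> h1 h2 h3 h4 h5 h6 na nb ns nt nk nr n2 d12 d13 d23 p np nq.
have E : p = a / s * s + - (b / t) * - t + - (r * (s * t) / (a * b)) * - (2 * r / (s * t)).
  by rewrite /p; field_nz.
rewrite E in np nq.
have nd (x y : F) : x + y != 0 -> x - - y != 0 by rewrite opprK.
have H : a / s * s ^+ 2 + - (b / t) * (- t) ^+ 2 + - (r * (s * t) / (a * b)) * (- (2 * r / (s * t))) ^+ 2 = 2 * r.
  apply: (@level15_sym k r); try done; try (exact: nd).
  - by transitivity (a ^+ 2 / s); [field_nz | rewrite h1; field_nz].
  - by transitivity (- (b ^+ 2 / t)); [field_nz | rewrite h2; field_nz].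
  - transitivity (- (s * t) * (2 * r ^+ 3 / (a * b) ^+ 2)); first by field_nz.
    by rewrite -h5; field_nz.
  - transitivity (k * s ^+ 2 / s); first by field_nz.
    by rewrite h3; field_nz.
  - transitivity (- (k * t ^+ 2 / t)); first by field_nz.
    by rewrite h4; field_nz.
  - transitivity (- (r * (s * t)) * (2 * k / (s * t) ^+ 2)); first by field_nz.
    by rewrite -h6; field_nz.
  - by field_nz.
  - by field_nz.
rewrite -H; by field_nz.
Qed.

End Vieta.

Lemma phi_quad_alg (F : fieldType) (p p' m m' u u' w Y Y' X X' z z' d d' e e' g g' : F) :
  p = Y ^+ 2 * d -> p' = Y' ^+ 2 * d' -> m = X ^+ 2 * e -> m' = X' ^+ 2 * e' ->
  u = g / z -> u' = g' / z' -> g = X * e -> g' = X' * e' ->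
  p * p' = m * m' + w * (u * u') ->
  d != 0 -> d' != 0 -> z != 0 -> z' != 0 ->
  (Y * Y') ^+ 2 = g * g' / (d * d') * (X * X' + w / (z * z')).
Proof.
move=> -> -> -> -> -> -> -> -> H n1 n2 n3 n4.
apply: (mulIf (x := d * d')); first by nz.
by etransitivity; [etransitivity; [|exact: H] |]; field_nz.
Qed.

Lemma psi_quad_alg (F : fieldType) (a a' b b' v v' w z z' t t' X X' g g' G G' e e' : F) :
  a = g / z -> a' = g' / z' -> b = g / t -> b' = g' / t' -> v = e / X -> v' = e' / X' ->
  G = X * e -> G' = X' * e' -> a * a' + b * b' = w * (v * v') ->
  z != 0 -> z' != 0 -> t != 0 -> t' != 0 -> X != 0 -> X' != 0 ->
  g * g' * (1 / (z * z') + 1 / (t * t')) = w * (G * G') / (X * X') ^+ 2.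
Proof.
move=> -> -> -> -> -> -> -> -> H n1 n2 n3 n4 n5 n6.
by etransitivity; [etransitivity; [|exact: H] |]; field_nz.
Qed.

Lemma psi_quadB_alg (F : fieldType) (a a' b b' v v' w z z' t t' X X' g g' G G' e e' : F) :
  a = g / z -> a' = g' / z' -> b = g / t -> b' = g' / t' -> v = e / X -> v' = e' / X' ->
  G = X * e -> G' = X' * e' -> a * a' - b * b' = w * (v * v') ->
  z != 0 -> z' != 0 -> t != 0 -> t' != 0 -> X != 0 -> X' != 0 ->
  g * g' * (1 / (z * z') - 1 / (t * t')) = w * (G * G') / (X * X') ^+ 2.
Proof.
move=> -> -> -> -> -> -> -> -> H n1 n2 n3 n4 n5 n6.
by etransitivity; [etransitivity; [|exact: H] |]; field_nz.
Qed.

Lemma lift_quad (p p' m m' u u' r : fps int) k : p * p' = m * m' + 2 * r ^+ k * u * u' ->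
  p%:F * p'%:F = m%:F * m'%:F + 2 * r%:F ^+ k * (u%:F * u'%:F) :> K.
Proof. by rewrite -[2 * _ * u * u']mulrA; lift_frac. Qed.

Lemma lift_quadN (p p' m m' u u' r : fps int) : p * p' = m * m' + 2 * - r * u * u' ->
  p%:F * p'%:F = m%:F * m'%:F + - (2 * r%:F) * (u%:F * u'%:F) :> K.
Proof. by rewrite -[2 * _ * u * u']mulrA mulrN; lift_frac. Qed.

Lemma lift_psi (p p' m m' u u' : fps int) : p * p' + m * m' = 2 * u * u' ->
  p%:F * p'%:F + m%:F * m'%:F = 2 * (u%:F * u'%:F) :> K.
Proof. by rewrite -[2 * u * u']mulrA; lift_frac. Qed.

Lemma lift_psiB (p p' m m' u u' r : fps int) : p * p' - m * m' = 2 * r ^+ 3 * u * u' ->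
  p%:F * p'%:F - m%:F * m'%:F = 2 * r%:F ^+ 3 * (u%:F * u'%:F) :> K.
Proof. by rewrite -[2 * _ * u * u']mulrA; lift_frac. Qed.

Section Level15.
Variable r : fps int.
Hypotheses (r0 : r 0%N = 0) (rn : r%:F != 0 :> K).
Local Notation x := (xx_ r).
Local Notation y := (yy_ r).
Local Notation e := (ee_ r).

Lemma level15_1 : (y 1 * y 15) ^+ 2 = e 6 * e 10 / (e 2 * e 30) * (x 6 * x 10 + 2 * r%:F ^+ 1 / (x 3 * x 5)).
Proof.
have H : phi (r ^+ 1) * phi (r ^+ 15) =
  phi (- r ^+ 6) * phi (- r ^+ 10) + 2 * r ^+ 1 * psi (r ^+ 3) * psi (r ^+ 5).
  by rewrite !expr1; exact: lattice_15_phi.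
apply: (phi_quad_alg (phi_yy r0 (k := 1) (n := 2) isT erefl) (phi_yy r0 (k := 15) (n := 30) isT erefl)
  (phi_xx r0 (k := 6) (n := 12) isT erefl) (phi_xx r0 (k := 10) (n := 20) isT erefl)
  (psi_xx r0 (k := 3) (n := 6) isT erefl) (psi_xx r0 (k := 5) (n := 10) isT erefl)
  (ee_xx r0 (k := 6) (n := 12) isT erefl) (ee_xx r0 (k := 10) (n := 20) isT erefl) (lift_quad H)); nz_side.
Qed.

Lemma level15_2 : (x 1 * x 15) ^+ 2 = e 6 * e 10 / (e 2 * e 30) * (x 6 * x 10 + - (2 * r%:F) / (y 3 * y 5)).
Proof.
have H : phi (- r ^+ 1) * phi (- r ^+ 15) =
  phi (- r ^+ 6) * phi (- r ^+ 10) + 2 * - r * psi (- r ^+ 3) * psi (- r ^+ 5).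
  have := lattice_15_phi (fpsN0 r0).
  rewrite (@oppX r 15 isT) (@oppX r 3 isT) (@oppX r 5 isT) (@oppX_even r 6 isT) (@oppX_even r 10 isT).
  by rewrite expr1; exact.
apply: (phi_quad_alg (phi_xx r0 (k := 1) (n := 2) isT erefl) (phi_xx r0 (k := 15) (n := 30) isT erefl)
  (phi_xx r0 (k := 6) (n := 12) isT erefl) (phi_xx r0 (k := 10) (n := 20) isT erefl)
  (psi_yy r0 (k := 3) (n := 6) isT erefl) (psi_yy r0 (k := 5) (n := 10) isT erefl)
  (ee_xx r0 (k := 6) (n := 12) isT erefl) (ee_xx r0 (k := 10) (n := 20) isT erefl) (lift_quadN H)); nz_side.
Qed.

Lemma level15_3 : (y 3 * y 5) ^+ 2 = e 2 * e 30 / (e 6 * e 10) * (x 2 * x 30 + 2 * r%:F ^+ 2 / (x 1 * x 15)).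
Proof.
have H : phi (r ^+ 3) * phi (r ^+ 5) =
  phi (- r ^+ 2) * phi (- r ^+ 30) + 2 * r ^+ 2 * psi (r ^+ 1) * psi (r ^+ 15).
  by rewrite expr1; exact: lattice_15_phi35.
apply: (phi_quad_alg (phi_yy r0 (k := 3) (n := 6) isT erefl) (phi_yy r0 (k := 5) (n := 10) isT erefl)
  (phi_xx r0 (k := 2) (n := 4) isT erefl) (phi_xx r0 (k := 30) (n := 60) isT erefl)
  (psi_xx r0 (k := 1) (n := 2) isT erefl) (psi_xx r0 (k := 15) (n := 30) isT erefl)
  (ee_xx r0 (k := 2) (n := 4) isT erefl) (ee_xx r0 (k := 30) (n := 60) isT erefl) (lift_quad H)); nz_side.
Qed.

Lemma level15_4 : (x 3 * x 5) ^+ 2 = e 2 * e 30 / (e 6 * e 10) * (x 2 * x 30 + 2 * r%:F ^+ 2 / (y 1 * y 15)).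
Proof.
have H : phi (- r ^+ 3) * phi (- r ^+ 5) =
  phi (- r ^+ 2) * phi (- r ^+ 30) + 2 * r ^+ 2 * psi (- r ^+ 1) * psi (- r ^+ 15).
  have := lattice_15_phi35 (fpsN0 r0).
  rewrite (@oppX r 15 isT) (@oppX r 3 isT) (@oppX r 5 isT) (@oppX_even r 2 isT) (@oppX_even r 30 isT).
  by rewrite expr1; exact.
apply: (phi_quad_alg (phi_xx r0 (k := 3) (n := 6) isT erefl) (phi_xx r0 (k := 5) (n := 10) isT erefl)
  (phi_xx r0 (k := 2) (n := 4) isT erefl) (phi_xx r0 (k := 30) (n := 60) isT erefl)
  (psi_yy r0 (k := 1) (n := 2) isT erefl) (psi_yy r0 (k := 15) (n := 30) isT erefl)
  (ee_xx r0 (k := 2) (n := 4) isT erefl) (ee_xx r0 (k := 30) (n := 60) isT erefl) (lift_quad H)); nz_side.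
Qed.

Lemma level15_5 : e 6 * e 10 * (1 / (x 3 * x 5) - 1 / (y 3 * y 5)) =
  2 * r%:F ^+ 3 * (e 2 * e 30) / (x 2 * x 30) ^+ 2.
Proof.
have H : psi (r ^+ 3) * psi (r ^+ 5) - psi (- r ^+ 3) * psi (- r ^+ 5) = 2 * r ^+ 3 * psi (r ^+ 2) * psi (r ^+ 30).
  have := lattice_15_psi35 r0.
  by rewrite (@oppX r 3 isT) (@oppX r 5 isT); exact.
apply: (psi_quadB_alg (psi_xx r0 (k := 3) (n := 6) isT erefl) (psi_xx r0 (k := 5) (n := 10) isT erefl)
  (psi_yy r0 (k := 3) (n := 6) isT erefl) (psi_yy r0 (k := 5) (n := 10) isT erefl)
  (psi_xx r0 (k := 2) (n := 4) isT erefl) (psi_xx r0 (k := 30) (n := 60) isT erefl)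
  (ee_xx r0 (k := 2) (n := 4) isT erefl) (ee_xx r0 (k := 30) (n := 60) isT erefl) (lift_psiB H)); nz_side.
Qed.

Lemma level15_6 : e 2 * e 30 * (1 / (x 1 * x 15) + 1 / (y 1 * y 15)) =
  2 * (e 6 * e 10) / (x 6 * x 10) ^+ 2.
Proof.
have H : psi (r ^+ 1) * psi (r ^+ 15) + psi (- r ^+ 1) * psi (- r ^+ 15) = 2 * psi (r ^+ 6) * psi (r ^+ 10).
  have := lattice_15_psi r0.
  by rewrite (@oppX r 15 isT) !expr1; exact.
apply: (psi_quad_alg (psi_xx r0 (k := 1) (n := 2) isT erefl) (psi_xx r0 (k := 15) (n := 30) isT erefl)
  (psi_yy r0 (k := 1) (n := 2) isT erefl) (psi_yy r0 (k := 15) (n := 30) isT erefl)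
  (psi_xx r0 (k := 6) (n := 12) isT erefl) (psi_xx r0 (k := 10) (n := 20) isT erefl)
  (ee_xx r0 (k := 6) (n := 12) isT erefl) (ee_xx r0 (k := 10) (n := 20) isT erefl) (lift_psi H)); nz_side.
Qed.

(** To be read with a = y1 y15, b = x1 x15, s = y3 y5, t = x3 x5, M = e6 e10 and E = e2 e30. Then b
    t is the series theta_1, a s its image under q |-> -q, and the factor k is M/E. *)
Lemma level15_final (F : fieldType) (a b s t ab st M E q : F) :
  a ^+ 2 = M / E * (st + 2 * q ^+ 1 / t) -> b ^+ 2 = M / E * (st + - (2 * q) / s) ->
  s ^+ 2 = E / M * (ab + 2 * q ^+ 2 / b) -> t ^+ 2 = E / M * (ab + 2 * q ^+ 2 / a) ->
  M * (1 / t - 1 / s) = 2 * q ^+ 3 * E / ab ^+ 2 -> E * (1 / b + 1 / a) = 2 * M / st ^+ 2 ->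
  a * b = ab -> s * t = st ->
  a != 0 -> b != 0 -> s != 0 -> t != 0 -> M != 0 -> E != 0 -> q != 0 -> 2 != 0 :> F ->
  a / s + b / t != 0 -> a / s + q * (s * t) / (a * b) != 0 -> - (b / t) + q * (s * t) / (a * b) != 0 ->
  a + b + 2 * q ^+ 2 / (a * b) != 0 ->
  (a + b + 2 * q ^+ 2 / (a * b)) ^+ 2 + 2 * (M / E) * (a + b + 2 * q ^+ 2 / (a * b)) + 4 * (M / E) ^+ 2 != 0 ->
  b * t - a * s = - (2 * q) - 4 * q ^+ 3 / (ab * st).
Proof.
move=> h1 h2 h3 h4 h5 h6 hab hst na nb ns nt nM nE nq n2 d1 d2 d3 np nr.
have nab : ab != 0 by rewrite -hab; nz.
have nst : st != 0 by rewrite -hst; nz.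
rewrite -{1}hab -{1}hst.
apply: (level15_alg (k := M / E) _ _ _ _ _ _ na nb ns nt _ nq n2 d1 d2 d3 np nr).
- by rewrite h1 hst expr1.
- by rewrite h2 hst mulNr.
- by rewrite h3 hab; field_nz.
- by rewrite h4 hab; field_nz.
- transitivity (M * (1 / t - 1 / s) / E); first by field_nz.
  by rewrite h5 hab; field_nz.
- transitivity (E * (1 / b + 1 / a) / E); first by field_nz.
  by rewrite h6 hst; field_nz.
- by nz.
Qed.

Lemma theta1_diff : x 1 * x 15 * (x 3 * x 5) - y 1 * y 15 * (y 3 * y 5) =
  - (2 * r%:F) - 4 * r%:F ^+ 3 / (x 2 * x 30 * (x 6 * x 10)).
Proof.
have hab : y 1 * y 15 * (x 1 * x 15) = x 2 * x 30.
  by rewrite mulrC mulrACA (x1y1 r0) (xx_yy r0 (k := 15) (n := 30) isT erefl).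
have hst : y 3 * y 5 * (x 3 * x 5) = x 6 * x 10.
  by rewrite mulrC mulrACA (x3y3 r0) (x5y5 r0).
apply: (level15_final level15_1 level15_2 level15_3 level15_4 level15_5 level15_6 hab hst).
- cst_nz r0.
- cst_nz r0.
- cst_nz r0.
- cst_nz r0.
- cst_nz r0.
- cst_nz r0.
- exact: rn.
- exact: char0K 1.
- cst_nz r0.
- cst_nz r0.
- cst_nz r0.
- cst_nz r0.
- cst_nz r0.
Qed.

End Level15.

(** * Level 25 *)

Section Level25Algebra.
Variable F : fieldType.

(** With u and v the Rogers-Ramanujan continued fraction at q and q^2, t/s is q^(1/5)/u, T/S is
    q^(2/5)/v, and the conclusion is the classical relation v - u^2 = (v + u^2) u v^2. The two
    addition formulas become [k1] and [k2], from which the auxiliary quotient m is eliminated. *)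
Lemma level25_cubic_alg (s t S T sp tp m1 m3 e5 e10 q : F) :
  t * sp = T * m3 + q * (S * m1) -> s * tp = T * m3 - q * (S * m1) ->
  s * sp * e10 = S * e5 ^+ 2 -> t * tp * e10 = T * e5 ^+ 2 ->
  s * e10 ^+ 2 = m1 * T * e5 -> t * e10 ^+ 2 = m3 * S * e5 ->
  s != 0 -> t != 0 -> S != 0 -> T != 0 -> e5 != 0 -> e10 != 0 ->
  (T / S) ^+ 2 * (t / s) ^+ 3 - q * (t / s) ^+ 2 - (T / S) ^+ 3 * (t / s) - q * (T / S) = 0.
Proof.
move=> h1 h2 p1 p2 p3 p4 ns nt nS nT ne5 ne10.
have E1 : sp = S * e5 ^+ 2 / (s * e10) by rewrite -p1; field_nz.
have E2 : tp = T * e5 ^+ 2 / (t * e10) by rewrite -p2; field_nz.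
have E3 : m1 = s * e10 ^+ 2 / (T * e5) by rewrite p3; field_nz.
have E4 : m3 = t * e10 ^+ 2 / (S * e5) by rewrite p4; field_nz.
move: h1 h2; rewrite E1 E2 E3 E4 => h1 h2.
pose m := S / s * (e5 / e10) ^+ 3.
have k1 : t / s * m = T / S * (t / s) + q / (T / S).
  transitivity (t * (S * e5 ^+ 2 / (s * e10)) / (s * e10 ^+ 2 / e5)); first by rewrite /m; field_nz.
  by rewrite h1; field_nz.
have k2 : T / S / (t / s) * m = T / S * (t / s) - q / (T / S).
  transitivity (s * (T * e5 ^+ 2 / (t * e10)) / (s * e10 ^+ 2 / e5)); first by rewrite /m; field_nz.
  by rewrite h2; field_nz.
transitivity (T / S * (t / s) ^+ 2 * (T / S * (t / s) - q / (T / S)) -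
  (T / S) ^+ 2 * (T / S * (t / s) + q / (T / S))); first by field_nz.
by rewrite -k1 -k2; field_nz.
Qed.

(* [C], [- C'] and [- q / C4] are the roots of one cubic with coefficients in [C2]. *)
Lemma level25_roots (C C' C2 C4 q : F) :
  C2 ^+ 2 * C ^+ 3 - q * C ^+ 2 - C2 ^+ 3 * C - q * C2 = 0 ->
  C2 ^+ 2 * C' ^+ 3 + q * C' ^+ 2 - C2 ^+ 3 * C' + q * C2 = 0 ->
  C4 ^+ 2 * C2 ^+ 3 - q ^+ 2 * C2 ^+ 2 - C4 ^+ 3 * C2 - q ^+ 2 * C4 = 0 ->
  C != 0 -> C' != 0 -> C2 != 0 -> C4 != 0 -> q != 0 ->
  C + C' != 0 -> C + q / C4 != 0 -> - C' + q / C4 != 0 ->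
  C - C' = q * (1 / C2 ^+ 2 + 1 / C4) /\ q * (1 / C - 1 / C') = C4 - C2 ^+ 2.
Proof.
move=> h1 h2 h3 nC nC' n2 n4 nq d1 d2 d3.
have nd (x y : F) : x + y != 0 -> x - - y != 0 by rewrite opprK.
have [|||v1 v2 v3] := @vieta3 F (C2 ^+ 2) (- q) (- C2 ^+ 3) (- (q * C2)) C (- C') (- (q / C4)) _ _ _ (nd _ _ d1) (nd _ _ d2) (nd _ _ d3).
- by rewrite -[RHS]h1; ring.
- by rewrite -[RHS]oppr0 -h2; ring.
(* At - q/C4 the cubic is, up to the factor q/C4^3, the same relation one level up, between C2 and
   C4 with q^2 in place of q. *)
- transitivity (q / C4 ^+ 3 * (C4 ^+ 2 * C2 ^+ 3 - q ^+ 2 * C2 ^+ 2 - C4 ^+ 3 * C2 - q ^+ 2 * C4)); first by field_nz.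
  by rewrite h3 mulr0.
have hd : C - C' = q * (1 / C2 ^+ 2 + 1 / C4).
  apply: (mulfI (x := C2 ^+ 2)); first by nz.
  transitivity (- (- C2 ^+ 2 * (C + - C' + - (q / C4))) + C2 ^+ 2 * q / C4); first by field_nz.
  by rewrite -v1; field_nz.
have hp : C * C' = C4 / C2.
  apply: (mulfI (x := C2 ^+ 2 * q / C4)); first by nz.
  transitivity (- (- C2 ^+ 2 * (C * - C' * - (q / C4)))); first by field_nz.
  by rewrite -v3; field_nz.
split=> //; transitivity (- q * (C - C') / (C * C')); first by field_nz.
rewrite hp; apply: (mulfI (x := C2)); first by nz.
have v2' : C2 ^+ 3 = C2 ^+ 2 * (C * C') + C2 ^+ 2 * (q / C4) * (C - C').
  by rewrite -[C2 ^+ 3]opprK v2; ring.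
transitivity (C2 * C4 - C2 ^+ 3); last by ring.
rewrite v2' hp; by field_nz.
Qed.

(** Multiplication by e2/e50 turns every quotient of x or y into a quotient of Euler products at q,
    -q and q^4, each given by the 5-dissection. The cubic relations hold with q^5, since c, c', c2
    and c4 are taken at fifth powers. *)
Lemma level25_final (c c' c2 c4 q e1 e25 y1 y25 x1 x25 x2 x50 e2 e50 e4 e100 : F) :
  e1 / e25 = c - q - q ^+ 2 / c -> y1 * e2 / (y25 * e50) = c' + q - q ^+ 2 / c' ->
  e2 / e50 = c2 - q ^+ 2 - q ^+ 4 / c2 -> e4 / e100 = c4 - q ^+ 4 - q ^+ 8 / c4 ->
  c - c' = q ^+ 5 * (1 / c2 ^+ 2 + 1 / c4) -> q ^+ 5 * (1 / c - 1 / c') = c4 - c2 ^+ 2 ->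
  e1 = x1 * e2 -> e25 = x25 * e50 -> e2 = x2 * e4 -> e50 = x50 * e100 ->
  c != 0 -> c' != 0 -> c2 != 0 -> c4 != 0 ->
  x2 != 0 -> x50 != 0 -> x25 != 0 -> y25 != 0 -> e4 != 0 -> e100 != 0 ->
  q ^+ 3 * (x1 / x25 - y1 / y25) + x50 / x2 = c2 + q ^+ 2 - q ^+ 4 / c2.
Proof.
move=> h1 h2 h3 h4 hd hv E1 E2 E3 E4 nc nc' nc2 nc4 n1 n2 n3 n4 n5 n6.
have n7 : e2 != 0 by rewrite E3; nz.
have n8 : e50 != 0 by rewrite E4; nz.
apply: (mulIf (x := e2 / e50)); first by nz.
transitivity (q ^+ 3 * (e1 / e25 - y1 * e2 / (y25 * e50)) + e4 / e100).
  have n9 : e25 != 0 by rewrite E2; nz.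
  by rewrite E1 E2 E3 E4; field_nz.
rewrite h1 h2 h3 h4.
transitivity (q ^+ 3 * (c - c') - q ^+ 5 * (1 / c - 1 / c') + c4 - 3 * q ^+ 4 - q ^+ 8 / c4); first by field_nz.
by rewrite hd hv; field_nz.
Qed.

Lemma level25_quot (s t s5 t5 q e1 e5 e25 : F) : s * t = e1 * e5 -> s5 * t5 = e5 * e25 ->
  s * t = t5 ^+ 2 - q * (s5 * t5) - q ^+ 2 * s5 ^+ 2 ->
  s5 != 0 -> t5 != 0 -> e5 != 0 -> e25 != 0 ->
  e1 / e25 = t5 / s5 - q - q ^+ 2 / (t5 / s5).
Proof.
move=> h1 h2 h3 ns nt n5 n25; apply: (mulIf (x := e5 * e25)); first by nz.
transitivity (e1 * e5); first by field_nz.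
by rewrite -h1 h3 -h2; field_nz.
Qed.

End Level25Algebra.

Lemma th_coef0 (R : comUnitRingType) (A B : fps R) : A 0%N = 0 -> B 0%N = 0 -> th A B 0%N = 1.
Proof.
move=> a b; rewrite (jacobi_triple a b) !fps_coefM0 !qpoch_coef0 ?mulr1 //.
- by rewrite fps_coefM0 a mul0r.
- by rewrite fps_coefN b oppr0.
- by rewrite fps_coefN a oppr0.
Qed.

HB.lock Definition ss_ (r : fps int) (k : nat) : K := (sT (r ^+ k))%:F.
HB.lock Definition tt_ (r : fps int) (k : nat) : K := (tT (r ^+ k))%:F.

Section RogersRamanujanQuotients.
Variable r : fps int.
Hypothesis r0 : r 0%N = 0.

Lemma ssE k : ss_ r k = (sT (r ^+ k))%:F. Proof. by rewrite ss_.unlock. Qed.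
Lemma ttE k : tt_ r k = (tT (r ^+ k))%:F. Proof. by rewrite tt_.unlock. Qed.

Lemma cst_ss k : (0 < k)%N -> cst (ss_ r k) 1.
Proof.
move=> k0; rewrite ssE; apply: cst_ser; apply: th_coef0; first exact: expN0.
by rewrite -exprM; apply: expN0 => //; rewrite muln_gt0 k0.
Qed.

Lemma cst_tt k : (0 < k)%N -> cst (tt_ r k) 1.
Proof.
by move=> k0; rewrite ttE; apply: cst_ser; apply: th_coef0;
  rewrite -exprM; apply: expN0 => //; rewrite muln_gt0 k0.
Qed.

Lemma ss_neq0 k : (0 < k)%N -> ss_ r k != 0. Proof. by move=> /cst_ss/cst_neq0; apply. Qed.
Lemma tt_neq0 k : (0 < k)%N -> tt_ r k != 0. Proof. by move=> /cst_tt/cst_neq0; apply. Qed.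

Lemma cst_cc k : (0 < k)%N -> cst (tt_ r k / ss_ r k) 1.
Proof. by move=> k0; rewrite -[1]mulr1; apply: cstM; [exact: cst_tt | apply/cstV/cst_ss]. Qed.

Lemma ss_pow m k n : n = (m * k)%N -> ss_ (r ^+ m) k = ss_ r n.
Proof. by move=> ->; rewrite ssE ss_.unlock exprM. Qed.
Lemma tt_pow m k n : n = (m * k)%N -> tt_ (r ^+ m) k = tt_ r n.
Proof. by move=> ->; rewrite ttE tt_.unlock exprM. Qed.

Lemma lift_add5 (a b c d e f q : fps int) : a * b = c * d + q * (e * f) ->
  a%:F * b%:F = c%:F * d%:F + q%:F * (e%:F * f%:F) :> K.
Proof. by lift_frac. Qed.

Lemma lift_sub5 (a b c d e f q : fps int) : a * b = c * d - q * (e * f) ->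
  a%:F * b%:F = c%:F * d%:F - q%:F * (e%:F * f%:F) :> K.
Proof. by lift_frac. Qed.

Lemma lift_prod_sq (a b c d e : fps int) : a * b * c = d * e ^+ 2 ->
  a%:F * b%:F * c%:F = d%:F * e%:F ^+ 2 :> K.
Proof. by lift_frac. Qed.

Lemma lift_sq_prod (a b c d e : fps int) : a * b ^+ 2 = c * d * e ->
  a%:F * b%:F ^+ 2 = c%:F * d%:F * e%:F :> K.
Proof. by lift_frac. Qed.

Lemma level25_cubic :
  let C := tt_ r 1 / ss_ r 1 in let C2 := tt_ r 2 / ss_ r 2 in
  C2 ^+ 2 * C ^+ 3 - r%:F * C ^+ 2 - C2 ^+ 3 * C - r%:F * C2 = 0.
Proof.
have P1 : sT (r ^+ 1) * sP r * eul (r ^+ 10) = sT (r ^+ 2) * eul (r ^+ 5) ^+ 2.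
  by rewrite expr1; exact: sT_sP.
have P2 : tT (r ^+ 1) * tP r * eul (r ^+ 10) = tT (r ^+ 2) * eul (r ^+ 5) ^+ 2.
  by rewrite expr1; exact: tT_tP.
have P3 : sT (r ^+ 1) * eul (r ^+ 10) ^+ 2 = n1 r * tT (r ^+ 2) * eul (r ^+ 5).
  by rewrite expr1; exact: sT_n1.
have P4 : tT (r ^+ 1) * eul (r ^+ 10) ^+ 2 = n3 r * sT (r ^+ 2) * eul (r ^+ 5).
  by rewrite expr1; exact: tT_n3.
have H1 : tT (r ^+ 1) * sP r = tT (r ^+ 2) * n3 r + r * (sT (r ^+ 2) * n1 r).
  by rewrite expr1; exact: lattice_5_add.
have H2 : sT (r ^+ 1) * tP r = tT (r ^+ 2) * n3 r - r * (sT (r ^+ 2) * n1 r).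
  by rewrite expr1; exact: lattice_5_sub.
have L1 : tt_ r 1 * (sP r)%:F = tt_ r 2 * (n3 r)%:F + r%:F * (ss_ r 2 * (n1 r)%:F).
  by rewrite !ttE !ssE; exact: lift_add5 H1.
have L2 : ss_ r 1 * (tP r)%:F = tt_ r 2 * (n3 r)%:F - r%:F * (ss_ r 2 * (n1 r)%:F).
  by rewrite !ttE !ssE; exact: lift_sub5 H2.
have L3 : ss_ r 1 * (sP r)%:F * ee_ r 10 = ss_ r 2 * ee_ r 5 ^+ 2.
  by rewrite !ssE !eeE; exact: lift_prod_sq P1.
have L4 : tt_ r 1 * (tP r)%:F * ee_ r 10 = tt_ r 2 * ee_ r 5 ^+ 2.
  by rewrite !ttE !eeE; exact: lift_prod_sq P2.
have L5 : ss_ r 1 * ee_ r 10 ^+ 2 = (n1 r)%:F * tt_ r 2 * ee_ r 5.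
  by rewrite !ssE !ttE !eeE; exact: lift_sq_prod P3.
have L6 : tt_ r 1 * ee_ r 10 ^+ 2 = (n3 r)%:F * ss_ r 2 * ee_ r 5.
  by rewrite !ssE !ttE !eeE; exact: lift_sq_prod P4.
apply: (level25_cubic_alg L1 L2 L3 L4 L5 L6).
- exact: ss_neq0.
- exact: tt_neq0.
- exact: ss_neq0.
- exact: tt_neq0.
- exact: ee_neq0.
- exact: ee_neq0.
Qed.

End RogersRamanujanQuotients.

Lemma ee_pow (r : fps int) m k n : n = (m * k)%N -> ee_ (r ^+ m) k = ee_ r n.
Proof. by move=> ->; rewrite !eeE exprM. Qed.

Lemma ee_opp (r : fps int) (r0 : r 0%N = 0) k n : odd k -> n = (k * 2)%N ->
  ee_ (- r) k = yy_ r k * ee_ r n.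
Proof.
move=> ok kn; rewrite eeE oppX //; apply: ee_yy => //.
by case: k ok {kn}.
Qed.

(** At r = q, the quotient q^(k/5) / R(q^k), where R is the Rogers-Ramanujan continued fraction. *)
Definition cc (r : fps int) k := tt_ r k / ss_ r k.

Lemma lift_mul4 (a b c d : fps int) : a * b = c * d -> a%:F * b%:F = c%:F * d%:F :> K.
Proof. by lift_frac. Qed.

Lemma lift_25 (s t s5 t5 r : fps int) : s * t = t5 ^+ 2 - r * (s5 * t5) - r ^+ 2 * s5 ^+ 2 ->
  s%:F * t%:F = t5%:F ^+ 2 - r%:F * (s5%:F * t5%:F) - r%:F ^+ 2 * s5%:F ^+ 2 :> K.
Proof. by lift_frac. Qed.

Lemma cc_neq0 (r : fps int) k : r 0%N = 0 -> (0 < k)%N -> cc r k != 0.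
Proof. by move=> r0 k0; apply: (cst_neq0 (cst_cc r0 k0)). Qed.

(** The classical (q;q)_oo / (q^25;q^25)_oo = q (1/R(q^5) - 1 - R(q^5)). *)
Lemma quot25 (r : fps int) : r 0%N = 0 -> ee_ r 1 / ee_ r 25 = cc r 5 - r%:F - r%:F ^+ 2 / cc r 5.
Proof.
move=> r0.
have H1 : sT (r ^+ 1) * tT (r ^+ 1) = eul (r ^+ 1) * eul (r ^+ 5).
  by rewrite !expr1; exact: sT_tT.
have H2 : sT (r ^+ 5) * tT (r ^+ 5) = eul (r ^+ 5) * eul (r ^+ 25).
  have E : (r ^+ 5) ^+ 5 = r ^+ 25 by rewrite -exprM.
  by rewrite -E; exact: sT_tT (exp0 r0 (k := 5) isT).
have H3 : sT (r ^+ 1) * tT (r ^+ 1) = tT (r ^+ 5) ^+ 2 - r * (sT (r ^+ 5) * tT (r ^+ 5)) - r ^+ 2 * sT (r ^+ 5) ^+ 2.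
  by rewrite expr1; exact: lattice_25.
have L1 : ss_ r 1 * tt_ r 1 = ee_ r 1 * ee_ r 5.
  by rewrite !ttE !ssE !eeE; exact: lift_mul4 H1.
have L2 : ss_ r 5 * tt_ r 5 = ee_ r 5 * ee_ r 25.
  by rewrite !ttE !ssE !eeE; exact: lift_mul4 H2.
have L3 : ss_ r 1 * tt_ r 1 = tt_ r 5 ^+ 2 - r%:F * (ss_ r 5 * tt_ r 5) - r%:F ^+ 2 * ss_ r 5 ^+ 2.
  by rewrite !ttE !ssE; exact: lift_25 H3.
apply: (level25_quot L1 L2 L3 (ss_neq0 r0 _) (tt_neq0 r0 _) (ee_neq0 r0 _) (ee_neq0 r0 _)); by [].
Qed.

Section Level25.
Variable r : fps int.
Hypotheses (r0 : r 0%N = 0) (rn : r%:F != 0 :> K).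
Local Notation x := (xx_ r).
Local Notation y := (yy_ r).
Local Notation e := (ee_ r).

Lemma cc_pow (s : fps int) m k n : n = (m * k)%N -> cc (s ^+ m) k = cc s n.
Proof. by move=> nE; rewrite /cc (ss_pow s nE) (tt_pow s nE). Qed.

Lemma cc_opp_even k : ~~ odd k -> cc (- r) k = cc r k.
Proof. by move=> ok; rewrite /cc !ttE !ssE oppX_even. Qed.

Lemma cubic_x : cc r 10 ^+ 2 * cc r 5 ^+ 3 - r%:F ^+ 5 * cc r 5 ^+ 2 - cc r 10 ^+ 3 * cc r 5 - r%:F ^+ 5 * cc r 10 = 0.
Proof.
have := level25_cubic (exp0 r0 (k := 5) isT); rewrite /= -/(cc _ 1) -/(cc _ 2).
by rewrite (@cc_pow r 5 1 5 erefl) (@cc_pow r 5 2 10 erefl) !rmorphXn /=.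
Qed.

Lemma cubic_y : cc r 10 ^+ 2 * cc (- r) 5 ^+ 3 + r%:F ^+ 5 * cc (- r) 5 ^+ 2 - cc r 10 ^+ 3 * cc (- r) 5 + r%:F ^+ 5 * cc r 10 = 0.
Proof.
have := level25_cubic (exp0 (fpsN0 r0) (k := 5) isT); rewrite /= -/(cc _ 1) -/(cc _ 2).
rewrite (@cc_pow (- r) 5 1 5 erefl) (@cc_pow (- r) 5 2 10 erefl) (@cc_opp_even 10 isT).
by rewrite (@oppX r 5 isT) rmorphN !rmorphXn /= ?mulNr ?opprK.
Qed.

Lemma cubic_2 : cc r 20 ^+ 2 * cc r 10 ^+ 3 - (r%:F ^+ 5) ^+ 2 * cc r 10 ^+ 2 - cc r 20 ^+ 3 * cc r 10 - (r%:F ^+ 5) ^+ 2 * cc r 20 = 0.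
Proof.
have := level25_cubic (exp0 r0 (k := 10) isT); rewrite /= -/(cc _ 1) -/(cc _ 2).
by rewrite (@cc_pow r 10 1 10 erefl) (@cc_pow r 10 2 20 erefl) !rmorphXn /= -exprM.
Qed.

Lemma quot25_y : y 1 * e 2 / (y 25 * e 50) = cc (- r) 5 + r%:F - r%:F ^+ 2 / cc (- r) 5.
Proof.
have := quot25 (fpsN0 r0).
by rewrite (ee_opp r0 (k := 1) (n := 2) isT erefl) (ee_opp r0 (k := 25) (n := 50) isT erefl) rmorphN opprK sqrrN.
Qed.

Lemma quot25_2 : e 2 / e 50 = cc r 10 - r%:F ^+ 2 - r%:F ^+ 4 / cc r 10.
Proof.
have := quot25 (exp0 r0 (k := 2) isT).
by rewrite (@ee_pow r 2 1 2 erefl) (@ee_pow r 2 25 50 erefl) (@cc_pow r 2 5 10 erefl) !rmorphXn /= -exprM.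
Qed.

Lemma quot25_4 : e 4 / e 100 = cc r 20 - r%:F ^+ 4 - r%:F ^+ 8 / cc r 20.
Proof.
have := quot25 (exp0 r0 (k := 4) isT).
by rewrite (@ee_pow r 4 1 4 erefl) (@ee_pow r 4 25 100 erefl) (@cc_pow r 4 5 20 erefl) !rmorphXn /= -exprM.
Qed.

Lemma theta2_diff :
  r%:F ^+ 3 * (x 1 / x 25 - y 1 / y 25) + x 50 / x 2 = cc r 10 + r%:F ^+ 2 - r%:F ^+ 4 / cc r 10.
Proof.
have c5 := cst_cc r0 (k := 5) isT; have c5' := cst_cc (fpsN0 r0) (k := 5) isT.
have i20 := cstV (cst_cc r0 (k := 20) isT); have cr := cstX 5 (cst_r r0).
have [hd hv] : cc r 5 - cc (- r) 5 = r%:F ^+ 5 * (1 / cc r 10 ^+ 2 + 1 / cc r 20) /\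
   r%:F ^+ 5 * (1 / cc r 5 - 1 / cc (- r) 5) = cc r 20 - cc r 10 ^+ 2.
  apply: (level25_roots cubic_x cubic_y cubic_2).
  - exact: cc_neq0.
  - by apply: cc_neq0 => //; exact: fpsN0.
  - exact: cc_neq0.
  - exact: cc_neq0.
  - by rewrite expf_neq0.
  - exact: cst_neq0 (cstD c5 c5') isT.
  - exact: cst_neq0 (cstD c5 (cstM cr i20)) isT.
  - exact: cst_neq0 (cstD (cstN c5') (cstM cr i20)) isT.
apply: (level25_final (quot25 r0) quot25_y quot25_2 quot25_4 hd hv (ee_xx r0 (k := 1) (n := 2) isT erefl)
  (ee_xx r0 (k := 25) (n := 50) isT erefl) (ee_xx r0 (k := 2) (n := 4) isT erefl) (ee_xx r0 (k := 50) (n := 100) isT erefl)).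
- exact: cc_neq0.
- by apply: cc_neq0 => //; exact: fpsN0.
- exact: cc_neq0.
- exact: cc_neq0.
- exact: xx_neq0.
- exact: xx_neq0.
- exact: xx_neq0.
- exact: yy_neq0.
- exact: ee_neq0.
- exact: ee_neq0.
Qed.

End Level25.

(** * Extraction of coefficients *)

Local Notation q := (fpsX int).

Lemma q0 : q 0%N = 0. Proof. by []. Qed.
Lemma q_neq0 : q != 0. Proof. by apply/eqP => /(congr1 (fun f : fps int => f 1%N)). Qed.
Lemma qF_neq0 : q%:F != 0 :> K. Proof. by rewrite tofrac_eq0 q_neq0. Qed.

Definition chiq (k : nat) : fps int := chi (q ^+ k).

Lemma chiq_unit k : (0 < k)%N -> chiq k \is a GRing.unit.
Proof. by move=> k0; rewrite fps_unitE (chi0 (exp0 q0 k0)) unitr1. Qed.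

Lemma dil_chi c m k : (0 < k)%N -> dil c m (chiq k) = chi ((q ^+ m.+1 *~ c) ^+ k).
Proof.
move=> k0; rewrite /chiq /chi dil_qpoch; last by rewrite -exprM exp0 // muln_gt0 k0.
by rewrite !rmorphXn /= dil_X.
Qed.

(* F, F(-q) and F(q^2) in the field of fractions. *)
Definition emb : fps int -> K := fun f => f%:F.
Definition embN : fps int -> K := fun f => (dil (-1) 0 f)%:F.
Definition emb2 : fps int -> K := fun f => (dil 1 1 f)%:F.
HB.instance Definition _ := GRing.RMorphism.copy emb (@FracField.tofrac (fps int)).
HB.instance Definition _ := GRing.RMorphism.copy embN (@FracField.tofrac (fps int) \o dil (-1) 0).
HB.instance Definition _ := GRing.RMorphism.copy emb2 (@FracField.tofrac (fps int) \o dil 1 1).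

Lemma emb_chi k : emb (chiq k) = xx_ q k. Proof. by rewrite xxE. Qed.
Lemma embN_chi k : odd k -> embN (chiq k) = yy_ q k.
Proof.
move=> ok; rewrite /embN dil_chi ?yyE; last by case: k ok.
by rewrite expr1 mulrNz mulr1z oppX.
Qed.
Lemma emb2_chi k n : (0 < k)%N -> n = (2 * k)%N -> emb2 (chiq k) = xx_ q n.
Proof. by move=> k0 ->; rewrite /emb2 dil_chi // xxE mulr1z exprM. Qed.

Lemma embK (A F P Q : fps int) : F \is a GRing.unit ->
  emb A = emb P + emb Q / emb2 F -> A = P + Q * dil 1 1 F^-1.
Proof.
move=> uF h; apply: tofrac_inj; rewrite -/(emb A) h /emb2 -rmorphV ?rmorph_unit // -rmorphV //.
by rewrite -rmorphM -rmorphD.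
Qed.

Lemma dilN_coef (F : fps int) n : dil (-1) 0 F n = (-1) ^+ n * F n.
Proof. by rewrite -{1}(mul1n n) dil_coef. Qed.

Lemma dilXM_coef (d : int) j (G : fps int) n :
  ((q ^+ j *~ d) * dil 1 1 G) (2 * n + j)%N = d * G n.
Proof.
have jn : (2 * n + j < j)%N = false by lia.
rewrite mulrzAl fps_coefMz fpsXnM jn addnK (dil_coef 1 1) expr1n mul1r.
by rewrite -mulrzr intz mulrC.
Qed.

(** The term c q only affects the coefficient of q^1, hence the alternative in the hypotheses: the
    items with c nonzero start at q^3. *)
Lemma extract_odd (F : fps int) j (c d : int) n : F \is a GRing.unit -> odd j ->
  c = 0 \/ (2 * n + j)%N != 1%N ->
  emb F - embN F = c%:~R * emb q + d%:~R * emb q ^+ j / emb2 F ->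
  2 * F (2 * n + j)%N = d * F^-1 n.
Proof.
move=> uF oj cn h.
have h' : emb (F - dil (-1) 0 F) = emb (q *~ c) + emb (q ^+ j *~ d) / emb2 F.
  have e1 : emb (q *~ c) = c%:~R * emb q by rewrite rmorphMz mulrzl.
  have e2 : emb (q ^+ j *~ d) = d%:~R * emb q ^+ j by rewrite rmorphMz rmorphXn mulrzl.
  by rewrite e1 e2 -h rmorphB.
have : (F - dil (-1) 0 F) (2 * n + j)%N = (q *~ c + q ^+ j *~ d * dil 1 1 F^-1) (2 * n + j)%N.
  by rewrite (embK uF h').
rewrite fps_coefB fps_coefD dilN_coef dilXM_coef fps_coefMz.
have -> : (-1) ^+ (2 * n + j) = -1 :> int by rewrite -signr_odd oddD oj oddM.
have -> : q (2 * n + j)%N = ((2 * n + j)%N == 1%N)%:R by [].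
rewrite mulN1r opprK; case: cn => [->|/negbTE ->]; rewrite ?mulr0z ?mul0rz add0r => <-; by rewrite mulr_natl mulr2n.
Qed.

(** The constant c is visible only at n = 0. This is why (v) is shifted by one and why n = 0 is
    excluded in (vi) and (viii). *)
Lemma extract_even (F : fps int) (c d : int) n : F \is a GRing.unit ->
  c = 0 \/ n != 0%N ->
  emb F + embN F = c%:~R + d%:~R / emb2 F -> 2 * F (2 * n)%N = d * F^-1 n.
Proof.
move=> uF cn h.
have h' : emb (F + dil (-1) 0 F) = emb (1 *~ c) + emb (q ^+ 0 *~ d) / emb2 F.
  have e1 (z : int) : emb (1 *~ z) = z%:~R by rewrite rmorphMz rmorph1.
  by rewrite expr0 !e1 -h rmorphD.
have : (F + dil (-1) 0 F) (2 * n + 0)%N = (1 *~ c + q ^+ 0 *~ d * dil 1 1 F^-1) (2 * n + 0)%N.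
  by rewrite (embK uF h').
rewrite fps_coefD [in RHS]fps_coefD dilXM_coef fps_coefMz addn0 dilN_coef.
have -> : (-1) ^+ (2 * n) = 1 :> int by rewrite -signr_odd oddM.
have -> : (1 : fps int) (2 * n)%N = (n == 0%N)%:R by rewrite fps_coef1 muln_eq0.
have -> : (n == 0%N)%:R *~ c = 0 :> int.
  by case: cn => [->|/negbTE ->]; rewrite ?mulr0z ?mul0rz.
by rewrite mul1r add0r => <-; rewrite mulr_natl mulr2n.
Qed.

Section Images.
Variable f : {rmorphism fps int -> K}.

Lemma morph_quot (a b : fps int) m k : b \is a GRing.unit ->
  f (a ^+ m / b ^+ k) = f a ^+ m / f b ^+ k.
Proof. by move=> ub; rewrite rmorphM rmorphV ?unitrX // !rmorphXn. Qed.
End Images.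

Lemma qpoch_chiq k : qpoch (q ^+ k) (q ^+ (2 * k)) = chiq k.
Proof. by rewrite /chiq /chi -exprM mulnC. Qed.

Lemma qpoch_chiq1 : qpoch q (q ^+ 2) = chiq 1.
Proof. by rewrite -[1%N]muln1 -qpoch_chiq expr1. Qed.

Lemma muE m k : mu m k = chiq k ^+ (m * k) / chiq 1 ^+ m.
Proof. by rewrite /mu qpoch_chiq qpoch_chiq1. Qed.

Lemma nuE m k : nu m k = chiq 1 ^+ (m * k) / chiq k ^+ m.
Proof. by rewrite /nu qpoch_chiq qpoch_chiq1. Qed.

Lemma etaE k : eta k = chiq 1 ^+ 3 * chiq 9 ^+ 3 / chiq 3 ^+ (2 * k).
Proof. by rewrite /eta qpoch_chiq1 (qpoch_chiq 9) (qpoch_chiq 3). Qed.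

Lemma zetaE m k : zeta m k = chiq 1 ^+ k * chiq m ^+ k.
Proof. by rewrite /zeta qpoch_chiq qpoch_chiq1. Qed.

Lemma theta1E : theta1 = chiq 1 * chiq 3 * chiq 5 * chiq 15.
Proof. by rewrite /theta1 qpoch_chiq1 (qpoch_chiq 3) (qpoch_chiq 5) (qpoch_chiq 15). Qed.

Lemma theta2E : theta2 = chiq 1 / chiq 25.
Proof. by rewrite /theta2 qpoch_chiq1 (qpoch_chiq 25). Qed.

Lemma quot_unit (a b : fps int) m k : a \is a GRing.unit -> b \is a GRing.unit -> a ^+ m / b ^+ k \is a GRing.unit.
Proof. by move=> ua ub; rewrite unitrM unitrV !unitrX. Qed.

Lemma quot_emb a b m n : (0 < b)%N ->
  emb (chiq a ^+ m / chiq b ^+ n) = xx_ q a ^+ m / xx_ q b ^+ n.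
Proof. by move=> b0; rewrite -!emb_chi; exact: (morph_quot (emb : {rmorphism fps int -> K}) _ _ _ (chiq_unit b0)). Qed.

Lemma quot_embN a b m n : odd a -> odd b ->
  embN (chiq a ^+ m / chiq b ^+ n) = yy_ q a ^+ m / yy_ q b ^+ n.
Proof. move=> oa ob; rewrite -(embN_chi oa) -(embN_chi ob).
exact: (morph_quot (embN : {rmorphism fps int -> K}) _ _ _ (chiq_unit (odd_gt0 ob))). Qed.

Lemma quot_emb2 a b m n : (0 < a)%N -> (0 < b)%N ->
  emb2 (chiq a ^+ m / chiq b ^+ n) = xx_ q (2 * a) ^+ m / xx_ q (2 * b) ^+ n.
Proof.
move=> a0 b0; rewrite -(emb2_chi a0 erefl) -(emb2_chi b0 erefl).
exact: (morph_quot (emb2 : {rmorphism fps int -> K}) _ _ _ (chiq_unit b0)).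
Qed.

Lemma quot_odd a b m l j (c d : int) n : odd a -> odd b -> odd j ->
  c = 0 \/ (2 * n + j)%N != 1%N ->
  xx_ q a ^+ m / xx_ q b ^+ l - yy_ q a ^+ m / yy_ q b ^+ l =
    c%:~R * q%:F + d%:~R * q%:F ^+ j / (xx_ q (2 * a) ^+ m / xx_ q (2 * b) ^+ l) ->
  2 * (chiq a ^+ m / chiq b ^+ l) (2 * n + j)%N = d * (chiq a ^+ m / chiq b ^+ l)^-1 n.
Proof.
move=> oa ob oj cn h; have [a0 b0] := (odd_gt0 oa, odd_gt0 ob).
apply: (extract_odd (c := c) (quot_unit _ _ (chiq_unit a0) (chiq_unit b0)) oj cn).
by rewrite (quot_emb _ _ _ b0) (quot_embN _ _ oa ob) (quot_emb2 _ _ a0 b0); exact: h.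
Qed.

Lemma quot_even a b m l (c d : int) n : odd a -> odd b -> c = 0 \/ n != 0%N ->
  xx_ q a ^+ m / xx_ q b ^+ l + yy_ q a ^+ m / yy_ q b ^+ l =
    c%:~R + d%:~R / (xx_ q (2 * a) ^+ m / xx_ q (2 * b) ^+ l) ->
  2 * (chiq a ^+ m / chiq b ^+ l) (2 * n)%N = d * (chiq a ^+ m / chiq b ^+ l)^-1 n.
Proof.
move=> oa ob cn h; have [a0 b0] := (odd_gt0 oa, odd_gt0 ob).
apply: (extract_even (c := c) (quot_unit _ _ (chiq_unit a0) (chiq_unit b0)) cn).
by rewrite (quot_emb _ _ _ b0) (quot_embN _ _ oa ob) (quot_emb2 _ _ a0 b0); exact: h.
Qed.

Lemma half_eq (x y d e : int) : 2 * x = e * y -> e = 2 * d -> x = d * y.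
Proof. by move=> h ed; apply: (mulfI (x := 2)) => //; rewrite h ed mulrA. Qed.

Lemma mu13_coef n : mu 1 3 (2 * n + 1)%N = (mu 1 3)^-1 n.
Proof.
rewrite muE -[RHS]mul1r; apply: (half_eq (e := 2)) => //.
apply: (@quot_odd 3 1 3 1 1 0 2 n isT isT isT); first by left.
by rewrite (mu13_diff q0) mul0r add0r.
Qed.

Lemma mu15_coef n : mu 1 5 (2 * n + 3)%N = 2 * (mu 1 5)^-1 n.
Proof.
rewrite muE; apply: (half_eq (e := 4)) => //.
apply: (@quot_odd 5 1 5 1 3 2 4 n isT isT isT); first by right; lia.
exact: (mu15_diff q0 qF_neq0).
Qed.

Lemma nu13_coef n : nu 1 3 (2 * n)%N = (nu 1 3)^-1 n.
Proof.
rewrite nuE -[RHS]mul1r; apply: (half_eq (e := 2)) => //.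
apply: (@quot_even 1 3 3 1 0 2 n isT isT); first by left.
by rewrite (nu13_sum q0) add0r.
Qed.

Lemma nu15_coef n : nu 1 5 (2 * n + 2)%N = 2 * (nu 1 5)^-1 (n + 1)%N.
Proof.
have -> : (2 * n + 2 = 2 * (n + 1))%N by lia.
rewrite nuE; apply: (half_eq (e := 4)) => //.
apply: (@quot_even 1 5 5 1 (- 2) 4 (n + 1) isT isT); first by right; lia.
by rewrite mulrNz; exact: (nu15_sum q0 qF_neq0).
Qed.

Lemma cube_quot (F : fieldType) (a b : F) : (a ^+ 3 / b) ^+ 3 = a ^+ (3 * 3) / b ^+ 3.
Proof. by rewrite expr_div_n exprM. Qed.

Lemma cube_diff_coef (F : fieldType) (a P : F) : 3 * (2 * a) + (2 * a) ^+ 3 / P = 6%:~R * a + 8%:~R * a ^+ 3 / P.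
Proof. ring. Qed.

Lemma mu33_coef n : mu 3 3 (2 * n + 3)%N = 4 * (mu 3 3)^-1 n.
Proof.
rewrite muE; apply: (half_eq (e := 8)) => //.
apply: (@quot_odd 3 1 9 3 3 6 8 n isT isT isT); first by right; lia.
rewrite -[in RHS](cube_quot (xx_ q 6)) -cube_diff_coef -(mu33_diff q0).
by rewrite !cube_quot.
Qed.

Lemma nu33_coef n : (0 < n)%N -> nu 3 3 (2 * n)%N = 4 * (nu 3 3)^-1 n.
Proof.
move=> n0; rewrite nuE; apply: (half_eq (e := 8)) => //.
apply: (@quot_even 1 3 9 3 (- 6) 8 n isT isT); first by right; rewrite -lt0n.
rewrite mulrNz -[in RHS](cube_quot (xx_ q 2)); have := nu33_sum q0.
by rewrite (cube_quot (xx_ q 1)) (cube_quot (yy_ q 1)).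
Qed.

Lemma morph_eta (f : {rmorphism fps int -> K}) (a b c : fps int) k : c \is a GRing.unit ->
  f (a ^+ 3 * b ^+ 3 / c ^+ k) = f a ^+ 3 * f b ^+ 3 / f c ^+ k.
Proof. by move=> uc; rewrite !rmorphM rmorphV ?unitrX // !rmorphXn. Qed.

Lemma morph_zeta (f : {rmorphism fps int -> K}) (a b : fps int) k :
  f (a ^+ k * b ^+ k) = f a ^+ k * f b ^+ k.
Proof. by rewrite rmorphM !rmorphXn. Qed.

Lemma morph_theta (f : {rmorphism fps int -> K}) (a b c d : fps int) :
  f (a * b * c * d) = f a * f b * f c * f d.
Proof. by rewrite !rmorphM. Qed.

Lemma prod_unit (a b : fps int) k : a \is a GRing.unit -> b \is a GRing.unit -> a ^+ k * b ^+ k \is a GRing.unit.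
Proof. by move=> ua ub; rewrite unitrM !unitrX. Qed.

Lemma zeta_odd m k j (c d : int) n : odd m -> odd j -> c = 0 \/ (2 * n + j)%N != 1%N ->
  (xx_ q 1 * xx_ q m) ^+ k - (yy_ q 1 * yy_ q m) ^+ k =
    c%:~R * q%:F + d%:~R * q%:F ^+ j / (xx_ q 2 * xx_ q (2 * m)) ^+ k ->
  2 * zeta m k (2 * n + j)%N = d * (zeta m k)^-1 n.
Proof.
move=> om oj cn h; have m0 := odd_gt0 om.
have uF : zeta m k \is a GRing.unit by rewrite zetaE; exact: prod_unit (chiq_unit _) (chiq_unit m0).
apply: (extract_odd (c := c) uF oj cn).
have e1 : emb (zeta m k) = (xx_ q 1 * xx_ q m) ^+ k.
  by rewrite zetaE exprMn -!emb_chi; exact: (morph_zeta (emb : {rmorphism fps int -> K})).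
have e2 : embN (zeta m k) = (yy_ q 1 * yy_ q m) ^+ k.
  rewrite zetaE exprMn -(@embN_chi 1 isT) -(embN_chi om).
  exact: (morph_zeta (embN : {rmorphism fps int -> K})).
have e3 : emb2 (zeta m k) = (xx_ q 2 * xx_ q (2 * m)) ^+ k.
  rewrite zetaE exprMn -(@emb2_chi 1 2 isT erefl) -(emb2_chi m0 erefl).
  exact: (morph_zeta (emb2 : {rmorphism fps int -> K})).
by rewrite e1 e2 e3; exact: h.
Qed.

Lemma zeta32_coef n : zeta 3 2 (2 * n + 1)%N = - 2 * (zeta 3 2)^-1 n.
Proof.
apply: (half_eq (e := - 4)) => //.
apply: (@zeta_odd 3 2 1 0 (- 4) n isT isT); first by left.
by rewrite (zeta32_diff q0) oppr0 mul0r mulrNz [- _ * _]mulNr mulNr.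
Qed.

Lemma zeta54_shape (F : fieldType) (a b a' b' c d Q : F) :
  a ^+ 4 * b ^+ 4 - a' ^+ 4 * b' ^+ 4 = - (8 * Q) - 16 * Q ^+ 3 / (c ^+ 4 * d ^+ 4) ->
  (a * b) ^+ 4 - (a' * b') ^+ 4 = (- 8)%:~R * Q + (- 16)%:~R * Q ^+ 3 / (c * d) ^+ 4.
Proof. by rewrite !exprMn !mulrNz !mulNr. Qed.

Lemma zeta54_coef n : zeta 5 4 (2 * n + 3)%N = - 8 * (zeta 5 4)^-1 n.
Proof.
apply: (half_eq (e := - 16)) => //.
apply: (@zeta_odd 5 4 3 (- 8) (- 16) n isT isT); first by right; lia.
exact: zeta54_shape (zeta54_diff q0 qF_neq0).
Qed.

Lemma zeta71_coef n : zeta 7 1 (2 * n + 1)%N = - (zeta 7 1)^-1 n.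
Proof.
rewrite -mulN1r; apply: (half_eq (e := - 2)) => //.
apply: (@zeta_odd 7 1 1 0 (- 2) n isT isT); first by left.
by rewrite mul0r add0r mulrNz mulNr; exact: (zeta71_diff q0).
Qed.

Lemma zeta73_shape (F : fieldType) (P Q : F) :
  3 * - (2 * Q) + (- (2 * Q)) ^+ 3 / P = (- 6)%:~R * Q + (- 8)%:~R * Q ^+ 3 / P.
Proof. ring. Qed.

Lemma zeta73_coef n : zeta 7 3 (2 * n + 3)%N = - 4 * (zeta 7 3)^-1 n.
Proof.
apply: (half_eq (e := - 8)) => //.
apply: (@zeta_odd 7 3 3 (- 6) (- 8) n isT isT); first by right; lia.
by rewrite -zeta73_shape; exact: (zeta73_diff q0).
Qed.

Lemma zeta112_coef n : zeta 11 2 (2 * n + 3)%N = - 2 * (zeta 11 2)^-1 n.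
Proof.
apply: (half_eq (e := - 4)) => //.
apply: (@zeta_odd 11 2 3 (- 4) (- 4) n isT isT); first by right; lia.
by rewrite !mulrNz !mulNr; exact: (level11 q0).
Qed.

Lemma zeta231_coef n : zeta 23 1 (2 * n + 3)%N = - (zeta 23 1)^-1 n.
Proof.
rewrite -mulN1r; apply: (half_eq (e := - 2)) => //.
apply: (@zeta_odd 23 1 3 (- 2) (- 2) n isT isT); first by right; lia.
by rewrite !mulrNz !mulNr; exact: (level23 q0 q_neq0).
Qed.

Lemma eta_unit k : eta k \is a GRing.unit.
Proof.
rewrite etaE; have [u1 [u3 u9]] := (chiq_unit (k := 1) isT, (chiq_unit (k := 3) isT, chiq_unit (k := 9) isT)).
by move: (chiq 1) (chiq 3) (chiq 9) u1 u3 u9 => a b c ua ub uc; rewrite unitrM unitrV unitrM !unitrX.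
Qed.

Lemma eta_emb k : emb (eta k) = xx_ q 1 ^+ 3 * xx_ q 9 ^+ 3 / xx_ q 3 ^+ (2 * k).
Proof.
by rewrite etaE -!emb_chi; exact: (morph_eta (emb : {rmorphism fps int -> K}) _ _ _ (chiq_unit (k := 3) isT)).
Qed.

Lemma eta_embN k : embN (eta k) = yy_ q 1 ^+ 3 * yy_ q 9 ^+ 3 / yy_ q 3 ^+ (2 * k).
Proof.
rewrite etaE -(@embN_chi 1 isT) -(@embN_chi 9 isT) -(@embN_chi 3 isT).
exact: (morph_eta (embN : {rmorphism fps int -> K}) _ _ _ (chiq_unit (k := 3) isT)).
Qed.

Lemma eta_emb2 k : emb2 (eta k) = xx_ q 2 ^+ 3 * xx_ q 18 ^+ 3 / xx_ q 6 ^+ (2 * k).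
Proof.
rewrite etaE -(@emb2_chi 1 2 isT erefl) -(@emb2_chi 9 18 isT erefl) -(@emb2_chi 3 6 isT erefl).
exact: (morph_eta (emb2 : {rmorphism fps int -> K}) _ _ _ (chiq_unit (k := 3) isT)).
Qed.

Lemma eta1_coef n : eta 1 (2 * n + 3)%N = - 2 * (eta 1)^-1 n.
Proof.
apply: (half_eq (e := - 4)) => //.
apply: (@extract_odd _ 3 (- 6) (- 4) n (eta_unit 1) isT); first by right; lia.
by rewrite eta_emb eta_embN eta_emb2 !mulrNz !mulNr; exact: (eta1_diff q0).
Qed.

Lemma morph_inv (f : {rmorphism fps int -> K}) (a : fps int) : a \is a GRing.unit -> f a^-1 = (f a)^-1.
Proof. exact: rmorphV. Qed.

Lemma eta5_coef n : (0 < n)%N -> 2 * eta 5 n = - (eta 5)^-1 (2 * n)%N.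
Proof.
move=> n0; have uE := eta_unit 5; have uV : (eta 5)^-1 \is a GRing.unit by rewrite unitrV.
(* The extraction is applied to the reciprocal of eta_5, so the series whose reciprocal appears on
   the right is eta_5 itself. *)
have H : 2 * (eta 5)^-1 (2 * n)%N = - 4 * (eta 5)^-1^-1 n.
  apply: (@extract_even _ 6 (- 4) n uV); first by right; rewrite -lt0n.
  have e1 : emb (eta 5)^-1 = xx_ q 3 ^+ 10 / (xx_ q 1 ^+ 3 * xx_ q 9 ^+ 3).
    by rewrite -invf_div -(eta_emb 5); exact: (morph_inv (emb : {rmorphism fps int -> K}) uE).
  have e2 : embN (eta 5)^-1 = yy_ q 3 ^+ 10 / (yy_ q 1 ^+ 3 * yy_ q 9 ^+ 3).
    by rewrite -invf_div -(eta_embN 5); exact: (morph_inv (embN : {rmorphism fps int -> K}) uE).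
  have e3 : emb2 (eta 5)^-1 = xx_ q 6 ^+ 10 / (xx_ q 2 ^+ 3 * xx_ q 18 ^+ 3).
    by rewrite -invf_div -(eta_emb2 5); exact: (morph_inv (emb2 : {rmorphism fps int -> K}) uE).
  by rewrite e1 e2 e3 mulrNz mulNr; exact: (eta5_sum q0).
by rewrite invrK in H; move: H; move: ((eta 5)^-1 _) (eta 5 n) => a b; lia.
Qed.

Lemma theta1_shape (F : fieldType) (x1 x3 x5 x15 y1 y3 y5 y15 z1 z3 z5 z15 Q : F) :
  x1 * x15 * (x3 * x5) - y1 * y15 * (y3 * y5) = - (2 * Q) - 4 * Q ^+ 3 / (z1 * z15 * (z3 * z5)) ->
  x1 * x3 * x5 * x15 - y1 * y3 * y5 * y15 =
    (- 2)%:~R * Q + (- 4)%:~R * Q ^+ 3 / (z1 * z3 * z5 * z15).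
Proof.
have E (a b c d : F) : a * b * c * d = a * d * (b * c) by ring.
by move=> h; rewrite !mulrNz !mulNr !E h.
Qed.

Lemma unitr_mul4 (a b c d : fps int) : a \is a GRing.unit -> b \is a GRing.unit ->
  c \is a GRing.unit -> d \is a GRing.unit -> a * b * c * d \is a GRing.unit.
Proof. by move=> ua ub uc ud; rewrite !unitrM ua ub uc ud. Qed.

Lemma theta1_coef n : theta1 (2 * n + 3)%N = - 2 * theta1^-1 n.
Proof.
apply: (half_eq (e := - 4)) => //.
have uF : theta1 \is a GRing.unit.
  by rewrite theta1E; apply: unitr_mul4; exact: chiq_unit.
apply: (@extract_odd _ 3 (- 2) (- 4) n uF isT); first by right; lia.
have e1 : emb theta1 = xx_ q 1 * xx_ q 3 * xx_ q 5 * xx_ q 15.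
  by rewrite theta1E -!emb_chi; exact: (morph_theta (emb : {rmorphism fps int -> K})).
have e2 : embN theta1 = yy_ q 1 * yy_ q 3 * yy_ q 5 * yy_ q 15.
  rewrite theta1E -(@embN_chi 1 isT) -(@embN_chi 3 isT) -(@embN_chi 5 isT) -(@embN_chi 15 isT).
  exact: (morph_theta (embN : {rmorphism fps int -> K})).
have e3 : emb2 theta1 = xx_ q 2 * xx_ q 6 * xx_ q 10 * xx_ q 30.
  rewrite theta1E -(@emb2_chi 1 2 isT erefl) -(@emb2_chi 3 6 isT erefl) -(@emb2_chi 5 10 isT erefl) -(@emb2_chi 15 30 isT erefl).
  exact: (morph_theta (emb2 : {rmorphism fps int -> K})).
by rewrite e1 e2 e3; exact: theta1_shape (theta1_diff q0 qF_neq0).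
Qed.

Lemma dil_coef00 c k (A : fps int) : A 0%N = 0 -> dil c k A 0%N = 0.
Proof. by move=> a; rewrite -(muln0 k.+1) dil_coef a mulr0. Qed.

Lemma dil_th c k (A B : fps int) : A 0%N = 0 -> B 0%N = 0 ->
  dil c k (th A B) = th (dil c k A) (dil c k B).
Proof.
move=> a b; have ab : (A * B) 0%N = 0 by rewrite fps_coefM0 a mul0r.
rewrite (jacobi_triple a b) (jacobi_triple (dil_coef00 c k a) (dil_coef00 c k b)).
by rewrite !rmorphM /= !(dil_qpoch _ _ _ ab) !rmorphN rmorphM.
Qed.

Lemma dil9_pow j : dil 1 9 ((q ^+ 1) ^+ j) = (q ^+ 10) ^+ j.
Proof. by rewrite expr1 rmorphXn /= dil_X mulr1z. Qed.

Lemma dil9_sT : dil 1 9 (sT (q ^+ 1)) = sT (q ^+ 10).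
Proof.
rewrite /sT dil_th; [|exact: (expN0 q0 (k := 1) isT) | by rewrite -exprM; exact: (expN0 q0 (k := 4) isT) ].
by rewrite !rmorphN /= dil9_pow -{1}[q ^+ 1]expr1 dil9_pow expr1.
Qed.

Lemma dil9_tT : dil 1 9 (tT (q ^+ 1)) = tT (q ^+ 10).
Proof.
rewrite /tT dil_th; [|by rewrite -exprM; exact: (expN0 q0 (k := 2) isT) | by rewrite -exprM; exact: (expN0 q0 (k := 3) isT) ].
by rewrite !rmorphN /= !dil9_pow.
Qed.

(** A power series whose image under q |-> q^10 (the map [dil 1 9]) is [cc q 10]; this exhibits
    [cc q 10] and its inverse as supported on multiples of 10. *)
Definition rrq : fps int := tT (q ^+ 1) / sT (q ^+ 1).

Lemma sT_unit : sT (q ^+ 1) \is a GRing.unit.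
Proof.
have [f hf f1] := cst_ss q0 (k := 1) isT.
by move: hf; rewrite ssE => /tofrac_inj ->; rewrite fps_unitE f1.
Qed.

Lemma tT_unit : tT (q ^+ 1) \is a GRing.unit.
Proof.
have [f hf f1] := cst_tt q0 (k := 1) isT.
by move: hf; rewrite ttE => /tofrac_inj ->; rewrite fps_unitE f1.
Qed.

Lemma quot_unit1 (a b : fps int) : a \is a GRing.unit -> b \is a GRing.unit -> a / b \is a GRing.unit.
Proof. by move=> ua ub; rewrite unitrM unitrV ua ub. Qed.

Lemma morph_div1 (f : {rmorphism fps int -> K}) (a b : fps int) : b \is a GRing.unit ->
  f (a / b) = f a / f b.
Proof. by move=> ub; rewrite rmorphM rmorphV. Qed.

Lemma dil_div1 c k (a b : fps int) : b \is a GRing.unit ->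
  dil c k (a / b) = dil c k a / dil c k b.
Proof. by move=> ub; rewrite rmorphM /= rmorphV. Qed.

Lemma rrq_unit : rrq \is a GRing.unit.
Proof. exact: quot_unit1 tT_unit sT_unit. Qed.

Lemma rrq_emb : emb (dil 1 9 rrq) = cc q 10.
Proof.
have uS : dil 1 9 (sT (q ^+ 1)) \is a GRing.unit by apply: rmorph_unit; exact: sT_unit.
rewrite /rrq (dil_div1 _ _ _ sT_unit).
rewrite (morph_div1 (emb : {rmorphism fps int -> K}) _ uS) /cc ttE ssE.
by rewrite dil9_sT dil9_tT.
Qed.

Lemma lift_theta2 (Q F G H W V : fps int) :
  Q%:F ^+ 3 * (F%:F - G%:F) + H%:F = W%:F + Q%:F ^+ 2 - Q%:F ^+ 4 * V%:F :> K ->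
  (Q ^+ 3 * (F - G) + H)%:F = (W + Q ^+ 2 - Q ^+ 4 * V)%:F :> K.
Proof. by rewrite !(rmorphB, rmorphD, rmorphM, rmorphXn). Qed.

Lemma theta2_shape (F W : fps int) (xF xN xi c : K) :
  F \is a GRing.unit -> W \is a GRing.unit ->
  emb F = xF -> embN F = xN -> emb2 F = xi^-1 -> emb W = c ->
  q%:F ^+ 3 * (xF - xN) + xi = c + q%:F ^+ 2 - q%:F ^+ 4 / c ->
  q ^+ 3 * (F - dil (-1) 0 F) + dil 1 1 F^-1 = W + q ^+ 2 - q ^+ 4 * W^-1.
Proof.
move=> uF uW <- <- h2 <- h; apply: tofrac_inj.
have e2 : (dil 1 1 F^-1)%:F = xi.
  by rewrite -[xi]invrK -h2; exact: (morph_inv (emb2 : {rmorphism fps int -> K}) uF).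
have e3 : (W^-1)%:F = (W%:F)^-1 by exact: (morph_inv (emb : {rmorphism fps int -> K}) uW).
by apply: lift_theta2; rewrite e2 e3; exact: h.
Qed.

Lemma theta2_identity :
  q ^+ 3 * (theta2 - dil (-1) 0 theta2) + dil 1 1 theta2^-1 =
  dil 1 9 rrq + q ^+ 2 - q ^+ 4 * dil 1 9 rrq^-1.
Proof.
have u1 := chiq_unit (k := 1) isT; have u25 := chiq_unit (k := 25) isT.
have uF : theta2 \is a GRing.unit by rewrite theta2E; exact: quot_unit1 u1 u25.
have uW : dil 1 9 rrq \is a GRing.unit by apply: rmorph_unit; exact: rrq_unit.
have -> : dil 1 9 rrq^-1 = (dil 1 9 rrq)^-1 by apply: rmorphV; exact: rrq_unit.
apply: (theta2_shape uF uW _ _ _ rrq_emb (theta2_diff q0 qF_neq0)).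
- by rewrite theta2E -!emb_chi; exact: (morph_div1 (emb : {rmorphism fps int -> K})).
- rewrite theta2E -(@embN_chi 1 isT) -(@embN_chi 25 isT).
  exact: (morph_div1 (embN : {rmorphism fps int -> K})).
- rewrite invf_div theta2E -(@emb2_chi 1 2 isT erefl) -(@emb2_chi 25 50 isT erefl).
  exact: (morph_div1 (emb2 : {rmorphism fps int -> K})).
Qed.

(* The right-hand side of [theta2_identity] is supported on exponents
   congruent to 0, 2 or 4 modulo 10. *)
Lemma theta2_vanish m j : ~~ (10 %| 2 * m)%N -> ~~ (10 %| (2 * m - 4))%N -> (4 <= 2 * m)%N ->
  (2 * m = j + 3)%N -> 2 * theta2 j = - theta2^-1 m.
Proof.
move=> h1 h2 h3 mj.
have L : (q ^+ 3 * (theta2 - dil (-1) 0 theta2) + dil 1 1 theta2^-1) (2 * m)%N =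
    2 * theta2 j + theta2^-1 m.
  rewrite fps_coefD (fpsXnM 3) (dil_coef 1 1) expr1n mul1r fps_coefB dilN_coef.
  have -> : (2 * m < 3)%N = false by lia.
  have -> : (2 * m - 3 = j)%N by lia.
  have -> : (-1) ^+ j = -1 :> int by rewrite -signr_odd; have -> : odd j by lia.
  by rewrite mulN1r opprK mulr_natl mulr2n.
have R : (dil 1 9 rrq + q ^+ 2 - q ^+ 4 * dil 1 9 rrq^-1) (2 * m)%N = 0.
  rewrite fps_coefB fps_coefD (fpsXnM 4) (fpsXn_coef 2).
  have -> : (2 * m < 4)%N = false by lia.
  have -> : (2 * m == 2)%N = false by lia.
  by rewrite (dil_coefN 1 rrq h1) (dil_coefN 1 rrq^-1 h2).
by apply/eqP; rewrite -addr_eq0 -L theta2_identity R.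
Qed.

Lemma theta2_coef3 n : 2 * theta2 (10 * n + 3)%N = - theta2^-1 (5 * n + 3)%N.
Proof. by apply: theta2_vanish; lia. Qed.

Lemma theta2_coef5 n : 2 * theta2 (10 * n + 5)%N = - theta2^-1 (5 * n + 4)%N.
Proof. by apply: theta2_vanish; lia. Qed.

(* For f : fps int, [f n] is the coefficient of q^n in f and [f^-1 n] the one in
   its reciprocal.  Items (vi) and (viii) are false at n = 0 (they would read
   1 = 4 and 2 = -1), whence the hypothesis 0 < n in these two items. *)
Theorem theorem1p3 (n : nat) :
  (*    (i) *) mu 1 3 (2 * n + 1)%N = (mu 1 3)^-1 n /\
  (*   (ii) *) mu 3 3 (2 * n + 3)%N = 4 * (mu 3 3)^-1 n /\
  (*  (iii) *) mu 1 5 (2 * n + 3)%N = 2 * (mu 1 5)^-1 n /\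
  (*   (iv) *) nu 1 3 (2 * n)%N = (nu 1 3)^-1 n /\
  (*    (v) *) nu 1 5 (2 * n + 2)%N = 2 * (nu 1 5)^-1 (n + 1)%N /\
  (*   (vi) *) ((0 < n)%N -> nu 3 3 (2 * n)%N = 4 * (nu 3 3)^-1 n) /\
  (*  (vii) *) eta 1 (2 * n + 3)%N = - 2 * (eta 1)^-1 n /\
  (* (viii) *) ((0 < n)%N -> 2 * eta 5 n = - (eta 5)^-1 (2 * n)%N) /\
  (*   (ix) *) zeta 3 2 (2 * n + 1)%N = - 2 * (zeta 3 2)^-1 n /\
  (*    (x) *) zeta 5 4 (2 * n + 3)%N = - 8 * (zeta 5 4)^-1 n /\
  (*   (xi) *) zeta 7 1 (2 * n + 1)%N = - (zeta 7 1)^-1 n /\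
  (*  (xii) *) zeta 7 3 (2 * n + 3)%N = - 4 * (zeta 7 3)^-1 n /\
  (* (xiii) *) zeta 11 2 (2 * n + 3)%N = - 2 * (zeta 11 2)^-1 n /\
  (*  (xiv) *) zeta 23 1 (2 * n + 3)%N = - (zeta 23 1)^-1 n /\
  (*   (xv) *) theta1 (2 * n + 3)%N = - 2 * theta1^-1 n /\
  (*  (xvi) *) 2 * theta2 (10 * n + 3)%N = - theta2^-1 (5 * n + 3)%N /\
  (* (xvii) *) 2 * theta2 (10 * n + 5)%N = - theta2^-1 (5 * n + 4)%N.
Proof.
split; first exact: mu13_coef.
split; first exact: mu33_coef.
split; first exact: mu15_coef.
split; first exact: nu13_coef.
split; first exact: nu15_coef.
split; first exact: nu33_coef.
split; first exact: eta1_coef.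
split; first exact: eta5_coef.
split; first exact: zeta32_coef.
split; first exact: zeta54_coef.
split; first exact: zeta71_coef.
split; first exact: zeta73_coef.
split; first exact: zeta112_coef.
split; first exact: zeta231_coef.
split; first exact: theta1_coef.
by split; [exact: theta2_coef3 | exact: theta2_coef5].
Qed.
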